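(* Let $y\in C([0,T];H)$ be a solution of the state equation $\dot y(t)=Ay(t)+f(t,y(t))u(t)$, $t\in(0,T)$, $y(0)=y_0$, with $u$ being a given reference control $u_1\in C(0,T;U)$. Let $p\in C([0,T];H^* )$ be the corresponding (mild) solution of the adjoint problem $$\dot p(t)=-A^*p(t)-\big((f(t,y(t))u_1(t))_y\big)^*p(t)-(l_1)_y(y(t)),\qquad p(T)=m_y(y(T)).$$ Let $P\in C([0,T];U^* )$ be defined by $$P(t)\colon w\mapsto \langle p(t),f(t,y(t))w\rangle_{H^*,H},\qquad t\in[0,T].$$ Then the operator $P^\star(t)P(t)+R^\star$ has a bounded inverse, and with $$\Pi(t)=(P^\star(t)P(t)+R^\star)^{-1},\qquad t\in[0,T],$$ the optimal solution $u_{\mathrm{opt}}(\tau)$ of the problem of minimizing over $u\in U$ $$l_2(u;\tau)=\tfrac12\Big[\tfrac{dJ_1}{d\lambda^+}(\tau,u)-\alpha_d\Big]^2+\tfrac12\langle u,Ru\rangle_U$$ is given by $$u_{\mathrm{opt}}(\tau)=\Pi(\tau)\big[P^\star(\tau)P(\tau)u_1(\tau)+P^\star(\tau)\alpha_d\big]$$ for all $\tau\in[0,T]$.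
   Context: $H$ and $U$ are real separable Hilbert spaces with topological duals $H^*,U^*$; $\mathfrak L(U,H)$ is the space of bounded linear operators from $U$ to $H$; $\langle\cdot,\cdot\rangle_{X^*,X}$ is the dual pairing. For a bounded linear operator $B\colon X\to Y$ between Hilbert spaces, $B^*\colon Y^*\to X^*$ is the topological adjoint, $\langle B^*y^*,x\rangle_{X^*,X}=\langle y^*,Bx\rangle_{Y^*,Y}$, and $B^\star\colon Y\to X$ is the Hilbert space adjoint, $\langle B^\star y,x\rangle_X=\langle y,Bx\rangle_Y$. In particular $P(t)\colon U\to\mathbb R$ and $P^\star(t)\colon\mathbb R\to U$. Data: $T>0$ a fixed time horizon, $y_0\in H$, $\alpha_d<0$ a real parameter, a linear operator $A$ on $H$, $f\colon(0,T)\times H\to\mathfrak L(U,H)$, functionals $l_1,m\colon H\to\mathbb R$, and $R\colon U\to U$. Standing assumptions: $A$ is densely defined on $D(A)\subset H$ and generates a strongly continuous semigroup $e^{tA}$ on $H$. $l_1$ and $m$ are continuously Fréchet differentiable and uniformly bounded. For every $t\in(0,T)$, $f(t,\cdot)\colon H\to\mathfrak L(U,H)$ is continuously Fréchet differentiable; furthermore $f$ is linearly bounded or $T$ is sufficiently small. $R$ is bounded, self-adjoint and, for some $\gamma_R>0$, $\langle Ru,u\rangle_U\ge\gamma_R\|u\|_U^2$ for all $u\in U$. Solutions are mild solutions. The state satisfies $y(t)=e^{tA}y_0+\int_0^te^{(t-s)A}f(s,y(s))u(s)\,ds$. The adjoint satisfies $p(t)=e^{(T-t)A^*}p(T)+\int_t^Te^{(s-t)A^*}\big(((f(s,y(s))u_1(s))_y)^*p(s)+(l_1)_y(y(s))\big)ds$.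 The subscript $y$ denotes the Fréchet derivative with respect to $y$. Cost: for $u\in L^p(0,T;U)$ (some $p\ge1$), $J_1(u)=\int_0^Tl_1(y(s))\,ds+m(y(T))$, where $y$ is the mild solution of the state equation for the control $u$. Needle variation and mode insertion gradient: for $v\in U$, let $u_{\lambda,\tau,v}(t)=v$ for $t\in[\tau-\frac\lambda2,\tau+\frac\lambda2]$ and $u_{\lambda,\tau,v}(t)=u_1(t)$ otherwise; then $\frac{dJ_1}{d\lambda^+}(\tau,v)=\lim_{\lambda\downarrow0}\frac{J_1(u_{\lambda,\tau,v})-J_1(u_1)}{\lambda}$.
   Formalization: Added: f(·,x)w is strongly measurable in t, and f, f_y are bounded near each x uniformly in t (else dJ_1/dλ+ may be undefined or infinite). At τ=0 and τ=T the gradient is the limit from interior times, since the literal half needle gives a factor 1/2 and the formula fails. *)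

(* Defs.v *)
From HB Require Import structures.
From mathcomp Require Import all_boot all_order all_algebra.
From mathcomp Require Import all_classical all_reals all_analysis.

Set Implicit Arguments.
Unset Strict Implicit.
Unset Printing Implicit Defensive.

Import Order.TTheory GRing.Theory Num.Theory.
Import numFieldNormedType.Exports.

Local Open Scope classical_set_scope.
Local Open Scope ring_scope.

(** * Bounded linear operators, with the operator norm *)

Section bounded_operators.
Context {R : realType} {V W : normedModType R}.

Definition bop_pred (B : V -> W) : bool := `[< linear B /\ continuous B >].

Lemma bop_pred_closed : subsemimod_closed bop_pred.
Proof.
split; [split|].
- apply/asboolP; split; first by move=> a x y; rewrite scaler0 addr0.
  exact: cst_continuous.
- move=> B C /asboolP[lB cB] /asboolP[lC cC]; apply/asboolP; split.
    by move=> a x y; rewrite !fctE lB lC scalerDr addrACA.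
  by move=> x; exact: cvgD (cB x) (cC x).
- move=> a B /asboolP[lB cB]; apply/asboolP; split.
    by move=> b x y; rewrite !fctE lB scalerDr !scalerA mulrC.
  by move=> x; exact: cvgZr (cB x).
Qed.

HB.instance Definition _ := GRing.isSubmodClosed.Build R (V -> W) bop_pred
  bop_pred_closed.

Record bop := Bop { bop_fun :> V -> W ; bop_funP : bop_pred bop_fun }.

HB.instance Definition _ := [isSub for bop_fun].
HB.instance Definition _ := [Choice of bop by <:].
HB.instance Definition _ := [SubChoice_isSubLmodule of bop by <:].

End bounded_operators.
Arguments bop {R} V W.
Arguments Bop {R V W}.

Section operator_norm.
Context {R : realType} {V W : normedModType R}.
Implicit Types B C : bop V W.

Definition opnorm B : R := sup [set `|B x| | x in [set x : V | `|x| <= 1]].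

Lemma bop_linear B : linear B. Proof. by have /asboolP[] := bop_funP B. Qed.

Lemma bop_continuous B : continuous B.
Proof. by have /asboolP[] := bop_funP B. Qed.

Lemma bopE B C : (B : V -> W) =1 C -> B = C.
Proof. by move=> BC; apply: val_inj; exact/funext. Qed.

Lemma bop_addE B C x : (B + C) x = B x + C x. Proof. by []. Qed.

Lemma bop_scaleE a B x : (a *: B) x = a *: B x. Proof. by []. Qed.

Lemma bop0 B : B 0 = 0.
Proof. by have := bop_linear B (-1) 0 0; rewrite scaleN1r oppr0 addr0 scaleN1r addNr. Qed.

Lemma bopZ B a x : B (a *: x) = a *: B x.
Proof. by have := bop_linear B a x 0; rewrite !addr0 bop0 addr0. Qed.

Lemma opnorm_has_sup B :
  has_sup [set `|B x| | x in [set x : V | `|x| <= 1]].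
Proof.
split; first by exists `|B 0|, 0 => //=; rewrite normr0.
have /cvgrPdist_lt/(_ 1 ltr01)/nbhs_norm0P[e /= e0] := @bop_continuous B 0.
rewrite bop0 => eB.
exists (e / 2)^-1 => _ [x /= x1 <-].
have e20 : 0 < e / 2 by rewrite divr_gt0.
have : `|(e / 2) *: x| < e.
  rewrite normrZ gtr0_norm//.
  rewrite (le_lt_trans (ler_wpM2l (ltW e20) x1))// mulr1.
  by rewrite ltr_pdivrMr// ltr_pMr// ltr1n.
move=> /(eB ((e / 2) *: x)) /ltW.
rewrite sub0r normrN bopZ normrZ gtr0_norm//.
by rewrite -ler_pdivlMl// mulr1.
Qed.

Lemma opnorm_ge B x : `|B x| <= opnorm B * `|x|.
Proof.
have [->|x0] := eqVneq x 0; first by rewrite bop0 !normr0 mulr0.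
have nx : 0 < `|x| by rewrite normr_gt0.
rewrite -ler_pdivrMr//.
have <- : `|B (`|x|^-1 *: x)| = `|B x| / `|x|.
  by rewrite bopZ normrZ normfV normr_id mulrC.
apply: ub_le_sup; first by case: (opnorm_has_sup B).
by exists (`|x|^-1 *: x) => //=; rewrite normfZV.
Qed.

Lemma opnorm_le B M : (forall x, `|x| <= 1 -> `|B x| <= M) -> opnorm B <= M.
Proof.
move=> BM; apply: ge_sup; first by case: (opnorm_has_sup B).
by move=> _ [x /= x1 <-]; exact: BM.
Qed.

Lemma opnorm_ge0 B : 0 <= opnorm B.
Proof.
rewrite -(normr0 W) -(bop0 B); apply: ub_le_sup.
  by case: (opnorm_has_sup B).
by exists 0 => //=; rewrite normr0.
Qed.

Lemma opnorm_ge1 B x : `|x| <= 1 -> `|B x| <= opnorm B.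
Proof.
move=> x1; apply: ub_le_sup; first by case: (opnorm_has_sup B).
by exists x.
Qed.

Lemma opnormD B C : opnorm (B + C) <= opnorm B + opnorm C.
Proof.
apply: opnorm_le => x x1; rewrite bop_addE (le_trans (ler_normD _ _))//.
by rewrite lerD// opnorm_ge1.
Qed.

Let opnormZ_le a B : opnorm (a *: B) <= `|a| * opnorm B.
Proof.
apply: opnorm_le => x x1; rewrite bop_scaleE normrZ ler_wpM2l//.
exact: opnorm_ge1.
Qed.

Lemma opnormZ a B : opnorm (a *: B) = `|a| * opnorm B.
Proof.
apply/eqP; rewrite eq_le opnormZ_le/=.
have [->|a0] := eqVneq a 0; first by rewrite normr0 mul0r opnorm_ge0.
rewrite -ler_pdivlMl ?normr_gt0// -normfV.
by rewrite (le_trans _ (opnormZ_le _ _))// scalerA mulVf// scale1r.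
Qed.

Lemma opnorm0_eq0 B : opnorm B = 0 -> B = 0.
Proof.
move=> B0; apply: bopE => x; apply/eqP; rewrite -normr_le0.
by rewrite (le_trans (opnorm_ge B x))// B0 mul0r.
Qed.

HB.instance Definition _ := Lmodule_isNormed.Build R (bop V W)
  opnormD opnormZ opnorm0_eq0.

End operator_norm.

Section operator_algebra.
Context {R : realType}.

Lemma bop_comp_subproof (X Y Z : normedModType R) (B : bop Y Z) (C : bop X Y) :
  bop_pred (B \o C).
Proof.
apply/asboolP; split; first by move=> a x y; rewrite /= !bop_linear.
by move=> x; apply: continuous_comp; exact: bop_continuous.
Qed.

Definition bop_comp (X Y Z : normedModType R) (B : bop Y Z) (C : bop X Y) :
  bop X Z := Bop (B \o C) (bop_comp_subproof B C).

Definition is_bop_inverse (X : normedModType R) (B C : bop X X) : Prop :=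
  cancel B C /\ cancel C B.

(* The topological adjoint; the dual of X is [bop X R]. *)
Definition dual_adj (X Y : normedModType R) (B : bop X Y) (q : bop Y R) :
  bop X R := bop_comp q B.

End operator_algebra.

(** * Hilbert spaces *)

HB.mixin Record CompleteNormedModule_isHilbert (R : realType) V
    & CompleteNormedModule R V := {
  dot : V -> V -> R ;
  dotC : forall x y, dot x y = dot y x ;
  dotP : forall a x y z, dot (a *: x + y) z = a * dot x z + dot y z ;
  dotxx : forall x, dot x x = `|x| ^+ 2
}.

#[short(type="hilbertType")]
HB.structure Definition Hilbert (R : realType) :=
  {V of CompleteNormedModule R V & CompleteNormedModule_isHilbert R V}.

Section real_line.
Variable R : realType.

Let mul_dotP (a x y z : R) : (a *: x + y) * z = a * (x * z) + y * z.
Proof. by rewrite mulrDl -mulrA. Qed.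

Let mul_dotxx (x : R) : x * x = `|x| ^+ 2.
Proof. by rewrite real_normK ?num_real// expr2. Qed.

#[non_forgetful_inheritance]
HB.instance Definition _ := CompleteNormedModule_isHilbert.Build R R
  (@mulrC R) mul_dotP mul_dotxx.

End real_line.

Definition separable (T : topologicalType) : Prop :=
  exists2 D : set T, countable D & dense D.

(* The Hilbert space adjoint; it exists by the Riesz representation theorem,
   so the default value 0 is never used. *)
Definition hadj (R : realType) (X Y : hilbertType R) (B : bop X Y) : bop Y X :=
  xget 0 [set C : bop Y X | forall y x, dot (C y) x = dot y (B x)].

(** * Frechet derivatives as bounded operators *)

Section frechet.
Context {R : realType} {V W : normedModType R}.

(* If F is differentiable at x, the bounded operator underlying ['d F x]. *)
Definition frechet (F : V -> W) (x : V) : bop V W :=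
  xget 0 [set B : bop V W | (B : V -> W) = 'd F x].

Definition continuously_frechet (F : V -> W) : Prop :=
  (forall x, differentiable F x) /\ continuous (frechet F).

End frechet.

(** * Bochner integral *)

Section bochner.
Context {d : measure_display} {T : measurableType d} {R : realType}.
Variables (mu : {measure set T -> \bar R}) (V : normedModType R).

Record simple := Simple {
  simple_size : nat ;
  simple_set : 'I_simple_size -> set T ;
  simple_coef : 'I_simple_size -> V ;
  simple_measurable : forall i, measurable (simple_set i)
}.

Definition simple_fun (s : simple) (x : T) : V :=
  \sum_(i < simple_size s) \1_(simple_set i) x *: simple_coef i.

Definition simple_integrable (D : set T) (s : simple) : Prop :=
  forall i, (mu (D `&` @simple_set s i) < +oo)%E.

Definition simple_integral (D : set T) (s : simple) : V :=
  \sum_(i < simple_size s) fine (mu (D `&` simple_set i)) *: simple_coef i.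

Definition ae_limit (D N : set T) (s : nat -> simple) (g : T -> V) : Prop :=
  [/\ measurable N, mu N = 0%E &
      forall x, (D `\` N) x -> simple_fun (s n) x @[n --> \oo] --> g x].

Definition strongly_measurable (D : set T) (g : T -> V) : Prop :=
  exists s N, ae_limit D N s g.

(* [v] is the Bochner integral of [g] over [D]; the exceptional null set [N]
   is removed in the third clause because lebesgue_measure is not complete,
   so that the integrand there is a measurable function. *)
Definition is_bochner (D : set T) (g : T -> V) (v : V) : Prop :=
  exists s N, [/\ ae_limit D N s g,
    forall n, simple_integrable D (s n),
    (\int[mu]_(x in D `\` N) `|simple_fun (s n) x - g x|%R%:E)%E
      @[n --> \oo] --> 0%E
    & simple_integral D (s n) @[n --> \oo] --> v].

End bochner.

(** * Strongly continuous semigroups *)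

Section semigroups.
Context {R : realType} {X : normedModType R}.
Implicit Types (D : set X) (A : X -> X) (S : R -> bop X X).

Definition c0_semigroup S : Prop :=
  [/\ forall x, S 0 x = x,
      forall s t, 0 <= s -> 0 <= t -> forall x, S (s + t) x = S s (S t x) &
      forall x, S t x @[t --> 0^'+] --> x].

Definition linear_on D A : Prop :=
  forall a x y, D x -> D y -> D (a *: x + y) /\ A (a *: x + y) = a *: A x + A y.

(* The unbounded operator (D, A) is densely defined, linear, and is the
   infinitesimal generator of S. *)
Definition generates D A S : Prop :=
  [/\ dense D, linear_on D A, c0_semigroup S &
      forall x z, (h^-1 *: (S h x - x) @[h --> 0^'+] --> z) <->
                  (D x /\ A x = z)].

End semigroups.

Section unbounded_adjoint.
Context {R : realType} {X : normedModType R}.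
Variables (D : set X) (A : X -> X).

Definition adjoint_graph (q g : bop X R) : Prop :=
  forall x, D x -> g x = q (A x).

Definition adjoint_dom : set (bop X R) := [set q | exists g, adjoint_graph q g].

(* g is unique when D is dense. *)
Definition adjoint_op (q : bop X R) : bop X R := xget 0 (adjoint_graph q).

End unbounded_adjoint.

(** * The control system *)

Section control.
Context {R : realType} {H U : hilbertType R}.
Variables (T : R) (S : R -> bop H H) (f : R -> H -> bop U H) (y0 : H).
Variables (l1 m : H -> R).

Local Notation leb := (@lebesgue_measure R).

Definition mild_state (u : R -> U) (y : R -> H) : Prop :=
  {within `[0, T], continuous y} /\
  forall t, 0 <= t <= T ->
    exists2 z, is_bochner leb `]0, t[ (fun s => S (t - s) (f s (y s) (u s))) z
             & y t = S t y0 + z.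

(* [Sd] stands for the semigroup generated by the adjoint of A. *)
Definition mild_adjoint (Sd : R -> bop (bop H R) (bop H R)) (u : R -> U)
    (y : R -> H) (p : R -> bop H R) : Prop :=
  {within `[0, T], continuous p} /\
  forall t, 0 <= t <= T ->
    exists2 z, is_bochner leb `]t, T[
        (fun s => Sd (s - t)
           (dual_adj (frechet (fun x => f s x (u s)) (y s)) (p s)
            + frechet l1 (y s))) z
      & p t = Sd (T - t) (p T) + z.

Definition Lp_control (q : R) (u : R -> U) : Prop :=
  strongly_measurable leb `]0, T[ u /\
  (\int[leb]_(s in `]0%R, T[) (`|u s| `^ q)%R%:E < +oo)%E.

(* Mild solutions are unique up to their values outside [0, T], which do not
   enter the cost. *)
Definition state (u : R -> U) : R -> H :=
  xget (cst 0) [set y | mild_state u y].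

Definition cost (u : R -> U) : R :=
  \int[leb]_(s in `[0, T]) l1 (state u s) + m (state u T).

Definition needle (u : R -> U) (tau : R) (v : U) (lambda : R) : R -> U :=
  fun t => if tau - lambda / 2 <= t <= tau + lambda / 2 then v else u t.

Definition needle_quotient (u : R -> U) (tau : R) (v : U) (lambda : R) : R :=
  (cost (needle u tau v lambda) - cost u) / lambda.

(* Needles centred at an interior time.  At 0 and T only half of the needle
   lies in the time horizon, and the one-sided derivative there would carry a
   spurious factor 1/2; the gradient is extended continuously instead. *)
Definition insertion_limit (u : R -> U) (v : U) (tau : R) : R :=
  lim (needle_quotient u tau v lambda @[lambda --> 0^'+]).

Definition insertion_gradient (u : R -> U) (tau : R) (v : U) : R :=
  if 0 < tau < T then insertion_limit u v tau
  else lim (insertion_limit u v sigma @[sigma --> within `]0, T[ (nbhs tau)]).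

Definition has_insertion_gradient (u : R -> U) (tau : R) (v : U) : Prop :=
  if 0 < tau < T then cvg (needle_quotient u tau v lambda @[lambda --> 0^'+])
  else cvg (insertion_limit u v sigma @[sigma --> within `]0, T[ (nbhs tau)]).

Definition l2 (u1 : R -> U) (alpha_d : R) (Q : bop U U) (tau : R) (u : U) : R :=
  2^-1 * (insertion_gradient u1 tau u - alpha_d) ^+ 2 + 2^-1 * dot u (Q u).

(** ** Assumptions on f *)

Definition linearly_bounded : Prop :=
  exists c, forall t x, 0 < t < T -> `|f t x| <= c * (1 + `|x|).

(* T is so small that the state equation can be solved up to time T for all
   controls in a neighbourhood of u1 in L^q(0, T; U). *)
Definition small_horizon (q : R) (u1 : R -> U) : Prop :=
  exists2 rho, 0 < rho & forall u, Lp_control q u ->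
    (\int[leb]_(s in `]0%R, T[) (`|u s - u1 s| `^ q)%R%:E < rho%:E)%E ->
    exists y, mild_state u y.

(* Regularity of f in time, needed besides f t being C^1 for each t: without
   the first condition the integrands need not be measurable, without the
   second one the insertion gradient may be infinite. *)
Definition measurable_in_time : Prop :=
  forall x w, strongly_measurable leb `]0, T[ (fun t => f t x w).

Definition locally_bounded_C1 : Prop :=
  forall x, exists r M, 0 < r /\ forall t z, 0 < t < T -> `|z - x| < r ->
    `|f t z| <= M /\ `|frechet (f t) z| <= M.

End control.

(* Main.v *)
(* The needle of width lambda changes the control on a set of measure lambda, so
   by Gronwall's lemma the perturbed state Y stays within C lambda of y; Picard
   iteration in a tube around y, where f is bounded and Lipschitz, shows that Y
   exists.  With delta = Y - y, pairing the mild equation of delta with the mild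
   equation of p (Fubini) turns m'(y(T)) delta(T) + int l_1'(y) delta into
   int <p, f(Y)u - f(y)u_1 - f'(y) delta u_1>.  Outside the needle this integrand
   is a Taylor remainder, and on the needle it is P(s)(v - u_1(s)) up to
   O(lambda).  Dividing by lambda, the remainders vanish by dominated convergence
   and the average over the needle tends to P(tau)(v - u_1(tau)), which is
   therefore the mode insertion gradient.  So l_2 is a coercive quadratic
   function with second derivative P^* P + R and stationarity condition
   (P^* P + R) u = P^* P u_1 + P^* alpha_d.

   The semigroup generated by A^* is identified with the adjoint of e^(tA) on
   the domains of the generators, by telescoping; density does the rest. *)

Require Import Defs.
From HB Require Import structures.
From mathcomp Require Import all_boot all_order all_algebra.
From mathcomp Require Import all_classical all_reals all_analysis.
From mathcomp Require Import measurable_realfun ring lra.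

Set Implicit Arguments.
Unset Strict Implicit.
Unset Printing Implicit Defensive.

Import Order.TTheory GRing.Theory Num.Theory.
Import numFieldNormedType.Exports.

Local Open Scope classical_set_scope.
Local Open Scope ring_scope.

(** * Bounded operators and Hilbert spaces *)

(** Null sets shape the proof: each f(.,x)w is an almost everywhere limit of simple functions with
    its own null set, Lebesgue measure on Borel sets is not complete, and the Bochner integrals
    bring further null sets. All this is confined to one measurable set [E] of full measure in ]0,T[
    on which every f(.,x)w is Borel measurable. For the estimates, vector integrals are replaced by
    weak integrals over [E], known through their inner products with fixed vectors, and the
    semigroup is extended by 0 so that the domain of integration does not move with t;
    [mild_weakint] and [mild_bochner] translate in both directions.

    The integrands met on [E] are bounded, which makes integrability and domination automatic. The
    bounds come from a tube around y, obtained by compactness of its trajectory. Gronwall and Picard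
    both rest on the weight exp(2at), for which the Volterra operator with constant a has norm at
    most 1/2; hence the constants 2 and 2^-n. At tau = 0 and tau = T the gradient is the limit of
    its interior values, so continuity of P and u_1 settles these times. *)

Section sequences_of_vectors.
Context {R : realType} {V : normedModType R}.

Lemma cvgnP (x : nat -> V) (l : V) :
  x n @[n --> \oo] --> l <->
  (forall e : R, 0 < e -> exists N, forall n, (N <= n)%N -> `|x n - l| < e).
Proof.
split.
- move=> /cvgrPdist_lt xl e /xl[N _ xN]; exists N => n Nn.
  by rewrite distrC; exact: xN.
- move=> xl; apply/cvgrPdist_lt => e /xl[N xN]; exists N => // n /= Nn.
  by rewrite distrC; exact: xN.
Qed.

Lemma cvg_norm_sub0 (x : nat -> V) (l : V) :
  `|x n - l| @[n --> \oo] --> (0 : R) -> x n @[n --> \oo] --> l.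
Proof.
move=> h; apply/cvgnP => e e0; have /cvgrPdist_lt/(_ _ e0)[N _ xN] := h.
by exists N => n Nn; have := xN n Nn; rewrite sub0r normrN normr_id.
Qed.

Lemma squeeze0 (x : nat -> V) (l : V) (e : nat -> R) :
  (forall n, `|x n - l| <= e n) -> e n @[n --> \oo] --> (0 : R) ->
  x n @[n --> \oo] --> l.
Proof.
move=> xe e0; apply: cvg_norm_sub0.
apply: (@squeeze_cvgr _ _ _ _ (cst 0) e) => //; last exact: cvg_cst.
by near=> n; rewrite normr_ge0 xe.
Unshelve. all: by end_near. Qed.

Lemma harmonic_ltn (e : R) : 0 < e -> exists n, n.+1%:R^-1 < e.
Proof.
move=> e0; have /cvgrPdist_lt/(_ _ e0)[N _ /(_ N (leqnn N))] := @cvg_harmonic R.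
by move=> /= h; exists N; move: h; rewrite sub0r normrN gtr0_norm// invr_gt0.
Qed.

End sequences_of_vectors.

Lemma cauchy_seq_cvg (R : realType) (V : completeNormedModType R)
    (x : nat -> V) :
  (forall e : R, 0 < e -> exists N, forall n m, (N <= n)%N -> (N <= m)%N ->
     `|x n - x m| < e) -> exists l : V, x n @[n --> \oo] --> l.
Proof.
move=> xc; have : cauchy (x @ \oo).
  apply: cauchy_exP => e /xc[N xN]; exists (x N), N => // n /= Nn.
  by rewrite -ball_normE /=; exact: xN.
by move=> /cauchy_cvg h; exists (lim (x @ \oo)).
Qed.

Section bounded_operator_lemmas.
Context {R : realType}.
Implicit Types V W : normedModType R.

Lemma bopD V W (B : bop V W) x y : B (x + y) = B x + B y.
Proof. by have := bop_linear B 1 x y; rewrite !scale1r. Qed.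

Lemma bopN V W (B : bop V W) x : B (- x) = - B x.
Proof. by rewrite -scaleN1r bopZ scaleN1r. Qed.

Lemma bopB V W (B : bop V W) x y : B (x - y) = B x - B y.
Proof. by rewrite bopD bopN. Qed.

Lemma bop_sumE V W I (r : seq I) (B : bop V W) (F : I -> V) :
  B (\sum_(i <- r) F i) = \sum_(i <- r) B (F i).
Proof. by elim/big_rec2: _ => [|i y x _ <-]; rewrite ?bop0 ?bopD. Qed.

Lemma bop_subE V W (B C : bop V W) x : (B - C) x = B x - C x. Proof. by []. Qed.

Lemma bopE_norm V W (B : bop V W) x : `|B x| <= `|B| * `|x|.
Proof. exact: opnorm_ge. Qed.

Lemma bop_norm_le V W (B : bop V W) M :
  (forall x, `|B x| <= M * `|x|) -> 0 <= M -> `|B| <= M.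
Proof.
move=> BM M0; apply: opnorm_le => x x1; rewrite (le_trans (BM x))//.
by rewrite -[leRHS]mulr1 ler_wpM2l.
Qed.

Lemma lipschitz_bop_pred V W (f : V -> W) (C : R) :
  linear f -> (forall x, `|f x| <= C * `|x|) -> bop_pred f.
Proof.
move=> fl fC; apply/asboolP; split => //.
have fB x y : f x - f y = f (x - y).
  by rewrite (addrC x (- y)) -(scaleN1r y) fl scaleN1r addrC.
move=> x; apply/cvgrPdist_lt => e e0.
have C0 : 0 < `|C| + 1 by rewrite ltr_pwDr.
near=> z; rewrite fB (le_lt_trans (fC _))//.
rewrite (@le_lt_trans _ _ ((`|C| + 1) * `|x - z|))//.
  by rewrite ler_wpM2r// (le_trans (ler_norm C))// lerDl.
rewrite -ltr_pdivlMl//.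
by near: z; apply: cvgr_dist_lt => //; rewrite mulr_gt0// invr_gt0.
Unshelve. all: by end_near. Qed.

Definition lipschitz_bop V W (f : V -> W) (C : R) (fl : linear f)
  (fC : forall x, `|f x| <= C * `|x|) : bop V W :=
  Bop f (lipschitz_bop_pred fl fC).

Lemma eval_linear V W (x : V) : linear (fun B : bop V W => B x).
Proof. by move=> a B C; rewrite bop_addE bop_scaleE. Qed.

Lemma eval_bound V W (x : V) (B : bop V W) : `|B x| <= `|x| * `|B|.
Proof. by rewrite mulrC; exact: bopE_norm. Qed.

(** Turns norm convergence of operators into pointwise convergence, and tests integrals with values
    in a dual space at a single vector. *)
Definition eval_bop V W (x : V) : bop (bop V W) W :=
  lipschitz_bop (@eval_linear V W x) (eval_bound x).

Lemma bop_cvg V W (B : bop V W) T (F : set_system T) {FF : Filter F} (x : T -> V) l :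
  x n @[n --> F] --> l -> B (x n) @[n --> F] --> B l.
Proof. by move=> xl; apply: continuous_cvg => //; exact: bop_continuous. Qed.

End bounded_operator_lemmas.

Section hilbert.
Context {R : realType} {H : hilbertType R}.
Implicit Types x y z : H.

Lemma dotDl x y z : dot (x + y) z = dot x z + dot y z.
Proof. by have := dotP 1 x y z; rewrite scale1r mul1r. Qed.

Lemma dot0l z : dot 0 z = 0.
Proof. by have := dotDl 0 0 z; rewrite addr0; lra. Qed.

Lemma dotZl a x z : dot (a *: x) z = a * dot x z.
Proof. by have := dotP a x 0 z; rewrite addr0 dot0l addr0. Qed.

Lemma dotNl x z : dot (- x) z = - dot x z.
Proof. by rewrite -scaleN1r dotZl mulN1r. Qed.

Lemma dotBl x y z : dot (x - y) z = dot x z - dot y z.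
Proof. by rewrite dotDl dotNl. Qed.

Lemma dotDr x y z : dot z (x + y) = dot z x + dot z y.
Proof. by rewrite !(dotC z) dotDl. Qed.

Lemma dot0r z : dot z 0 = 0. Proof. by rewrite dotC dot0l. Qed.

Lemma dotZr a x z : dot z (a *: x) = a * dot z x.
Proof. by rewrite !(dotC z) dotZl. Qed.

Lemma dotNr x z : dot z (- x) = - dot z x.
Proof. by rewrite !(dotC z) dotNl. Qed.

Lemma dotBr x y z : dot z (x - y) = dot z x - dot z y.
Proof. by rewrite !(dotC z) dotBl. Qed.

Lemma cauchy_schwarz x y : `|dot x y| <= `|x| * `|y|.
Proof.
have [->|y0] := eqVneq y 0; first by rewrite dot0r !normr0 mulr0.
have ny : 0 < `|y| ^+ 2 by rewrite exprn_gt0// normr_gt0.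
rewrite -(@ler_pXn2r _ 2)// ?nnegrE ?mulr_ge0//.
rewrite real_normK ?num_real// exprMn.
(* The squared norm of |y|^2 x - <x,y> y is |y|^2 (|x|^2 |y|^2 - <x,y>^2); this scaling avoids
   division by |y|^2. *)
have : 0 <= dot (`|y| ^+ 2 *: x - dot x y *: y) (`|y| ^+ 2 *: x - dot x y *: y).
  by rewrite dotxx exprn_ge0.
rewrite dotBl !dotBr !dotZl !dotZr !dotxx (dotC y x).
set a := `|y| ^+ 2 in ny *; set b := dot x y; set c := `|x| ^+ 2.
rewrite [X in 0 <= X](_ : _ =
  a * (c * a - b ^+ 2)); last by rewrite -/b; ring.
by rewrite pmulr_rge0// subr_ge0.
Qed.

Lemma dot_linear x : linear (dot x).
Proof. by move=> a y z; rewrite dotDr dotZr. Qed.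

Definition dotb x : bop H R := lipschitz_bop (dot_linear x) (cauchy_schwarz x).

Lemma dot_inj x y : (forall h, dot h x = dot h y) -> x = y.
Proof.
move=> xy; apply/eqP; rewrite -subr_eq0 -normr_eq0.
by rewrite -[_ == 0]/(true && _) -(expf_eq0 _ 2) -dotxx dotBr xy subrr.
Qed.

Lemma dot_norm_le x M : 0 <= M -> (forall h, dot h x <= M * `|h|) -> `|x| <= M.
Proof.
move=> M0 /(_ x); rewrite dotxx expr2.
have [->|x0] := eqVneq x 0; first by rewrite normr0.
by rewrite ler_pM2r// normr_gt0.
Qed.

Lemma dot_norm_le_bop x M :
  0 <= M -> (forall h, `|dot h x| <= M * `|h|) -> `|x| <= M.
Proof.
by move=> M0 hx; apply: dot_norm_le => // h; exact: le_trans (ler_norm _) _.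
Qed.

(** First-order optimality in scalar form, applied on lines through a minimizer: once for
    [lax_milgram], once for the necessity part of [quadratic_minimizer]. *)
Lemma quadratic_ge0_linear0 (a b : R) :
  (forall t, 0 <= t ^+ 2 * b + 2 * t * a) -> a = 0.
Proof.
move=> h; apply/eqP/negPn/negP => a0.
have b1 : 0 < `|b| + 1 by rewrite ltr_pwDr.
(* At this t the value is a^2/(|b|+1)^2 times b - 2(|b|+1), and the last factor is negative whatever
   the sign of b. *)
have := h (- a / (`|b| + 1)).
have -> : (- a / (`|b| + 1)) ^+ 2 * b + 2 * (- a / (`|b| + 1)) * a =
   a ^+ 2 / (`|b| + 1) ^+ 2 * (b - 2 * (`|b| + 1)).
  by field; rewrite gt_eqF.
rewrite pmulr_rge0; last first.
  rewrite divr_gt0 ?(exprn_gt0 _ b1)// lt_def expf_neq0//.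
  by rewrite sqr_ge0.
by have := ler_norm b; lra.
Qed.

(** * Symmetric Lax-Milgram theorem by energy minimization *)

Section lax_milgram.
Variables (B : bop H H) (c : R) (phi : bop H R).
Hypothesis c_gt0 : 0 < c.
Hypothesis B_symmetric : forall x y, dot (B x) y = dot x (B y).
Hypothesis B_coercive : forall x, c * `|x| ^+ 2 <= dot (B x) x.

Let E x := dot (B x) x - 2 * phi x.

Let E_lb : lbound (range E) (- (`|phi| ^+ 2 / c)).
Proof.
move=> _ [x _ <-]; rewrite /E.
have h1 := B_coercive x; have h2 := le_trans (ler_norm _) (bopE_norm phi x).
(* Completing the square: this quantity minus |phi|^2/c is a lower bound of the energy. *)
have h3 : 0 <= (c * `|x| - `|phi|) ^+ 2 / c.
  by rewrite divr_ge0// ?sqr_ge0// ltW.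
have e : (c * `|x| - `|phi|) ^+ 2 / c =
   c * `|x| ^+ 2 - 2 * (`|phi| * `|x|) + `|phi| ^+ 2 / c.
  by field; rewrite gt_eqF.
by rewrite e in h3; lra.
Qed.

Let d := inf (range E).

Let E_ge x : d <= E x.
Proof.
by apply: ge_inf; [exists (- (`|phi| ^+ 2 / c)); exact: E_lb|exists x].
Qed.

(** The linear part of the energy cancels at the midpoint. As the midpoint has energy at least [d],
    coercivity bounds (c/2)|x-y|^2 by the sum of the excess energies of x and y, so minimizing
    sequences are Cauchy. *)
Let E_parallelogram x y : E x + E y - 2 * E (2^-1 *: (x + y)) =
  2^-1 * dot (B (x - y)) (x - y).
Proof.
rewrite /E !bopZ !(bopD, bopN) !(dotZl, dotZr, dotDl, dotDr, dotNl, dotNr).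
rewrite (dotC (B y) x) -B_symmetric.
set a := dot (B x) x; set b := dot (B x) y; set e := dot (B y) y.
rewrite -!/(dot (B x) y) -/b /GRing.scale /=; by field.
Qed.

(** The minimizer of the energy [E] solves the equation, which is its stationarity condition. With
    the identity for [B] this gives the Riesz representation; with P^* P + R it gives the inverse in
    the theorem. *)
Lemma lax_milgram : exists z, forall x, dot (B z) x = phi x.
Proof.
have infE : has_inf (range E).
  by split; [exists (E 0), 0|exists (- (`|phi| ^+ 2 / c)); exact: E_lb].
have /choice[x xE] : forall n, exists x, E x < d + n.+1%:R^-1.
  move=> n; have n0 : 0 < n.+1%:R^-1 :> R by rewrite invr_gt0.
  by have [_ [x _ <-] ?] := inf_adherent n0 infE; exists x.
have dist n m : `|x n - x m| ^+ 2 <= 2 / c * (n.+1%:R^-1 + m.+1%:R^-1).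
  have h := E_parallelogram (x n) (x m).
  have h1 := B_coercive (x n - x m).
  have := E_ge (2^-1 *: (x n + x m)); have := xE n; have := xE m => e1 e2 e3.
  rewrite mulrAC ler_pdivlMr//; move: h h1 e1 e2 e3.
  move: (E (x n)) (E (x m)) (E _) (dot _ _) n.+1%:R^-1 m.+1%:R^-1 => *.
  by lra.
have [e e0|z xz] := @cauchy_seq_cvg _ _ x.
  (* With 1/(N+1) below this threshold, 2/c times the sum of two such terms is below e^2. *)
  have e2 : 0 < e ^+ 2 * c / 4 by rewrite divr_gt0// mulr_gt0// exprn_gt0.
  have [N NE] := harmonic_ltn e2; exists N => n m Nn Nm.
  rewrite -(@ltr_pXn2r _ 2)// ?nnegrE ?(ltW e0)//.
  rewrite (le_lt_trans (dist n m))//.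
  have hN k : (N <= k)%N -> k.+1%:R^-1 <= N.+1%:R^-1 :> R.
    by move=> Nk; rewrite lef_pV2 ?posrE// ler_nat ltnS.
  have := hN _ Nn; have := hN _ Nm => a1 a2.
  rewrite mulrAC ltr_pdivrMr//; move: NE a1 a2.
  move: n.+1%:R^-1 m.+1%:R^-1 N.+1%:R^-1 => *.
  by lra.
have Ez : E z <= d.
  have Ex : E (x n) @[n --> \oo] --> E z.
    apply: cvgB; last by apply: cvgMr; exact: bop_cvg.
    rewrite -[X in _ --> X]/(dot (B z) z).
    apply: (@squeeze0 _ _ _ _ (fun n => (`|B| * `|x n| + `|B| * `|z|) * `|x n - z|)).
      move=> n.
      have -> : dot (B (x n)) (x n) - dot (B z) z =
          dot (B (x n)) (x n - z) + dot (x n - z) (B z).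
        by rewrite -B_symmetric bopB !(dotBl, dotBr); ring.
      rewrite (le_trans (ler_normD _ _))// mulrDl lerD//.
        by rewrite (le_trans (cauchy_schwarz _ _))// ler_wpM2r// bopE_norm.
      rewrite (le_trans (cauchy_schwarz _ _))// mulrC.
      by rewrite ler_wpM2r// bopE_norm.
    rewrite -[X in _ --> X](mulr0 (`|B| * `|z| + `|B| * `|z|)).
    apply: cvgM; first by apply: cvgD; [apply: cvgMr; exact: cvg_norm|exact: cvg_cst].
    rewrite -[X in _ --> X](@normr0 _ H) -(subrr z); apply: cvg_norm.
    by apply: cvgB => //; exact: cvg_cst.
  have h : d + n.+1%:R^-1 @[n --> \oo] --> d.
    by rewrite -[X in _ --> X]addr0; apply: cvgD; [exact: cvg_cst|exact: cvg_harmonic].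
  apply: (ler_cvg_to Ex h).
  by near=> n; exact: ltW (xE n).
exists z => w; apply/eqP; rewrite -subr_eq0; apply/eqP.
(* The energy at z + t w minus that at z is t^2 <Bw,w> + 2t(<Bz,w> - phi w), and z is a
   minimizer. *)
apply: (@quadratic_ge0_linear0 _ (dot (B w) w)) => t.
have := E_ge (z + t *: w); rewrite /E in Ez *.
rewrite !bopD !bopZ !(dotDl, dotDr, dotZl, dotZr) => h.
have e : dot (B w) z = dot (B z) w by rewrite B_symmetric dotC.
rewrite e in h.
rewrite -[t *: phi w]/(t * phi w) in h.
by lra.
Unshelve. all: by end_near. Qed.

End lax_milgram.

Definition idb : bop H H := Bop idfun ltac:(by apply/asboolP; split => // x; exact: cvg_id).

Lemma riesz (phi : bop H R) : exists z, forall x, dot z x = phi x.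
Proof.
have [||z zE] := @lax_milgram idb 1 phi ltr01.
- by [].
- by move=> x; rewrite mul1r -dotxx.
- by exists z.
Qed.

Lemma riesz_fun (phi : H -> R) M : linear phi ->
  (forall x, `|phi x| <= M * `|x|) -> exists z, forall x, dot x z = phi x.
Proof.
move=> l b; have [z zE] := riesz (lipschitz_bop l b).
by exists z => x; rewrite dotC zE.
Qed.

Lemma dotb_norm x : `|dotb x| = `|x|.
Proof.
apply/eqP; rewrite eq_le; apply/andP; split.
  by apply: bop_norm_le => // y; exact: cauchy_schwarz.
apply: dot_norm_le_bop => // h; rewrite dotC; exact: (bopE_norm (dotb x)).
Qed.

End hilbert.

(** * Measurability of vector-valued functions *)

Section dense_enumeration.
Context {R : realType} {V : normedModType R}.

Lemma dense_norm (D : set V) (v : V) (e : R) : dense D -> 0 < e ->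
  exists2 w, D w & `|v - w| < e.
Proof.
move=> dD e0; have [|w [/= bw Dw]] := dD (ball v e) _ (@ball_open _ _ v e).
  by exists v; exact: ballxx.
by exists w => //; rewrite -ball_normE in bw.
Qed.

Lemma separable_enum : separable V -> exists e : nat -> V,
  e 0%N = 0 /\ forall v (r : R), 0 < r -> exists k, `|v - e k| < r.
Proof.
move=> [D cD dD]; have [D0|/set0P D0] := eqVneq D set0.
  by have [w] := dense_norm 0 dD ltr01; rewrite D0.
have /pfcard_geP[D0'|/unsquash g] := cD; first by case: D0 => x; rewrite D0'.
exists (fun n => if n is k.+1 then g k else 0); split => // v r /(dense_norm v dD).
by move=> [w /(@surj _ _ _ _ g)[k _ <-] wr]; exists k.+1.
Qed.

End dense_enumeration.

Lemma separable_real (R : realType) : separable R.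
Proof.
exists (range ratr); last exact: dense_rat.
by apply: (card_le_trans (card_image_le _ _)); exact: countableP.
Qed.

(* Borel measurability of a vector-valued function, tested on the distances to
   fixed vectors; for a separable target this is measurability for the Borel
   sets, and it is visibly stable under pointwise limits. *)
Definition dmeas d (T : measurableType d) (R : realType) (V : normedModType R)
  (D : set T) (g : T -> V) := forall v, measurable_fun D (fun x => `|g x - v|).

Section dmeas_basic.
Context {d} {T : measurableType d} {R : realType} {V : normedModType R}.
Implicit Types (D : set T) (g : T -> V).

Lemma dmeas_cst D (c : V) : dmeas D (fun=> c).
Proof. by move=> v; exact: measurable_cst. Qed.

Lemma eq_dmeas D g1 g2 : (forall x, D x -> g1 x = g2 x) -> dmeas D g1 -> dmeas D g2.
Proof.
move=> g12 m1 v; apply: eq_measurable_fun (m1 v) => x.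
by rewrite inE => /g12 ->.
Qed.

Lemma dmeasS D E g : measurable D -> E `<=` D -> dmeas D g -> dmeas E g.
Proof. by move=> mD ED mg v; exact: measurable_funS (mg v). Qed.

Lemma dmeas_lim D (g_ : nat -> T -> V) g : (forall n, dmeas D (g_ n)) ->
  (forall x, D x -> g_ n x @[n --> \oo] --> g x) -> dmeas D g.
Proof.
move=> mg gg v.
apply: (@measurable_fun_cvg _ _ _ D (fun n x => `|g_ n x - v|)) => [n|x Dx].
  exact: mg.
by apply: cvg_norm; apply: cvgB; [exact: gg|exact: cvg_cst].
Qed.

Lemma dmeas_norm D g : dmeas D g -> measurable_fun D (fun x => `|g x|).
Proof. by move=> /(_ 0); under eq_fun do rewrite subr0. Qed.

Lemma dmeas_if D (b : T -> bool) g1 g2 : measurable D -> measurable_fun D b ->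
  dmeas D g1 -> dmeas D g2 -> dmeas D (fun x => if b x then g1 x else g2 x).
Proof.
move=> mD mb m1 m2 v.
rewrite [X in measurable_fun _ X](_ : _ =
  (fun x => if b x then `|g1 x - v| else `|g2 x - v|)); last first.
  by apply/funext => x; case: ifP.
by apply: measurable_fun_if => //; apply: measurable_funS (mD) _ _ => //.
Qed.

(** Countable pasting along the level sets of [k]; with [nearest] as [k] it makes the finite-valued
    approximations below measurable. *)
Lemma measurable_fun_switch D (k : T -> nat) (F : nat -> T -> R) :
  (forall n, measurable (D `&` [set x | k x = n])) ->
  (forall n, measurable_fun D (F n)) -> measurable_fun D (fun x => F (k x) x).
Proof.
move=> mk mF mD Y mY.
rewrite [X in measurable X](_ : _ = \bigcup_n ((D `&` [set x | k x = n]) `&`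
   (D `&` F n @^-1` Y))); last first.
  apply/seteqP; split => [x [Dx Yx]|x [n _ [[Dx <-] [_ Yx]]]] //.
  by exists (k x).
by apply: bigcupT_measurable => n; apply: measurableI; [exact: mk|exact: mF].
Qed.

Lemma dmeas_switch D (k : T -> nat) (F : nat -> T -> V) :
  (forall n, measurable (D `&` [set x | k x = n])) ->
  (forall n, dmeas D (F n)) -> dmeas D (fun x => F (k x) x).
Proof.
move=> mk mF v; apply: (@measurable_fun_switch D k (fun n x => `|F n x - v|)) => //.
by move=> n; exact: mF.
Qed.

(** Works in every normed space, in particular in spaces of operators: removing one more term
    changes the function by a constant vector on a measurable set, which only shifts the test vector
    there. *)
Lemma dmeasB_simple D g (s : @simple d T R V) : measurable D -> dmeas D g ->
  dmeas D (fun x => g x - simple_fun s x).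
Proof.
case: s => n A c mA mD mg; rewrite /simple_fun /=; elim: n A c mA => [|n IH] A c mA.
  by move=> v; under eq_fun do rewrite big_ord0 subr0; exact: mg.
pose s x := \sum_(i < n) \1_(A (widen_ord (leqnSn n) i)) x *:
  c (widen_ord (leqnSn n) i).
have mIH : dmeas D (fun x => g x - s x).
  by apply: (IH (A \o widen_ord (leqnSn n)) (c \o widen_ord (leqnSn n))) => i; exact: mA.
apply: (@eq_dmeas D (fun x => if x \in A ord_max then g x - s x - c ord_max
  else g x - s x)).
  move=> x _; rewrite big_ord_recr /= indicE -/(s x).
  by case: ifP => _; rewrite ?scale1r ?opprD ?addrA// scale0r subr0.
apply: dmeas_if => //.
  apply: (measurable_funS measurableT) => //; apply: (measurable_fun_bool true).
  rewrite setTI (_ : _ @^-1` _ = A ord_max)//.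
  by apply/seteqP; split => x /= h; [exact: set_mem|exact: mem_set].
move=> v; have := mIH (c ord_max + v).
by apply: eq_measurable_fun => x _; rewrite opprD addrA.
Qed.

Lemma dmeas_simple D (s : @simple d T R V) : measurable D ->
  dmeas D (simple_fun s).
Proof.
move=> mD v; have := dmeasB_simple s mD (@dmeas_cst D 0) (- v).
by apply: eq_measurable_fun => x _; rewrite sub0r -opprD normrN.
Qed.

Lemma ae_limit_dmeas (mu : {measure set T -> \bar R}) D N s g : measurable D ->
  ae_limit mu D N s g -> dmeas (D `\` N) g.
Proof.
move=> mD [mN _ sg]; apply: (@dmeas_lim _ (fun n => simple_fun (s n))) => // n.
by apply: dmeas_simple; exact: measurableD.
Qed.

End dmeas_basic.

Section nearest.
Context {d} {T : measurableType d} {R : realType} {V : normedModType R}.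
Variables (e : nat -> V) (D : set T) (g : T -> V).
Hypothesis e_dense : forall v (r : R), 0 < r -> exists k, `|v - e k| < r.
Hypotheses (mD : measurable D) (mg : dmeas D g).

(** Index of the point among e 0, ..., e n closest to [g x]; the strict comparison keeps the earlier
    index in a tie, so the choice is definite. *)
Fixpoint nearest (n : nat) (x : T) : nat :=
  if n is m.+1 then
    if `|g x - e n| < `|g x - e (nearest m x)| then n else nearest m x
  else 0%N.

Lemma nearest_leq n x : (nearest n x <= n)%N.
Proof. by elim: n => //= n IH; case: ifP => // _; rewrite leqW. Qed.

Lemma nearest_le n k x : (k <= n)%N -> `|g x - e (nearest n x)| <= `|g x - e k|.
Proof.
elim: n => [|n IH] /=; first by rewrite leqn0 => /eqP ->.
rewrite leq_eqVlt => /predU1P[->|]; first by case: ifP => // /negbT; rewrite -leNgt.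
rewrite ltnS => /IH h; case: ifP => // /ltW /le_trans; exact.
Qed.

Lemma nearest_cvg x : e (nearest n x) @[n --> \oo] --> g x.
Proof.
apply/cvgnP => r r0; have [k kr] := e_dense (g x) r0; exists k => n kn.
by rewrite distrC (le_lt_trans (nearest_le _ kn)).
Qed.

(** The level sets for n+1 arise from those for n by cutting along the set [L] where the new point
    is strictly closer; the distance to the current nearest point is measurable by pasting. *)
Lemma measurable_nearest n j : measurable (D `&` [set x | nearest n x = j]).
Proof.
elim: n j => [|n IH] j /=.
  have [->|j0] := eqVneq j 0%N; first by rewrite (_ : [set x | _] = setT) ?setIT//;
    apply/seteqP; split.
  rewrite (_ : _ `&` _ = set0)// -subset0 => x [_ /= j00].
  by rewrite -j00 eqxx in j0.
pose L := D `&` [set x | `|g x - e n.+1| < `|g x - e (nearest n x)|].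
have mL : measurable L.
  have : measurable_fun D (fun x => `|g x - e n.+1| < `|g x - e (nearest n x)|).
    apply: measurable_fun_ltr; first exact: mg.
    apply: (@measurable_fun_switch _ _ _ D (nearest n) (fun m x => `|g x - e m|)) => //.
  move=> /(_ mD [set true] I); congr (measurable _).
rewrite (_ : _ `&` _ = (if j == n.+1 then L else set0) `|`
  ((D `&` [set x | nearest n x = j]) `\` L)).
  apply: measurableU; first by case: ifP.
  exact: measurableD.
apply/seteqP; split => x /=.
- move=> [Dx]; case: ifP => h.
    by move=> <-; rewrite eqxx; left.
  by move=> nj; right; split => // -[_ /=]; rewrite h.
- case.
    by case: ifP => // /eqP -> [Dx /= ->].
  move=> [[Dx nj] /not_andP[//|/= /negP/negbTE h]]; split => //.
  by rewrite h.
Qed.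

End nearest.

Section caratheodory.
Context {d} {T : measurableType d} {R : realType} {V W : normedModType R}.
Hypothesis sepV : separable V.

(** Replacing g by its nearest point among e 0, ..., e n pastes the measurable sections F(.,e k);
    continuity in the second argument passes to the limit. *)
Lemma caratheodory (D : set T) (F : T -> V -> W) (g : T -> V) : measurable D ->
  (forall v, dmeas D (F^~ v)) ->
  (forall x, D x -> forall (v : nat -> V) l,
    v n @[n --> \oo] --> l -> F x (v n) @[n --> \oo] --> F x l) ->
  dmeas D g -> dmeas D (fun x => F x (g x)).
Proof.
move=> mD mF cF mg; have [e [_ ed]] := separable_enum sepV.
apply: (@dmeas_lim _ _ _ _ _ (fun n x => F x (e (nearest e g n x)))).
  move=> n; apply: (@dmeas_switch _ _ _ _ D (nearest e g n) (fun m x => F x (e m))).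
    by move=> m; exact: measurable_nearest.
  by move=> m; exact: mF.
by move=> x Dx; apply: cF => //; exact: nearest_cvg ed _.
Qed.

Lemma dmeas_bop (D : set T) (B : T -> bop V W) (g : T -> V) : measurable D ->
  (forall v, dmeas D (fun x => B x v)) -> dmeas D g -> dmeas D (fun x => B x (g x)).
Proof.
move=> mD mB mg; apply: (@caratheodory _ (fun x v => B x v)) => //.
by move=> x _ v l; exact: bop_cvg.
Qed.

Lemma dmeas_bop_cst (D : set T) (B : bop V W) (g : T -> V) : measurable D ->
  dmeas D g -> dmeas D (fun x => B (g x)).
Proof.
move=> mD mg; apply: (@dmeas_bop D (fun=> B)) => // v; exact: dmeas_cst.
Qed.

End caratheodory.

Section dmeas_algebra.
Context {d} {T : measurableType d} {R : realType} {V : normedModType R}.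
Hypothesis sepV : separable V.
Variables (D : set T).
Hypothesis mD : measurable D.

(** Read as a Caratheodory function v -> g x - v, whose distance to w is the distance of g x to v +
    w. *)
Lemma dmeasB (g h : T -> V) :
  dmeas D g -> dmeas D h -> dmeas D (fun x => g x - h x).
Proof.
move=> mg mh; apply: (@caratheodory _ _ _ _ _ sepV D (fun x v => g x - v)) => //.
  move=> v w; have := mg (v + w); apply: eq_measurable_fun => x _.
  by rewrite opprD addrA.
by move=> x _ v l vl; apply: cvgB => //; exact: cvg_cst.
Qed.

Lemma dmeasZ (a : R) (h : T -> V) : dmeas D h -> dmeas D (fun x => a *: h x).
Proof.
move=> mh; apply: (@caratheodory _ _ _ _ _ sepV D (fun x v => a *: v)) => //.
  by move=> v; exact: dmeas_cst.
by move=> x _ v l vl; exact: cvgZr.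
Qed.

Lemma dmeasD (g h : T -> V) :
  dmeas D g -> dmeas D h -> dmeas D (fun x => g x + h x).
Proof.
move=> mg mh; apply: (@eq_dmeas _ _ _ _ _ (fun x => g x - (-1) *: h x)).
  by move=> x _; rewrite scaleN1r opprK.
by apply: dmeasB => //; exact: dmeasZ.
Qed.

End dmeas_algebra.

Section dmeas_real.
Context {d} {T : measurableType d} {R : realType}.

Lemma dmeas_realP (D : set T) (g : T -> R) : dmeas D g <-> measurable_fun D g.
Proof.
split=> [mg|mg v]; last first.
  by apply: measurableT_comp => //; apply: measurable_funB => //; exact: measurable_cst.
(* As soon as n exceeds |g x|, the distance of g x to -n is g x + n, so g is recovered from
   distances. *)
apply: (@measurable_fun_cvg _ _ _ D (fun n x => `|g x - - n%:R| - n%:R)).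
  by move=> n; apply: measurable_funB; [exact: mg|exact: measurable_cst].
move=> x Dx; apply/cvgnP => r r0; exists (Num.truncn `|g x|).+1 => n xn.
suff -> : `|g x - - n%:R| - n%:R - g x = 0 by rewrite normr0.
have h : `|g x| < n%:R.
  by rewrite (lt_le_trans (truncnS_gt _))// ler_nat.
rewrite ger0_norm; first by ring.
by move: h; rewrite ltr_norml opprK => /andP[]; lra.
Qed.

Lemma measurable_bop (V : normedModType R) (D : set T) (B : T -> bop V R) (g : T -> V) :
  separable V -> measurable D ->
  (forall v, measurable_fun D (fun x => B x v)) -> dmeas D g ->
  measurable_fun D (fun x => B x (g x)).
Proof.
move=> sV mD mB mg; apply/dmeas_realP; apply: dmeas_bop => // v.
by apply/dmeas_realP; exact: mB.
Qed.

Lemma dmeas_continuous (V : normedModType R) (a b : R) (g : R -> V) :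
  {within `[a, b], continuous g} -> dmeas `[a, b]%classic g.
Proof.
move=> cg v; apply: subspace_continuous_measurable_fun => //.
by move=> x; apply: cvg_norm; apply: cvgB; [exact: cg|exact: cvg_cst].
Qed.

End dmeas_real.

(** * Bochner integrals *)

Section bounded_integrals.
Context {d} {T : measurableType d} {R : realType} (mu : {measure set T -> \bar R}).
Variable (E : set T).
Hypotheses (mE : measurable E) (finE : (mu E < +oo)%E).

Lemma bounded_integrable (f : T -> R) (M : R) : measurable_fun E f ->
  (forall x, E x -> `|f x| <= M) -> mu.-integrable E (EFin \o f).
Proof.
move=> mf fM; apply: measurable_bounded_integrable => //; exists M; split.
  exact: num_real.
by move=> x Mx y Ey; exact: le_trans (fM _ Ey) (ltW Mx).
Qed.

Lemma norm_Rintegral_le_Rintegral (f g : T -> R) (M : R) : measurable_fun E f ->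
  measurable_fun E g -> (forall x, E x -> g x <= M) ->
  (forall x, E x -> `|f x| <= g x) ->
  `|\int[mu]_(x in E) f x| <= \int[mu]_(x in E) g x.
Proof.
move=> mf mg gM fg; have fM x : E x -> `|f x| <= M.
  by move=> Ex; rewrite (le_trans (fg _ Ex))// gM.
have ig : mu.-integrable E (EFin \o g).
  apply: (@bounded_integrable _ M) => // x Ex; rewrite ger0_norm ?gM//.
  exact: le_trans (fg _ Ex).
apply: (le_trans (le_normr_Rintegral mE (bounded_integrable mf fM))).
apply: le_Rintegral => //.
by apply: (@bounded_integrable _ M) => [|x Ex];
  [exact: measurableT_comp|rewrite normr_id fM].
Qed.

Lemma norm_Rintegral_le (f : T -> R) (M : R) : measurable_fun E f ->
  (forall x, E x -> `|f x| <= M) ->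
  `|\int[mu]_(x in E) f x| <= M * fine (mu E).
Proof.
move=> mf fM; rewrite -Rintegral_cst//.
by apply: (@norm_Rintegral_le_Rintegral _ _ M).
Qed.

Lemma Rintegral_cvg (f_ : nat -> T -> R) (f : T -> R) (M : R) :
  (forall n, measurable_fun E (f_ n)) -> measurable_fun E f ->
  (forall n x, E x -> `|f_ n x| <= M) ->
  (forall x, E x -> f_ n x @[n --> \oo] --> f x) ->
  \int[mu]_(x in E) f_ n x @[n --> \oo] --> \int[mu]_(x in E) f x.
Proof.
move=> mf_ mf fM ff.
have [|||||ic _ h] := @dominated_convergence _ _ _ mu E mE
  (fun n => EFin \o f_ n) (EFin \o f) (EFin \o cst M).
- by move=> n; exact/measurable_EFinP.
- exact/measurable_EFinP.
- by apply: aeW => x Ex; apply: cvg_EFin; [exact: nearW|exact: ff].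
- by apply: (@bounded_integrable _ `|M|).
- by apply: aeW => x n Ex; rewrite /= lee_fin fM.
rewrite /Rintegral; apply: fine_cvg; rewrite fineK//.
exact: integrable_fin_num.
Qed.

Lemma Rintegral_cvg0 (f_ : nat -> T -> R) (M : R) :
  (forall n, measurable_fun E (f_ n)) ->
  (forall n x, E x -> `|f_ n x| <= M) ->
  (forall x, E x -> f_ n x @[n --> \oo] --> (0 : R)) ->
  \int[mu]_(x in E) f_ n x @[n --> \oo] --> (0 : R).
Proof.
move=> mf fM f0; have -> : 0 = \int[mu]_(x in E) (cst 0 x) :> R.
  by rewrite Rintegral_cst// mul0r.
exact: Rintegral_cvg fM f0.
Qed.

Lemma measure_full_subset (D A : set T) : measurable D -> measurable A ->
  E `<=` D -> mu (D `\` E) = 0%E -> mu (D `&` A) = mu (E `&` A).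
Proof.
move=> mD mA ED DE0.
rewrite (_ : D `&` A = (E `&` A) `|` ((D `\` E) `&` A)); last first.
  apply/seteqP; split => [x [Dx Ax]|x [[Ex Ax]|[[Dx _] Ax]]].
  - by have [Ex|nEx] := pselect (E x); [left|right].
  - by split => //; exact: ED.
  - by split.
have mDE : measurable (D `\` E) by exact: measurableD.
rewrite measureU0//; [exact: measurableI|exact: measurableI|].
apply/eqP; rewrite -measure_le0 -DE0; apply: le_measure; rewrite ?inE//.
by apply: measurableI.
Qed.

Lemma sum_indic_integral n (A : 'I_n -> set T) (c : 'I_n -> R) :
  (forall i, measurable (A i)) ->
  mu.-integrable E (EFin \o (fun x => \sum_(i < n) \1_(A i) x * c i)) /\
  \int[mu]_(x in E) (\sum_(i < n) \1_(A i) x * c i) =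
    \sum_(i < n) fine (mu (E `&` A i)) * c i.
Proof.
elim: n A c => [|n IH] A c mA.
  rewrite big_ord0; split.
    apply: (@bounded_integrable _ 0).
      by under eq_fun do rewrite big_ord0; exact: measurable_cst.
    by move=> x _; rewrite big_ord0 normr0.
  under eq_Rintegral do rewrite big_ord0.
  by rewrite Rintegral_cst// mul0r.
have [|i1 e1] := IH (A \o widen_ord (leqnSn n)) (c \o widen_ord (leqnSn n)).
  by move=> i; exact: mA.
have ii : mu.-integrable E (EFin \o \1_(A ord_max)).
  apply: (@bounded_integrable _ 1).
    exact: measurable_indic (mA ord_max).
  by move=> x _; rewrite indicE; case: (_ \in _); rewrite ?normr1 ?normr0.
have i2 : mu.-integrable E (EFin \o (fun x => \1_(A ord_max) x * c ord_max)).
  apply: (@bounded_integrable _ `|c ord_max|).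
    apply: measurable_funM; last exact: measurable_cst.
    exact: measurable_indic (mA ord_max).
  move=> x _; rewrite normrM ler_piMl// indicE.
  by case: (_ \in _); rewrite ?normr1 ?normr0.
rewrite big_ord_recr /= -e1; split.
  apply: (eq_integrable mE _ _ _ (integrableD mE i1 i2)) => x _ /=.
  by rewrite big_ord_recr.
under eq_Rintegral do rewrite big_ord_recr /=.
rewrite RintegralD// RintegralZr//.
by congr (_ + _ * _); rewrite /Rintegral integral_indic// setIC.
Qed.

End bounded_integrals.

Section bochner_lemmas.
Context {d} {T : measurableType d} {R : realType} (mu : {measure set T -> \bar R}).
Variables (D E : set T).
Hypotheses (mD : measurable D) (mE : measurable E) (ED : E `<=` D).
Hypotheses (finD : (mu D < +oo)%E) (DE0 : mu (D `\` E) = 0%E).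

Let finE : (mu E < +oo)%E.
Proof. by rewrite (le_lt_trans _ finD)// le_measure ?inE. Qed.

(** The simple integral measures sets inside [D], while measurability is available on [E] only; the
    null difference reconciles the two. *)
Lemma bop_simple_integral (V : normedModType R) (s : simple V) (phi : bop V R) :
  mu.-integrable E (EFin \o (fun x => phi (simple_fun s x))) /\
  phi (simple_integral mu D s) = \int[mu]_(x in E) phi (simple_fun s x).
Proof.
have phiE x : phi (simple_fun s x) =
    \sum_(i < simple_size s) \1_(simple_set i) x * phi (@simple_coef _ _ _ _ s i).
  by rewrite bop_sumE; apply: eq_bigr => i _; rewrite bopZ.
have [h1 h2] := sum_indic_integral mE finE (fun i => phi (@simple_coef _ _ _ _ s i))
  (@simple_measurable _ _ _ _ s).
split; first by apply: (eq_integrable mE _ _ _ h1) => x _ /=; rewrite phiE.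
under eq_Rintegral do rewrite phiE.
rewrite h2 bop_sumE; apply: eq_bigr => i _; rewrite bopZ.
by rewrite (@measure_full_subset _ _ _ mu E mE D)//; exact: simple_measurable.
Qed.

End bochner_lemmas.

Section bochner_functional.
Context {d} {T : measurableType d} {R : realType} (mu : {measure set T -> \bar R}).
Variables (D E : set T).
Hypotheses (mD : measurable D) (mE : measurable E) (ED : E `<=` D).
Hypotheses (finD : (mu D < +oo)%E) (DE0 : mu (D `\` E) = 0%E).

(** A bounded functional commutes with the Bochner integral: both sides are limits of its values on
    the simple integrals, the right one because the L^1 error is multiplied by at most |phi|. The
    null set [N] of the definition is removed from [E] first. *)
Lemma bochner_bop (V : normedModType R) (g : T -> V) (z : V) (phi : bop V R) (M : R) :
  is_bochner mu D g z -> (forall x, E x -> `|g x| <= M) ->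
  measurable_fun E (fun x => phi (g x)) ->
  phi z = \int[mu]_(x in E) phi (g x).
Proof.
move=> [s [N [[mN N0 sg] fins L1 Iz]]] gM mphi.
have mEN : measurable (E `\` N) by exact: measurableD.
have ENE : E `\` N `<=` E by move=> x [].
have finE : (mu E < +oo)%E by rewrite (le_lt_trans _ finD)// le_measure ?inE.
have finEN : (mu (E `\` N) < +oo)%E by rewrite (le_lt_trans _ finE)// le_measure ?inE.
have mg : dmeas (E `\` N) g.
  apply: (@dmeasS _ _ _ _ (D `\` N)) => //; first exact: measurableD.
    by move=> x [/ED].
  exact: (ae_limit_dmeas mD (And3 mN N0 sg)).
have DEN0 : mu (D `\` (E `\` N)) = 0%E.
  apply/eqP; rewrite -measure_le0 -(@null_set_setU _ _ _ mu (D `\` E) N)//.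
    apply: le_measure; rewrite ?inE//; [exact: measurableD| |].
      by apply: measurableU => //; exact: measurableD.
    move=> x [Dx /not_andP[nEx|/contrapT]]; by [left|right].
  exact: measurableD.
have phib x : E x -> `|phi (g x)| <= `|phi| * M.
  by move=> Ex; rewrite (le_trans (bopE_norm _ _))// ler_wpM2l// gM.
rewrite /Rintegral (@negligible_integral _ _ _ mu E N)//; last first.
  exact: bounded_integrable phib.
rewrite -/(Rintegral mu (E `\` N) (phi \o g)).
have mphi' : measurable_fun (E `\` N) (phi \o g) by exact: measurable_funS mphi.
have iphi : mu.-integrable (E `\` N) (EFin \o (phi \o g)).
  by apply: (@bounded_integrable _ _ _ _ _ mEN finEN _ (`|phi| * M)) => // x [/phib].
have iE n := @bop_simple_integral _ _ _ mu D (E `\` N) mD mEN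
  (subset_trans ENE ED) finD DEN0 V (s n) phi.
have phiI : phi (simple_integral mu D (s n)) @[n --> \oo] --> phi z by exact: bop_cvg.
suff : phi (simple_integral mu D (s n)) @[n --> \oo] -->
    \int[mu]_(x in E `\` N) (phi \o g) x.
  by move=> h; exact: cvg_unique phiI h.
pose a n := (\int[mu]_(x in D `\` N) `|simple_fun (s n) x - g x|%:E)%E.
(* The L^1 error [a n] is a priori only an extended real, so the estimate is made there and brought
   back to R in the limit. *)
have key n : (`|phi (simple_integral mu D (s n)) -
    \int[mu]_(x in E `\` N) (phi \o g) x|%:E <= `|phi|%:E * a n)%E.
  have [i1 ->] := iE n; rewrite -RintegralB//.
  have iB : mu.-integrable (E `\` N)
     (EFin \o (fun x => phi (simple_fun (s n) x) - (phi \o g) x)).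
    exact: (eq_integrable mEN _ _ (fun x _ => erefl) (integrableB mEN i1 iphi)).
  rewrite EFin_normr_Rintegral//; have /integrableP[mB _] := iB.
  have mgn : measurable_fun (E `\` N) (fun x => `|simple_fun (s n) x - g x|).
    have := dmeas_norm (dmeasB_simple (s n) mEN mg).
    by apply: eq_measurable_fun => y _; rewrite distrC.
  rewrite (le_trans (le_abse_integral _ mEN mB))//.
  rewrite (@le_trans _ _ (\int[mu]_(x in E `\` N)
      (`|phi|%:E * `|simple_fun (s n) x - g x|%:E))%E)//.
    apply: ge0_le_integral => //.
    - exact: measurableT_comp.
    - apply: measurable_funeM; exact/measurable_EFinP.
    - by move=> x _ /=; rewrite lee_fin -bopB bopE_norm.
  rewrite ge0_integralZl//; last exact/measurable_EFinP.
  rewrite lee_wpmul2l// ?lee_fin//; apply: ge0_subset_integral => //.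
  - exact: measurableD.
  - apply/measurable_EFinP.
    have := dmeas_norm (dmeasB_simple (s n) (measurableD mD mN)
      (ae_limit_dmeas mD (And3 mN N0 sg))).
    by apply: eq_measurable_fun => y _; rewrite distrC.
  - by move=> x [/ED].
apply: cvg_norm_sub0.
have ha : (`|phi|%:E * a n)%E @[n --> \oo] --> 0%E.
  by rewrite -[X in _ --> X](mule0 `|phi|%:E); apply: cvgeZl.
apply: (@fine_cvg _ _ _ _ (fun n => `|phi (simple_integral mu D (s n)) -
  \int[mu]_(x in E `\` N) (phi \o g) x|%:E)).
apply: (squeeze_cvge _ (cvg_cst 0%E) ha).
by near=> n; rewrite key lee_fin normr_ge0.
Unshelve. all: by end_near. Qed.

Section existence.
Variables (H : hilbertType R) (g : T -> H) (M : R).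
Hypotheses (sepH : separable H) (mg : dmeas E g).
Hypothesis (gM : forall x, E x -> `|g x| <= M).

Let finE : (mu E < +oo)%E.
Proof. by rewrite (le_lt_trans _ finD)// le_measure ?inE. Qed.

Let mdot h : measurable_fun E (fun x => dot h (g x)).
Proof. by apply/dmeas_realP; exact: (dmeas_bop_cst sepH (dotb h)). Qed.

Let dotM h x : E x -> `|dot h (g x)| <= M * `|h|.
Proof.
by move=> Ex; rewrite (le_trans (cauchy_schwarz _ _))// mulrC ler_wpM2r// gM.
Qed.

Let idot h : mu.-integrable E (EFin \o (fun x => dot h (g x))).
Proof. exact: bounded_integrable (dotM h). Qed.

Lemma weak_integral :
  exists z, forall h, dot h z = \int[mu]_(x in E) dot h (g x).
Proof.
apply: (@riesz_fun _ _ _ (M * fine (mu E))) => [a h k|h]; last first.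
  by rewrite mulrAC; exact: (norm_Rintegral_le mE finE (mdot h) (dotM h)).
under eq_Rintegral do rewrite dotDl dotZl.
rewrite RintegralD ?RintegralZl//.
exact: (eq_integrable mE _ _ (fun x _ => erefl) (integrableZl mE a (idot h))).
Qed.

(** The weak integral is already the Bochner integral: nearest-point simple functions converge to g
    on [E], boundedly, hence in L^1, and D minus E serves as the exceptional set. *)
Lemma bochner_exists : exists2 z, is_bochner mu D g z &
  forall h, dot h z = \int[mu]_(x in E) dot h (g x).
Proof.
have [z zE] := weak_integral; exists z => //.
have [e [e0 ed]] := separable_enum sepH.
pose s n := @Simple _ _ R H n.+1
  (fun j => E `&` [set x | nearest e g n x = j]) (fun j => e j)
  (fun j => measurable_nearest e mE mg n j).
have sE n x : E x -> simple_fun (s n) x = e (nearest e g n x).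
  move=> Ex; rewrite /simple_fun /= (bigD1 (inord (nearest e g n x)))//=.
  rewrite inordK ?ltnS ?nearest_leq// indicE mem_set ?scale1r//.
  rewrite big1 ?addr0// => j jn; rewrite indicE memNset ?scale0r// => -[_ /= nj].
  by move/eqP : jn; apply; apply: val_inj; rewrite /= inordK ?ltnS ?nearest_leq.
have sg x : E x -> simple_fun (s n) x @[n --> \oo] --> g x.
  move=> Ex; under eq_fun do rewrite sE//.
  exact: nearest_cvg ed _.
have DDE : D `\` (D `\` E) = E by rewrite setDD; apply/setIidPr.
have mDE : measurable (D `\` E) by exact: measurableD.
(* As e 0 = 0 is always among the candidates, the distance to the nearest point never exceeds |g x|;
   this is the dominating function. *)
have sgM n x : E x -> `|simple_fun (s n) x - g x| <= M.
  move=> Ex; rewrite sE// distrC.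
  by rewrite (le_trans (nearest_le _ _ _ (leq0n n)))// e0 subr0 gM.
have msg n : measurable_fun E (fun x => `|simple_fun (s n) x - g x|).
  have := dmeas_norm (dmeasB_simple (s n) mE mg).
  by apply: eq_measurable_fun => y _; rewrite distrC.
have isg n : mu.-integrable E (EFin \o (fun x => `|simple_fun (s n) x - g x|)).
  by apply: (@bounded_integrable _ _ _ _ _ mE finE _ M) => // x Ex; rewrite normr_id sgM.
have L1 : \int[mu]_(x in E) `|simple_fun (s n) x - g x| @[n --> \oo] --> (0 : R).
  apply: (Rintegral_cvg0 mE finE (M := M)) => // [n x Ex|x Ex].
    by rewrite normr_id sgM.
  rewrite -[X in _ --> X](@normr0 _ H) -(subrr (g x)).
  by apply: cvg_norm; apply: cvgB; [exact: sg|exact: cvg_cst].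
exists s, (D `\` E); split.
- split => //; rewrite DDE => x; exact: sg.
- move=> n i; rewrite (le_lt_trans _ finD)// le_measure ?inE//.
  by apply: measurableI => //; exact: simple_measurable.
- rewrite DDE (_ : (fun n => _) = EFin \o (fun n =>
    \int[mu]_(x in E) `|simple_fun (s n) x - g x|)); last first.
    apply/funext => n /=; rewrite /Rintegral fineK//.
    exact: integrable_fin_num (isg n).
  by apply: cvg_EFin => //; exact: nearW.
(* Tested against h, the difference of the integrals is at most |h| times the L^1 error, which
   bounds its norm. *)
- apply: (squeeze0 _ L1) => n; set w := _ - z.
  have int_ge0 : 0 <= \int[mu]_(x in E) `|simple_fun (s n) x - g x|.
    exact: Rintegral_ge0.
  apply: dot_norm_le => // h.
  have [i1 e1] := bop_simple_integral mD mE ED finD DE0 (s n) (dotb h).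
  rewrite /w dotBr (e1 : dot h _ = _) zE -RintegralB//.
  rewrite (le_trans (ler_norm _))//.
  rewrite mulrC -RintegralZl//.
  apply: (@norm_Rintegral_le_Rintegral _ _ _ mu E mE finE _ _ (`|h| * M)).
  + apply: measurable_funB => //.
    exact/measurable_EFinP/(measurable_int mu).
  + apply: measurable_funM => //; exact: measurable_cst.
  + by move=> x Ex; rewrite ler_wpM2l// sgM.
  + by move=> x Ex /=; rewrite -dotBr cauchy_schwarz.
Qed.

End existence.
End bochner_functional.

(** * Semigroups and their adjoints *)

Section uniform_boundedness.
Context {R : realType} {V : completeNormedModType R} {W : normedModType R}.

Lemma uniform_boundedness (B : nat -> bop V W) :
  (forall x, exists M, forall n, `|B n x| <= M) -> exists M, forall n, `|B n| <= M.
Proof.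
move=> Bx; pose F := range (fun n => B n : V -> W).
have Fl f : F f -> bounded_fun_norm f /\ linear f.
  move=> [n _ <-]; split; last exact: bop_linear.
  move=> r; exists (`|B n| * r) => x xr.
  by rewrite (le_trans (bopE_norm _ _))// ler_wpM2l.
have Fb : pointwise_bounded F.
  by move=> x; have [M BM] := Bx x; exists M => _ [n _ <-].
have [M BM] := Banach_Steinhauss Fl Fb 1.
by exists M => n; apply: opnorm_le => x x1; apply: BM => //; exists n.
Qed.

End uniform_boundedness.

Lemma bop_dense_eq0 (R : realType) (V W : normedModType R) (B : bop V W) (D : set V) :
  dense D -> (forall x, D x -> B x = 0) -> forall x, B x = 0.
Proof.
move=> dD B0 x; apply/eqP; rewrite -normr_le0; apply/ler_addgt0Pl => e e0.
have B1 : 0 < `|B| + 1 by rewrite ltr_pwDr.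
have [w Dw xw] := dense_norm x dD (divr_gt0 e0 B1).
have -> : B x = B (x - w) by rewrite bopB (B0 w Dw) subr0.
rewrite addr0 (le_trans (bopE_norm _ _))//.
rewrite (@le_trans _ _ ((`|B| + 1) * `|x - w|))//.
  by rewrite ler_wpM2r// lerDl.
by rewrite mulrC -ler_pdivlMr// ltW.
Qed.

Section semigroup.
Context {R : realType} {X : normedModType R}.
Variable S : R -> bop X X.
Hypothesis c0S : c0_semigroup S.

Lemma sg0 x : S 0 x = x. Proof. by case: c0S. Qed.

Lemma sgD (s t : R) x : 0 <= s -> 0 <= t -> S (s + t) x = S s (S t x).
Proof. by case: c0S => _ h _ s0 t0; exact: h. Qed.

Lemma sg_near0 x (e : R) : 0 < e ->
  exists2 d : R, 0 < d & forall h, 0 <= h < d -> `|S h x - x| < e.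
Proof.
move=> e0; have [_ _ /(_ x)/cvgrPdist_lt/(_ _ e0)] := c0S.
move=> [d /= d0 dS]; exists d => // h /andP[].
rewrite le_eqVlt => /predU1P[<- _|h0 hd]; first by rewrite sg0 subrr normr0.
by rewrite distrC; apply: dS => //=; rewrite sub0r normrN gtr0_norm.
Qed.

Lemma sg_cvg0 x (t : nat -> R) : (forall n, 0 <= t n) ->
  t n @[n --> \oo] --> 0 -> S (t n) x @[n --> \oo] --> x.
Proof.
move=> t0 tc; apply/cvgnP => e /(sg_near0 x)[d d0 dS].
have /cvgnP/(_ _ d0)[N tN] := tc; exists N => n /tN; rewrite subr0 => h.
by apply: dS; rewrite t0 (le_lt_trans _ h)// ler_norm.
Qed.

(* The uniform boundedness principle needs a complete domain; X may be a dual
   space, which is parametrized isometrically by a Hilbert space through J. *)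
Lemma sg_bounded_near0 (V : completeNormedModType R) (J : bop V X) :
  (forall x, exists2 v, J v = x & `|v| <= `|x|) ->
  exists d M : R, 0 < d /\ forall t : R, 0 <= t <= d -> `|S t| <= M.
Proof.
move=> Jx; apply: contrapT => h.
(* Without a bound near 0 there are times tending to 0 with |S (t n)| > n, although every single
   orbit stays bounded along them. *)
have /choice[t tP] : forall n : nat, exists t : R,
    0 <= t <= n.+1%:R^-1 /\ n%:R < `|S t|.
  move=> n; apply: contrapT => h'; apply: h; exists n.+1%:R^-1, n%:R.
  rewrite invr_gt0; split => // t tn; rewrite leNgt; apply/negP => St.
  by apply: h'; exists t.
have tc : t n @[n --> \oo] --> (0 : R).
  apply: (squeeze0 _ (@cvg_harmonic R)) => n.
  by have [/andP[t0 tn] _] := tP n; rewrite subr0 ger0_norm.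
have t0 n : 0 <= t n by have [/andP[]] := tP n.
have [v|M SM] := @uniform_boundedness _ V X (fun n => bop_comp (S (t n)) J).
  have h1 := @sg_cvg0 (J v) _ t0 tc.
  have /cvg_seq_bounded[M [_ /(_ (M + 1))]] : cvgn (fun n => S (t n) (J v)).
    by apply/cvg_ex; exists (J v).
  rewrite ltrDl ltr01 => /(_ isT) hM.
  by exists (M + 1) => n /=; apply: hM.
have M0 : 0 <= M by rewrite (le_trans _ (SM 0%N)).
have [_ ] := tP (Num.truncn M).+1; apply/negP; rewrite -leNgt.
rewrite (@le_trans _ _ M)//; last by rewrite ltW// truncnS_gt.
apply: bop_norm_le => // x; have [v <- vx] := Jx x.
rewrite (le_trans (bopE_norm (bop_comp (S (t (Num.truncn M).+1)) J) v))//.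
by rewrite ler_pM.
Qed.

Variables (d M : R).
Hypotheses (d_gt0 : 0 < d) (SM : forall t : R, 0 <= t <= d -> `|S t| <= M).

(** Splitting off steps of length d multiplies the bound by [L] each time. Taking L at least 1 makes
    the powers increase, so one power serves all of [0,T]. *)
Lemma sg_bounded (T : R) : exists2 K, 1 <= K & forall t : R, 0 <= t <= T -> `|S t| <= K.
Proof.
pose L := Num.max 1 M.
have L1 : 1 <= L by rewrite le_max lexx.
have SL t : 0 <= t <= d -> `|S t| <= L.
  by move=> td; rewrite le_max SM ?orbT.
have Sn (n : nat) t : 0 <= t <= n%:R * d -> `|S t| <= L ^+ n.+1.
  elim: n t => [|n IH] t /andP[t0].
    by rewrite mul0r => t0'; rewrite expr1 SL// t0 (le_trans t0')// ltW.
  have [td _|dt tn] := leP t d.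
    by rewrite (le_trans (SL _ _)) ?t0// ler_eXnr.
  apply: bop_norm_le => [x|]; last by rewrite exprn_ge0// (le_trans ler01).
  rewrite -{1}(subrK d t) sgD ?subr_ge0 ?(ltW dt) ?(ltW d_gt0)//.
  rewrite (le_trans (bopE_norm _ _))// exprSr -mulrA ler_pM//.
    apply: IH; rewrite subr_ge0 ltW//= lerBlDr.
    by rewrite -[X in _ + X]mul1r -mulrDl -natr1 in tn *.
  by rewrite (le_trans (bopE_norm _ _))// ler_wpM2r// SL// lexx andbT ltW.
exists (L ^+ (Num.truncn (T / d)).+2); first by rewrite exprn_ege1.
move=> t /andP[t0 tT]; apply: Sn; rewrite t0/= (le_trans tT)//.
by rewrite -ler_pdivrMr// ltW// truncnS_gt.
Qed.

(** Continuity from the right at 0 suffices: factoring out the smaller of the two times leaves S b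
    (S a x - x) with a small and S b bounded, on either side of l. *)
Lemma sg_continuous (x : X) (t : nat -> R) (l : R) : (forall n, 0 <= t n) -> 0 <= l ->
  t n @[n --> \oo] --> l -> S (t n) x @[n --> \oo] --> S l x.
Proof.
move=> t0 l0 tl; have [K K1 SK] := sg_bounded (l + 1).
have K0 : 0 < K by rewrite (lt_le_trans ltr01).
apply/cvgnP => e e0; have [dd d0 dS] := sg_near0 x (divr_gt0 e0 K0).
have /cvgnP/(_ (Num.min 1 dd)) := tl.
rewrite lt_min ltr01 d0 => /(_ isT)[N tN]; exists N => n /tN; rewrite lt_min => /andP[tn1 tnd].
have key a b : 0 <= a -> 0 <= b <= l + 1 -> a < dd -> `|S b (S a x - x)| < e.
  move=> a0 bl ad; rewrite (le_lt_trans (bopE_norm _ _))//.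
  rewrite (@le_lt_trans _ _ (K * `|S a x - x|))//; first by rewrite ler_wpM2r// SK.
  by rewrite mulrC -ltr_pdivlMr// dS// a0.
have [tnl|ltn] := leP (t n) l.
  rewrite -[in S l x](subrKC (t n) l) sgD ?subr_ge0// distrC -bopB.
  apply: key; rewrite ?subr_ge0 ?t0 ?(le_trans tnl) ?lerDl//.
  by rewrite distrC in tnd; rewrite (le_lt_trans (ler_norm _) tnd).
rewrite -[in S (t n) x](subrKC l (t n)) sgD ?subr_ge0 ?(ltW ltn)// -bopB.
apply: key; rewrite ?subr_ge0 ?(ltW ltn) ?l0 ?lerDl ?ler01//.
exact: le_lt_trans (ler_norm _) tnd.
Qed.

End semigroup.

Section generator.
Context {R : realType} {X : normedModType R}.
Variables (S : R -> bop X X) (D : set X) (A : X -> X).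
Hypothesis gen : generates D A S.

Let c0S : c0_semigroup S. Proof. by case: gen. Qed.

Lemma generator_invariant x (t : R) : 0 <= t -> D x -> D (S t x) /\ A (S t x) = S t (A x).
Proof.
move=> t0 Dx; have [_ _ _ genP] := gen.
apply/genP; have /genP hx : D x /\ A x = A x by [].
have : S t (h^-1 *: (S h x - x)) @[h --> 0^'+] --> S t (A x).
  exact: bop_cvg.
apply: cvg_trans; apply: near_eq_cvg; near=> h.
have h0 : 0 <= h by apply: ltW; near: h; exact: nbhs_right_gt.
have -> : S h (S t x) = S t (S h x) by rewrite -!sgD// addrC.
by rewrite bopZ bopB.
Unshelve. all: by end_near. Qed.

Lemma generator_expansion x (e : R) : D x -> 0 < e ->
  exists2 d : R, 0 < d & forall h, 0 < h < d -> `|S h x - x - h *: A x| <= e * h.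
Proof.
move=> Dx e0; have [_ _ _ genP] := gen.
have /genP/cvgrPdist_lt/(_ _ e0)[d /= d0 dS] : D x /\ A x = A x by [].
exists d => // h /andP[h0 hd].
have := dS h; rewrite /= sub0r normrN gtr0_norm// => /(_ hd h0) /ltW.
rewrite -(ler_pM2r h0) mulrC -[X in X * _](gtr0_norm h0) -normrZ scalerBr.
by rewrite scalerA divff ?gt_eqF// scale1r distrC.
Qed.

End generator.

Section adjoint_semigroup.
Context {R : realType} {H : hilbertType R}.

Definition riesz_map_linear : linear (dotb : H -> bop H R).
Proof. by move=> a x y; apply: bopE => z /=; rewrite /= dotDl dotZl. Qed.

Lemma riesz_map_bound (x : H) : `|dotb x| <= 1 * `|x|.
Proof. by rewrite mul1r dotb_norm. Qed.

Definition riesz_map : bop H (bop H R) := lipschitz_bop riesz_map_linear riesz_map_bound.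

Lemma riesz_map_onto (q : bop H R) : exists2 v, riesz_map v = q & `|v| <= `|q|.
Proof.
have [v vq] := riesz q; exists v; first by apply: bopE => x; exact: vq.
by rewrite -(dotb_norm v) (_ : dotb v = q)//; apply: bopE => x; exact: vq.
Qed.

Variables (S : R -> bop H H) (D : set H) (A : H -> H).
Variable (Sd : R -> bop (bop H R) (bop H R)).
Hypothesis gen : generates D A S.
Hypothesis gend : generates (adjoint_dom D A) (adjoint_op D A) Sd.

Let c0S : c0_semigroup S. Proof. by case: gen. Qed.
Let c0Sd : c0_semigroup Sd. Proof. by case: gend. Qed.

Lemma hilbert_sg_bounded (T : R) :
  exists2 K, 1 <= K & forall t : R, 0 <= t <= T -> `|S t| <= K.
Proof.
have [|d [M [d0 SM]]] := @sg_bounded_near0 _ _ S c0S H idb.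
  by move=> x; exists x.
exact: (sg_bounded c0S d0 SM).
Qed.

Lemma dual_sg_bounded (T : R) :
  exists2 K, 1 <= K & forall t : R, 0 <= t <= T -> `|Sd t| <= K.
Proof.
have [d [M [d0 SM]]] := sg_bounded_near0 c0Sd riesz_map_onto.
exact: (sg_bounded c0Sd d0 SM).
Qed.

Lemma hilbert_sg_continuous (x : H) (t : nat -> R) (l : R) : (forall n, 0 <= t n) -> 0 <= l ->
  t n @[n --> \oo] --> l -> S (t n) x @[n --> \oo] --> S l x.
Proof.
have [|d [M [d0 SM]]] := @sg_bounded_near0 _ _ S c0S H idb.
  by move=> z; exists z.
exact: (sg_continuous c0S d0 SM).
Qed.

Lemma adjoint_opE q x : adjoint_dom D A q -> D x -> adjoint_op D A q x = q (A x).
Proof.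
move=> [g gq] Dx; have := @xgetPex _ 0 (adjoint_graph D A q) (ex_intro _ g gq).
exact.
Qed.

Lemma seq_increment_le (phi : nat -> R) (b : R) (n : nat) :
  (forall k, (k < n)%N -> `|phi k.+1 - phi k| <= b) -> `|phi n - phi 0%N| <= n%:R * b.
Proof.
elim: n => [|n IH] h; first by rewrite subrr normr0 mul0r.
have -> : phi n.+1 - phi 0%N = (phi n.+1 - phi n) + (phi n - phi 0%N).
  by rewrite addrA subrK.
rewrite (le_trans (ler_normD _ _))// -natr1 mulrDl mul1r addrC lerD ?h//.
by apply: IH => k kn; rewrite h// ltnW.
Qed.

(* No derivative is taken: the increments of k |-> Sd(kh)q (S(t-kh)x), with
   h = t/n, are o(h), since the first order terms cancel by duality. *)
Lemma adjoint_sg_on_domains q x (t : R) : adjoint_dom D A q -> D x -> 0 < t ->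
  Sd t q x = q (S t x).
Proof.
move=> Dq Dx t0; apply/eqP; rewrite -subr_eq0 -normr_le0; apply/ler_addgt0Pl => e e0.
rewrite addr0.
have [K K1 SK] := hilbert_sg_bounded t; have [L L1 SL] := dual_sg_bounded t.
have K0 : 0 < K by rewrite (lt_le_trans ltr01).
have L0 : 0 < L by rewrite (lt_le_trans ltr01).
(* Each increment below is at most [c] times the accuracy e/(ct) times h, and n+1 increments of step
   h cover t, so the total is e. The summand 1 keeps c positive. *)
pose c := L * K * (`|x| + `|q| + 1).
have c0 : 0 < c by rewrite !mulr_gt0// ltr_pwDr// addr_ge0.
have e'0 : 0 < e / (c * t) by rewrite divr_gt0// mulr_gt0.
have [d1 d10 Sx] := generator_expansion gen Dx e'0.
have [d2 d20 Sq] := generator_expansion gend Dq e'0.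
have [n nd] : exists n : nat, t / n.+1%:R < Num.min d1 d2.
  have d0 : 0 < Num.min d1 d2 / t by rewrite divr_gt0// lt_min d10.
  by have [n nd] := harmonic_ltn d0; exists n; rewrite mulrC -ltr_pdivlMr.
set h := t / n.+1%:R in nd.
have h0 : 0 < h by rewrite divr_gt0.
have nh : n.+1%:R * h = t by rewrite /h mulrC divfK// pnatr_eq0.
move: nd; rewrite lt_min => /andP[hd1 hd2].
have {}Sx := Sx h; rewrite h0 hd1 in Sx; have {}Sx := Sx isT.
have {}Sq := Sq h; rewrite h0 hd2 in Sq; have {}Sq := Sq isT.
(* Interpolates between q (S t x) at k = 0 and Sd t q x at k = n+1; the natural subtraction does not
   truncate in this range. *)
pose phi k := Sd (k%:R * h) q (S ((n.+1 - k)%:R * h) x).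
have -> : Sd t q x - q (S t x) = phi n.+1 - phi 0%N.
  by rewrite /phi subnn subn0 nh !mul0r !sg0.
have -> : e = n.+1%:R * (e / (c * t) * h * c).
  rewrite [RHS](_ : _ = e / (c * t) * c * (n.+1%:R * h)); last by ring.
  by rewrite nh; field; rewrite !gt_eqF.
apply: seq_increment_le => k kn; rewrite /phi.
set s := k%:R * h; set r := (n.+1 - k.+1)%:R * h.
have s0 : 0 <= s by rewrite mulr_ge0// ltW.
have r0 : 0 <= r by rewrite mulr_ge0// ltW.
have st : s <= t by rewrite /s -nh ler_pM2r// ler_nat ltnW.
have rt : r <= t by rewrite /r -nh ler_pM2r// ler_nat leq_subr.
have -> : k.+1%:R * h = s + h by rewrite -natr1 mulrDl mul1r.
have -> : (n.+1 - k)%:R * h = r + h.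
  by rewrite /r -subnSK// -natr1 mulrDl mul1r.
rewrite !sgD ?(ltW h0)//.
have [DSr ASr] := generator_invariant gen r0 Dx.
have [DSs ASs] := generator_invariant gend s0 Dq.
(* The domains are invariant and the generators commute with their semigroups, so the generator of
   Sd can be moved across the pairing; hence the terms of order h cancel. *)
have cancel : Sd s (adjoint_op D A q) (S r x) = Sd s q (S r (A x)).
  by rewrite -ASs adjoint_opE// ASr.
set e1 := Sd h q - q - h *: adjoint_op D A q in Sq.
set e2 := S h x - x - h *: A x in Sx.
have -> : Sd s (Sd h q) (S r x) - Sd s q (S r (S h x)) =
    Sd s e1 (S r x) - Sd s q (S r e2).
  rewrite /e1 /e2 !bopB !bopZ !bop_subE bop_scaleE cancel.
  by rewrite /GRing.scale /=; ring.
rewrite (le_trans (ler_normB _ _))//.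
have b1 : `|Sd s e1 (S r x)| <= L * (e / (c * t) * h) * (K * `|x|).
  rewrite (le_trans (bopE_norm _ _))// ler_pM//.
    rewrite (le_trans (bopE_norm _ _))// ler_pM// SL// s0//.
  by rewrite (le_trans (bopE_norm _ _))// ler_wpM2r// SK// r0.
have b2 : `|Sd s q (S r e2)| <= L * `|q| * (K * (e / (c * t) * h)).
  rewrite (le_trans (bopE_norm _ _))// ler_pM//.
    by rewrite (le_trans (bopE_norm _ _))// ler_wpM2r// SL// s0.
  by rewrite (le_trans (bopE_norm _ _))// ler_pM// SK// r0.
rewrite (le_trans (lerD b1 b2))// /c.
have : 0 <= e / (c * t) * h by rewrite mulr_ge0// ltW.
rewrite -/c; set w := e / (c * t) * h => w0.
have -> : L * w * (K * `|x|) + L * `|q| * (K * w) = w * (L * K * (`|x| + `|q|)) by ring.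
by rewrite ler_wpM2l// ler_pM2l ?mulr_gt0// lerDl.
Qed.

(** Both sides are bounded in q and in x, so density applies first to q and then to x; the domain of
    the adjoint is dense because Sd is assumed to be generated there. *)
Lemma adjoint_sgE q x (t : R) : 0 <= t -> Sd t q x = q (S t x).
Proof.
rewrite le_eqVlt => /predU1P[<-|t0]; first by rewrite !sg0.
have [dD _ _ _] := gen; have [dD' _ _ _] := gend.
pose B := bop_comp (eval_bop R x) (Sd t) - eval_bop R (S t x).
suff : B q = 0 by rewrite bop_subE => /eqP; rewrite subr_eq0 => /eqP.
apply: (bop_dense_eq0 dD') => {}q Dq.
pose C := Sd t q - bop_comp q (S t).
suff : forall z, C z = 0 by move=> /(_ x); rewrite !bop_subE.
apply: (bop_dense_eq0 dD) => z Dz.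
by rewrite bop_subE /= adjoint_sg_on_domains// subrr.
Qed.

End adjoint_semigroup.

(** * Convolution with a semigroup *)

(** The working class of integrands: integrable on every set of finite measure and stable under the
    operations used below. *)
Definition bmeas d (T : measurableType d) (R : realType) (V : normedModType R)
  (E : set T) (g : T -> V) :=
  dmeas E g /\ exists M, forall x, E x -> `|g x| <= M.

(* z is the Pettis integral of g over E. *)
Definition weakint d (T : measurableType d) (R : realType)
    (mu : {measure set T -> \bar R}) (H : hilbertType R) (E : set T) (g : T -> H) (z : H) :=
  forall h, dot h z = \int[mu]_(x in E) dot h (g x).

Section bmeas.
Context {d} {T : measurableType d} {R : realType} (mu : {measure set T -> \bar R}).
Variables (E : set T).
Hypotheses (mE : measurable E) (finE : (mu E < +oo)%E).
Implicit Types f g : T -> R.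

Lemma bmeas_measurable f : bmeas E f -> measurable_fun E f.
Proof. by case=> /dmeas_realP. Qed.

Lemma bmeas_integrable f : bmeas E f -> mu.-integrable E (EFin \o f).
Proof. by case=> /dmeas_realP mf [M fM]; exact: bounded_integrable fM. Qed.

Lemma eq_bmeas (V : normedModType R) (g1 g2 : T -> V) :
  (forall x, E x -> g1 x = g2 x) -> bmeas E g1 -> bmeas E g2.
Proof.
move=> g12 [m1 [M M1]]; split; first exact: eq_dmeas m1.
by exists M => x Ex; rewrite -g12// M1.
Qed.

Lemma bmeas_cst (V : normedModType R) (c : V) : bmeas E (fun=> c).
Proof. by split; [exact: dmeas_cst|exists `|c|]. Qed.

Lemma bmeas_norm (V : normedModType R) (g : T -> V) :
  bmeas E g -> bmeas E (fun x => `|g x|).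
Proof.
move=> [mg [M gM]]; split; first exact/dmeas_realP/dmeas_norm.
by exists M => x Ex; rewrite normr_id gM.
Qed.

Lemma bmeasB (V : normedModType R) (g1 g2 : T -> V) : separable V ->
  bmeas E g1 -> bmeas E g2 -> bmeas E (fun x => g1 x - g2 x).
Proof.
move=> sV [m1 [M1 g1M]] [m2 [M2 g2M]]; split; first exact: dmeasB.
exists (M1 + M2) => x Ex.
by rewrite (le_trans (ler_normB _ _))// lerD ?g1M ?g2M.
Qed.

Lemma bmeasD (V : normedModType R) (g1 g2 : T -> V) : separable V ->
  bmeas E g1 -> bmeas E g2 -> bmeas E (fun x => g1 x + g2 x).
Proof.
move=> sV [m1 [M1 g1M]] [m2 [M2 g2M]]; split; first exact: dmeasD.
exists (M1 + M2) => x Ex.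
by rewrite (le_trans (ler_normD _ _))// lerD ?g1M ?g2M.
Qed.

Lemma bmeasM f g : bmeas E f -> bmeas E g -> bmeas E (fun x => f x * g x).
Proof.
move=> [/dmeas_realP m1 [M1 g1M]] [/dmeas_realP m2 [M2 g2M]]; split.
  exact/dmeas_realP/measurable_funM.
exists (M1 * M2) => x Ex.
by rewrite normrM ler_pM ?g1M ?g2M.
Qed.

Lemma bmeas_dot (H : hilbertType R) h (g : T -> H) : separable H ->
  bmeas E g -> bmeas E (fun x => dot h (g x)).
Proof.
move=> sH [mg [M gM]]; split; first exact: (dmeas_bop_cst sH (dotb h)).
exists (`|h| * M) => x Ex.
by rewrite (le_trans (cauchy_schwarz _ _))// ler_wpM2l// gM.
Qed.

Lemma bmeas_if (V : normedModType R) (b : T -> bool) (g1 g2 : T -> V) :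
  measurable_fun E b -> bmeas E g1 -> bmeas E g2 ->
  bmeas E (fun x => if b x then g1 x else g2 x).
Proof.
move=> mb [m1 [M1 gM1]] [m2 [M2 gM2]]; split; first exact: dmeas_if.
exists (Num.max M1 M2) => x Ex; rewrite le_max.
by case: ifP => _; rewrite ?gM1 ?gM2 ?orbT.
Qed.

Lemma Rintegral_norm_le f g : bmeas E f -> bmeas E g ->
  (forall x, E x -> `|f x| <= g x) ->
  `|\int[mu]_(x in E) f x| <= \int[mu]_(x in E) g x.
Proof.
move=> bf [mg [M gM]]; apply: (@norm_Rintegral_le_Rintegral _ _ _ mu E mE finE _ _ M).
- exact: bmeas_measurable.
- exact/dmeas_realP.
- by move=> x Ex; rewrite (le_trans (ler_norm _))// gM.
Qed.

Lemma Rintegral_le f g : bmeas E f -> bmeas E g ->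
  (forall x, E x -> f x <= g x) -> \int[mu]_(x in E) f x <= \int[mu]_(x in E) g x.
Proof. by move=> bf bg; apply: le_Rintegral => //; exact: bmeas_integrable. Qed.

Section weak_integral.
Variable H : hilbertType R.
Hypothesis sepH : separable H.

Lemma weakint_exists (g : T -> H) : bmeas E g -> exists z, weakint mu E g z.
Proof.
move=> [mg [M gM]].
by have [z zE] := @weak_integral _ _ _ mu E E mE mE (@subset_refl _ E) finE H g M sepH mg gM;
  exists z.
Qed.

Lemma weakintB (g1 g2 : T -> H) z1 z2 : bmeas E g1 -> bmeas E g2 ->
  weakint mu E g1 z1 -> weakint mu E g2 z2 ->
  weakint mu E (fun x => g1 x - g2 x) (z1 - z2).
Proof.
move=> b1 b2 w1 w2 h; rewrite dotBr w1 w2 -RintegralB//; first last.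
- exact/bmeas_integrable/bmeas_dot.
- exact/bmeas_integrable/bmeas_dot.
by apply: eq_Rintegral => x _; rewrite dotBr.
Qed.

Lemma weakint_norm (g : T -> H) z f : bmeas E g -> bmeas E f ->
  (forall x, E x -> `|g x| <= f x) -> weakint mu E g z ->
  `|z| <= \int[mu]_(x in E) f x.
Proof.
move=> bg bf gf w; apply: dot_norm_le => [|h].
  by apply: Rintegral_ge0 => x Ex; rewrite (le_trans _ (gf x Ex)).
rewrite w -RintegralZr//; last exact: bmeas_integrable.
apply: Rintegral_le; first exact: bmeas_dot.
  by apply: bmeasM => //; exact: bmeas_cst.
move=> x Ex; rewrite (le_trans (ler_norm _))// (le_trans (cauchy_schwarz _ _))//.
by rewrite mulrC ler_wpM2r// gf.
Qed.

(** Norm convergence, although the integrals are defined weakly: the difference is bounded by the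
    scalar integral of |g_n - g|, to which dominated convergence applies. *)
Lemma weakint_cvg (g_ : nat -> T -> H) (g : T -> H) z_ z (M : R) :
  (forall n, dmeas E (g_ n)) -> dmeas E g ->
  (forall n x, E x -> `|g_ n x| <= M) -> (forall x, E x -> `|g x| <= M) ->
  (forall x, E x -> g_ n x @[n --> \oo] --> g x) ->
  (forall n, weakint mu E (g_ n) (z_ n)) -> weakint mu E g z ->
  z_ n @[n --> \oo] --> z.
Proof.
move=> mg_ mg g_M gM gg w_ w.
have bg_ n : bmeas E (g_ n) by split => //; exists M; exact: g_M.
have bg : bmeas E g by split => //; exists M.
have bd n : bmeas E (fun x => g_ n x - g x) by exact: bmeasB.
apply: (@squeeze0 _ _ _ _ (fun n => \int[mu]_(x in E) `|g_ n x - g x|)).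
  move=> n; apply: (@weakint_norm (fun x => g_ n x - g x)) => //.
    exact: bmeas_norm.
  exact: weakintB.
apply: (Rintegral_cvg0 mE finE (M := M + M)).
- by move=> n; exact/bmeas_measurable/bmeas_norm.
- move=> n x Ex; rewrite normr_id (le_trans (ler_normB _ _))//.
  by rewrite lerD ?g_M ?gM.
- move=> x Ex; rewrite -[X in _ --> X](@normr0 _ H) -(subrr (g x)).
  by apply: cvg_norm; apply: cvgB; [exact: gg|exact: cvg_cst].
Qed.

End weak_integral.
End bmeas.

Section sequential_continuity.
Context {R : realType} {V : normedModType R}.
Implicit Types (g : R -> V) (D : set R).

Lemma withinP D g : {within D, continuous g} <->
  (forall l (e : R), D l -> 0 < e -> exists2 d : R, 0 < d &
     forall t, D t -> `|t - l| < d -> `|g t - g l| < e).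
Proof.
rewrite subspace_continuousP; split=> h l.
- move=> e Dl e0; have /cvgrPdist_lt/(_ _ e0)[d /= d0 dg] := h _ Dl.
  by exists d => // t Dt td; rewrite distrC; apply: dg => //=; rewrite distrC.
- move=> Dl; apply/cvgrPdist_lt => e e0; have [d d0 dg] := h l e Dl e0.
  by exists d => //= t /= td Dt; rewrite distrC; apply: dg => //; rewrite distrC.
Qed.

Lemma within_cvg D g (t : nat -> R) (l : R) : {within D, continuous g} ->
  (forall n, D (t n)) -> D l ->
  t n @[n --> \oo] --> l -> g (t n) @[n --> \oo] --> g l.
Proof.
move=> /withinP cg Dt Dl /cvgnP tl; apply/cvgnP => e /(cg _ _ Dl)[d /tl[N tN] dg].
by exists N => n /tN; exact: dg.
Qed.

(** Dominated convergence speaks of sequences; this converts its conclusions into continuity in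
    time. *)
Lemma seq_within_continuous D g :
  (forall (t : nat -> R) (l : R), (forall n, D (t n)) -> D l ->
    t n @[n --> \oo] --> l -> g (t n) @[n --> \oo] --> g l) ->
  {within D, continuous g}.
Proof.
move=> h; apply/withinP => l e Dl e0; apply: contrapT => hd.
have /choice[t tP] : forall n : nat, exists t : R,
    [/\ D t, `|t - l| < n.+1%:R^-1 & e <= `|g t - g l|].
  move=> n; apply: contrapT => h'; apply: hd; exists n.+1%:R^-1.
    by rewrite invr_gt0.
  move=> t Dt tl; rewrite ltNge; apply/negP => eg; apply: h'.
  by exists t.
have tl : t n @[n --> \oo] --> l.
  apply: (squeeze0 _ (@cvg_harmonic R)) => n.
  by have [_ /ltW] := tP n.
have /cvgnP/(_ _ e0)[N gN] := h t l (fun n => let: And3 Dt _ _ := tP n in Dt) Dl tl.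
by have [_ _] := tP N; rewrite leNgt gN.
Qed.

End sequential_continuity.

Section convolution.
Context {R : realType} {H : hilbertType R}.
Local Notation leb := (@lebesgue_measure R).
Local Notation RR := (measurableTypeR R).
Hypothesis sepH : separable H.
Variables (T : R) (E : set RR).
Hypotheses (T_gt0 : 0 < T) (mE : measurable E) (ET : E `<=` `]0, T[%classic).
Hypothesis E_full : leb (`]0, T[%classic `\` E) = 0%E.
Variables (S : R -> bop H H) (K : R).
Hypothesis S_bounded : forall t, 0 <= t <= T -> `|S t| <= K.
Hypothesis S_continuous : forall (x : H) (t : nat -> R) (l : R),
  (forall n, 0 <= t n) -> 0 <= l ->
  t n @[n --> \oo] --> l -> S (t n) x @[n --> \oo] --> S l x.

Lemma lebesgue_itvT : leb `]0, T[%classic = T%:E.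
Proof. by rewrite lebesgue_measure_itv/= lte_fin T_gt0 sube0. Qed.

Lemma finE : (leb E < +oo)%E.
Proof.
rewrite (@le_lt_trans _ _ (leb `]0, T[%classic))//; first by rewrite le_measure ?inE.
by rewrite lebesgue_itvT ltry.
Qed.

(* The semigroup extended by 0 to negative times, so that the mild solution
   formula becomes a convolution over the fixed domain E. *)
Definition sg_ext (r : R) : bop H H := if 0 < r then S r else 0.

Lemma sg_ext_bound r x : r <= T -> `|sg_ext r x| <= K * `|x|.
Proof.
move=> rT; rewrite /sg_ext; case: ifP => [r0|_].
  by rewrite (le_trans (bopE_norm _ _))// ler_wpM2r// S_bounded// ltW.
rewrite normr0 mulr_ge0// (le_trans _ (S_bounded (t := 0) _))//.
by rewrite lexx ltW.
Qed.

Lemma dmeas_sg_ext x : dmeas setT (fun r => sg_ext r x).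
Proof.
(* Freezing negative times at 0 gives a continuous function on the whole line that agrees with the
   orbit for r > 0. *)
have h : dmeas setT (fun r : R => if 0 < r then S (Num.max r 0) x else 0).
  apply: dmeas_if => //; first exact: measurable_fun_ltr.
    have cS : continuous (fun r : R => S (Num.max r 0) x).
      apply/continuous_subspace_setT/seq_within_continuous => t l _ _ tl.
      apply: S_continuous; [by move=> n; rewrite le_max lexx orbT|
        by rewrite le_max lexx orbT|].
      apply: (@squeeze0 _ _ _ _ (fun n => `|t n - l|)) => [n|].
        rewrite /Num.max; case: ltP => h1; case: ltP => h2; rewrite ?subrr ?normr0//.
        - by rewrite sub0r normrN (ger0_norm h2) ler0_norm; lra.
        - by rewrite subr0 (ger0_norm h1) ger0_norm; lra.
      rewrite -[X in _ --> X](@normr0 _ R) -(subrr l).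
      by apply: cvg_norm; apply: cvgB => //; exact: cvg_cst.
    move=> v; apply: continuous_measurable_fun => r.
    by apply: cvg_norm; apply: cvgB; [exact: cS|exact: cvg_cst].
apply: eq_dmeas h => r _; rewrite /sg_ext; case: ifPn => // r0.
by rewrite max_l ?ltW.
Qed.

Lemma dmeas_sg_ext_comp d (X : measurableType d) (D : set X) (a : X -> R) (g : X -> H) :
  measurable D -> measurable_fun D a -> dmeas D g ->
  dmeas D (fun x => sg_ext (a x) (g x)).
Proof.
move=> mD ma mg; apply: (dmeas_bop sepH) => // v w.
apply: (@measurableT_comp _ _ _ _ _ _ (fun r => `|sg_ext r v - w|)) => //.
exact: dmeas_sg_ext.
Qed.

Lemma measurable_time (D : set RR) : measurable_fun D (fun s : RR => (s : R)).
Proof. exact: (@measurable_id _ R D). Qed.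

Lemma bmeas_sg_ext (t : R) (g : R -> H) : t <= T -> bmeas E g ->
  bmeas E (fun s => sg_ext (t - s) (g s)).
Proof.
move=> tT [mg [M gM]]; split.
  by apply: dmeas_sg_ext_comp => //; apply: measurable_funB; [exact: measurable_cst|exact: measurable_time].
exists (K * M) => s Es; have /andP[s0 _] : 0 < s < T by have := ET Es; rewrite /= in_itv.
rewrite (le_trans (sg_ext_bound _ _))//; first by lra.
rewrite ler_wpM2l ?gM// (le_trans _ (S_bounded (t := 0) _))//.
by rewrite lexx ltW.
Qed.

Let integrand_itv (t s : R) (g : R -> H) h : t <= T -> s \in E ->
  ((fun s => dot h (S (t - s) (g s))) \_ `]0, t[%classic) s =
  dot h (sg_ext (t - s) (g s)).
Proof.
rewrite inE => tT /ET /=; rewrite in_itv/= => /andP[s0 sT].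
rewrite patchE /sg_ext subr_gt0; case: ifPn.
  by rewrite inE /= in_itv/= => /andP[_ ->].
by rewrite notin_setE /= in_itv/= s0/=; case: (s < t) => // _; rewrite dot0r.
Qed.

(** From the Bochner integral over the moving interval ]0,t[ to a weak integral over [E]; the factor
    [sg_ext] vanishes for s at or beyond t. *)
Lemma mild_weakint (t : R) (g : R -> H) z : 0 <= t <= T -> bmeas E g ->
  is_bochner leb `]0, t[ (fun s => S (t - s) (g s)) z ->
  weakint leb E (fun s => sg_ext (t - s) (g s)) z.
Proof.
move=> /andP[t0 tT] bg bz h; have [mg [M gM]] := bg.
have mEt : measurable (E `&` `]0, t[%classic) by exact: measurableI.
have sub0 : `]0, t[%classic `<=` `]0, T[%classic.
  by move=> s /=; rewrite !in_itv/= => /andP[-> /lt_le_trans]; exact.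
have eqS s : (E `&` `]0, t[%classic) s -> S (t - s) (g s) = sg_ext (t - s) (g s).
  by move=> [_ /=]; rewrite in_itv/= /sg_ext subr_gt0 => /andP[_ ->].
have [m1 [M1 b1]] := bmeas_sg_ext tT bg.
suff -> : dot h z = \int[leb]_(s in E `&` `]0%R, t[) dot h (S (t - s) (g s)).
  by rewrite Rintegral_mkcondr; apply: eq_Rintegral => s Es; exact: integrand_itv.
apply: (@bochner_bop _ _ _ leb `]0, t[%classic (E `&` `]0, t[%classic) _ mEt _ _ _
  H _ z (dotb h) M1 bz).
- exact: measurable_itv.
- by move=> s [].
- by rewrite (le_lt_trans _ (_ : (leb `]0%R, T[%classic < +oo)%E)) ?lebesgue_itvT ?ltry//
    -lebesgue_itvT le_measure ?inE.
- apply/eqP; rewrite -measure_le0 -E_full; apply: le_measure; rewrite ?inE.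
  + exact: measurableD.
  + exact: measurableD.
  + by move=> s [st nEs]; split; [exact: sub0|move=> Es; apply: nEs].
- by move=> s Es; rewrite eqS// b1//; case: Es.
- have := bmeas_measurable (bmeas_dot mE h sepH (bmeas_sg_ext tT bg)) => mh.
  apply: (@eq_measurable_fun _ _ RR _ _ (fun s => dot h (sg_ext (t - s) (g s)))).
    by move=> s; rewrite inE => Es; rewrite /= eqS.
  by apply: measurable_funS mh => // s [].
Qed.

(** Some Bochner integral z' exists and has the same inner products as z, so it equals z. *)
Lemma mild_bochner (t : R) (g : R -> H) z : 0 <= t <= T -> bmeas E g ->
  weakint leb E (fun s => sg_ext (t - s) (g s)) z ->
  is_bochner leb `]0, t[ (fun s => S (t - s) (g s)) z.
Proof.
move=> /andP[t0 tT] bg wz; have [mg [M gM]] := bg.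
have mEt : measurable (E `&` `]0, t[%classic) by exact: measurableI.
have sub0 : `]0, t[%classic `<=` `]0, T[%classic.
  by move=> s /=; rewrite !in_itv/= => /andP[-> /lt_le_trans]; exact.
have eqS s : (E `&` `]0, t[%classic) s -> S (t - s) (g s) = sg_ext (t - s) (g s).
  by move=> [_ /=]; rewrite in_itv/= /sg_ext subr_gt0 => /andP[_ ->].
have [m1 [M1 b1]] := bmeas_sg_ext tT bg.
have [||||||z' bz' wz'] := @bochner_exists _ _ _ leb `]0, t[%classic (E `&` `]0, t[%classic)
   _ mEt _ _ _ H (fun s => S (t - s) (g s)) M1 sepH.
- exact: measurable_itv.
- by move=> s [].
- by rewrite (le_lt_trans _ (_ : (leb `]0%R, T[%classic < +oo)%E)) ?lebesgue_itvT ?ltry//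
    -lebesgue_itvT le_measure ?inE.
- apply/eqP; rewrite -measure_le0 -E_full; apply: le_measure; rewrite ?inE.
  + exact: measurableD.
  + exact: measurableD.
  + by move=> s [st nEs]; split; [exact: sub0|move=> Es; apply: nEs].
- apply: (@eq_dmeas _ RR _ _ _ (fun s => sg_ext (t - s) (g s))).
    by move=> s Es; rewrite eqS.
  by apply: dmeasS m1 => // s [].
- by move=> s Es; rewrite eqS// b1//; case: Es.
suff -> : z = z' by [].
apply: dot_inj => h; rewrite wz wz' Rintegral_mkcondr.
by apply: eq_Rintegral => s Es; rewrite integrand_itv.
Qed.

(** The only jump of the extended semigroup is at 0. *)
Lemma sg_ext_cvg x (r : nat -> R) (l : R) : l != 0 ->
  r n @[n --> \oo] --> l -> sg_ext (r n) x @[n --> \oo] --> sg_ext l x.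
Proof.
move=> l0 rl; rewrite /sg_ext.
have [lp|ln] := ltP 0 l; last first.
  have {}ln : l < 0 by rewrite lt_neqAle l0 ln.
  have /cvgnP/(_ (- l)) := rl; rewrite oppr_gt0 => /(_ ln)[N rN].
  apply/cvgnP => e e0; exists N => n /rN; rewrite ltr_norml => /andP[_ h].
  by rewrite ifN ?subrr ?normr0// -leNgt; lra.
have /cvgnP/(_ _ lp)[N rN] := rl.
have r0 n : (N <= n)%N -> 0 < r n.
  by move=> /rN; rewrite ltr_norml => /andP[h _]; lra.
rewrite -(@cvg_shiftn N).
rewrite (_ : (fun n => _) = (fun n => S (r (n + N)%N) x)); last first.
  by apply/funext => n; rewrite r0// leq_addl.
apply: S_continuous => [n||]; rewrite ?(ltW lp)//; first by rewrite ltW// r0// leq_addl.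
by have := rl; rewrite -(@cvg_shiftn N).
Qed.

(** The integrands converge except at s = l, where the extended semigroup jumps; this point is null
    and is removed from [E]. *)
Lemma convolution_continuous (g : R -> H) (z : R -> H) : bmeas E g ->
  (forall t, 0 <= t <= T -> weakint leb E (fun s => sg_ext (t - s) (g s)) (z t)) ->
  {within `[0, T], continuous z}.
Proof.
move=> bg zw; apply: seq_within_continuous => t l tT lT tl.
have {}tT n : 0 <= t n <= T by have := tT n; rewrite /= in_itv.
have {}lT : 0 <= l <= T by move: lT; rewrite /= in_itv.
have mEl : measurable (E `\` [set l]) by apply: measurableD => //; exact: measurable_set1.
have sEl : E `\` [set l] `<=` E by move=> s [].
have fEl : (leb (E `\` [set l]) < +oo)%E by rewrite (le_lt_trans _ finE)// le_measure ?inE.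
have [mg [M gM]] := bg.
have wEl a : 0 <= a <= T ->
    weakint leb (E `\` [set l]) (fun s => sg_ext (a - s) (g s)) (z a).
  move=> aT h; have /andP[a0 aT'] := aT.
  rewrite zw// /Rintegral (@negligible_integral _ _ _ leb E [set l])//.
  - by apply/bmeas_integrable/bmeas_dot/bmeas_sg_ext => //; exact: finE.
  - exact: lebesgue_measure_set1.
have bound a s : a <= T -> (E `\` [set l]) s -> `|sg_ext (a - s) (g s)| <= K * M.
  move=> aT [Es _]; have /andP[s0 _] : 0 < s < T by have := ET Es; rewrite /= in_itv.
  rewrite (le_trans (sg_ext_bound _ _))//; first by lra.
  rewrite ler_wpM2l ?gM// (le_trans _ (S_bounded (t := 0) _))//.
  by rewrite lexx ltW.
have dm a : a <= T -> dmeas (E `\` [set l]) (fun s => sg_ext (a - s) (g s)).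
  by move=> aT; apply: (dmeasS mE sEl); have [] := bmeas_sg_ext aT bg.
apply: (@weakint_cvg _ _ _ leb (E `\` [set l]) mEl fEl H sepH
  (fun n s => sg_ext (t n - s) (g s)) (fun s => sg_ext (l - s) (g s)) _ _ (K * M)) => //.
- by move=> n; apply: dm; have /andP[] := tT n.
- by apply: dm; have /andP[] := lT.
- by move=> n x; apply: bound; have /andP[] := tT n.
- by move=> x; apply: bound; have /andP[] := lT.
- move=> s [Es /eqP sl]; apply: sg_ext_cvg; first by rewrite subr_eq0 eq_sym.
  by apply: cvgB => //; exact: cvg_cst.
- by move=> n; exact: wEl.
- exact: wEl.
Qed.

End convolution.

(** * Existence and stability of mild solutions *)

Section stability.
Context {R : realType} {H U : hilbertType R}.
Local Notation leb := (@lebesgue_measure R).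
Local Notation RR := (measurableTypeR R).
Hypotheses (sepH : separable H) (sepU : separable U).
Variables (T : R) (E : set RR).
Hypotheses (T_gt0 : 0 < T) (mE : measurable E) (ET : E `<=` `]0, T[%classic).
Hypothesis E_full : leb (`]0, T[%classic `\` E) = 0%E.
Variables (S : R -> bop H H) (K : R).
Hypothesis S_bounded : forall t, 0 <= t <= T -> `|S t| <= K.
Hypothesis S_continuous : forall (x : H) (t : nat -> R) (l : R),
  (forall n, 0 <= t n) -> 0 <= l ->
  t n @[n --> \oo] --> l -> S (t n) x @[n --> \oo] --> S l x.
Let finE := @finE R T E T_gt0 mE ET.
Let bmeas_sg_ext := @bmeas_sg_ext R H sepH T E T_gt0 mE ET S K S_bounded S_continuous.
Let convolution_continuous := @convolution_continuous R H sepH T E T_gt0 mE ET S K S_bounded S_continuous.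
Lemma E_itv s : E s -> 0 < s < T.
Proof. by move=> /ET; rewrite /= in_itv. Qed.

Lemma K_ge0 : 0 <= K.
Proof. by rewrite (le_trans _ (S_bounded (t := 0) _))// lexx ltW. Qed.

Lemma measurable_before (t : R) : measurable_fun E (fun s : RR => (s : R) < t).
Proof. by apply: measurable_fun_ltr; [exact: measurable_time|exact: measurable_cst]. Qed.

Lemma bmeas_before (t : R) (V : normedModType R) (g : RR -> V) : bmeas E g ->
  bmeas E (fun s : RR => if (s : R) < t then g s else 0).
Proof.
by move=> bg; apply: bmeas_if => //; [exact: measurable_before|exact: bmeas_cst].
Qed.

Lemma bmeas_continuous (V : normedModType R) (g : R -> V) :
  {within `[0, T], continuous g} -> bmeas E (g : RR -> V).
Proof.
move=> cg; split.
  apply: (@dmeasS _ RR _ _ `[0, T]%classic) => //.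
    by move=> s /E_itv /andP[/ltW s0 /ltW sT]; rewrite /= in_itv /= s0.
  exact: (dmeas_continuous cg).
have cn : {within `[0, T], continuous (fun t => `|g t|)}.
  by move=> x; apply: cvg_norm; exact: cg.
have [c _ gc] := EVT_max (ltW T_gt0) cn.
exists `|g c| => s /E_itv /andP[/ltW s0 /ltW sT].
by apply: gc; rewrite in_itv /= s0.
Qed.

(** The majorant [r] has to hold only for s < t. This causality lets a trajectory be estimated while
    its future is unknown. *)
Lemma convolution_diff (t : R) (g1 g2 : R -> H) (r : R -> R) z1 z2 : t <= T ->
  bmeas E (g1 : RR -> H) -> bmeas E (g2 : RR -> H) -> bmeas E (r : RR -> R) ->
  (forall s, E s -> s < t -> `|g1 s - g2 s| <= r s) ->
  weakint leb E (fun s => sg_ext S (t - s) (g1 s)) z1 ->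
  weakint leb E (fun s => sg_ext S (t - s) (g2 s)) z2 ->
  `|z1 - z2| <= \int[leb]_(s in E) (if (s : R) < t then K * r s else 0).
Proof.
move=> tT b1 b2 br gr w1 w2.
have bd : bmeas E (fun s : RR => sg_ext S (t - s) (g1 s) - sg_ext S (t - s) (g2 s)).
  by apply: bmeasB => //; exact: bmeas_sg_ext.
apply: (weakint_norm mE finE sepH bd _ _ (weakintB mE finE sepH _ _ w1 w2)).
- apply: bmeas_before; apply: bmeasM => //; exact: bmeas_cst.
- move=> s Es; rewrite -bopB; case: ifPn => [st|].
    rewrite (le_trans (sg_ext_bound T_gt0 S_bounded _ _))//.
      by have /andP[s0 _] := E_itv Es; lra.
    by rewrite ler_wpM2l ?K_ge0// gr.
  by rewrite -leNgt -subr_le0 leNgt /sg_ext => /negbTE ->; rewrite normr0.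
- exact: bmeas_sg_ext.
- exact: bmeas_sg_ext.
Qed.

Lemma bmeas_exp (a : R) : bmeas E (fun s : RR => expR (2 * a * s)).
Proof.
apply: bmeas_continuous; apply: continuous_subspaceT => x.
apply: continuous_comp; last exact: continuous_expR.
by apply: cvgMr; exact: cvg_id.
Qed.

(** In the supremum norm weighted by exp(-2at), the Volterra operator with constant a has norm at
    most 1/2. Both [gronwall] and the Picard iteration rest on this. *)
Lemma exp_integral (a c : R) : 0 < a -> 0 <= c <= T ->
  \int[leb]_(s in E) (if (s : R) < c then a * expR (2 * a * s) else 0)
    <= expR (2 * a * c) / 2.
Proof.
move=> a0 /andP[c0 cT].
have bex : bmeas E (fun s : RR => a * expR (2 * a * s)).
  by apply: bmeasM; [exact: bmeas_cst|exact: bmeas_exp].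
have [c00|cn0] := eqVneq c 0.
  rewrite (@eq_Rintegral _ _ _ leb E (cst 0)); last first.
    by move=> s; rewrite inE c00 => /E_itv /andP[/ltW s0 _]; rewrite ifN// -leNgt.
  by rewrite Rintegral_cst// mul0r divr_ge0// expR_ge0.
have {cn0 c0}c0 : 0 < c by rewrite lt_neqAle eq_sym cn0.
pose f := fun s : R => a * expR (2 * a * s).
have cf : continuous f.
  move=> x; apply: cvgMr; apply: continuous_comp; last exact: continuous_expR.
  by apply: cvgMr; exact: cvg_id.
have cF : continuous (fun s : R => expR (2 * a * s) / 2).
  move=> x; apply: cvgMl; apply: continuous_comp; last exact: continuous_expR.
  by apply: cvgMr; exact: cvg_id.
have dF (x : R) : is_derive x (1 : R) (fun s : R => expR (2 * a * s) / 2) (f x).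
  have -> : f x = 2^-1 *: (expR (2 * a * x) * (2 * a)).
    by rewrite /f /GRing.scale /=; field.
  rewrite (_ : (fun s : R => _) = 2^-1 \*: (expR \o (fun s => 2 * a * s))); last first.
    by apply/funext => s /=; rewrite mulrC.
  apply: is_deriveZ.
  apply: is_derive1_comp.
  rewrite -[X in is_derive _ _ _ X]mulr1.
  exact: is_deriveZ.
have FTC : (\int[leb]_(s in `[0%R, c]) (f s)%:E =
    (expR (2 * a * c) / 2)%:E - (expR (2 * a * 0) / 2)%:E)%E.
  apply: (@continuous_FTC2 R f (fun s => expR (2 * a * s) / 2) 0 c c0).
  - exact: continuous_subspaceT.
  - split.
    + by move=> x _; exact: ex_derive.
    + exact/cvg_at_right_filter/cF.
    + exact/cvg_at_left_filter/cF.
  - by move=> x _; rewrite derive1E; apply: derive_val.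
rewrite -lee_fin /Rintegral fineK; last first.
  apply: integrable_fin_num => //; apply: bmeas_integrable => //.
  exact: bmeas_before.
apply: (@le_trans _ _ (\int[leb]_(s in `[0%R, c]) (f s)%:E)%E); last first.
  by rewrite FTC -EFinB lee_fin lerBlDr lerDl divr_ge0// expR_ge0.
rewrite [leLHS]integral_mkcond [leRHS]integral_mkcond.
apply: ge0_le_integral => //.
- move=> s _; rewrite patchE; case: ifP => // _.
  by case: ifP => // _; rewrite lee_fin mulr_ge0 ?expR_ge0// ltW.
- apply/(measurable_restrictT _ mE)/measurable_EFinP.
  by apply: bmeas_measurable; exact: bmeas_before.
- apply/(@measurable_restrictT _ _ RR _ `[0, c]%classic) => //; apply/measurable_EFinP.
  apply: (@measurable_funS _ _ RR _ setT) => //.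
  exact: continuous_measurable_fun.
- move=> s _; rewrite !patchE; case: ifPn => [|_].
    rewrite inE => /E_itv /andP[s0 sT]; case: ifPn => sc.
      by rewrite ifT// inE /= in_itv /= !ltW.
    by case: ifP => // _; rewrite lee_fin mulr_ge0 ?expR_ge0// ltW.
  by case: ifP => // _; rewrite lee_fin mulr_ge0 ?expR_ge0// ltW.
Qed.

(** At a maximum c of w(t) = D(t) exp(-2at), the inequality reads w(c) X <= b + w(c) X / 2 with X =
    exp(2ac) >= 1, hence w(c) <= 2b. The end time tau allows for a trajectory known to stay in the
    tube only up to tau. *)
Lemma gronwall (D : R -> R) (a b tau : R) : 0 < a -> 0 <= b -> 0 <= tau <= T ->
  {within `[0, T], continuous D} ->
  (forall t, 0 <= t <= tau -> 0 <= D t) ->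
  (forall t, 0 <= t <= tau ->
     D t <= b + \int[leb]_(s in E) (if (s : R) < t then a * D s else 0)) ->
  forall t, 0 <= t <= tau -> D t <= 2 * b * expR (2 * a * t).
Proof.
move=> a0 b0 /andP[tau0 tauT] cD D0 DI.
have sub : `[0, tau]%classic `<=` `[0, T]%classic.
  by move=> s /=; rewrite !in_itv /= => /andP[-> /le_trans]; exact.
pose w t := D t * expR (- (2 * a * t)).
have cw : {within `[0, tau], continuous w}.
  move=> x; apply: cvgM; first exact: (continuous_subspaceW sub cD).
  apply: (@continuous_subspaceT _ _ `[0, tau]%classic (fun t => expR (- (2 * a * t)))).
  move=> z; apply: continuous_comp; last exact: continuous_expR.
  by apply: cvgN; apply: cvgMr; exact: cvg_id.
have [c] := EVT_max tau0 cw; rewrite in_itv /= => /andP[c0 ctau] wc.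
have Dw t : D t = w t * expR (2 * a * t) by rewrite /w -mulrA (mulrC (expR (- _))) expRxMexpNx_1 mulr1.
have Dle t : 0 <= t <= tau -> D t <= w c * expR (2 * a * t).
  by move=> ttau; rewrite Dw ler_wpM2r ?expR_ge0// wc// in_itv.
have wc0 : 0 <= w c by rewrite mulr_ge0 ?expR_ge0// D0// c0.
have bD : bmeas E (D : RR -> R) by exact: bmeas_continuous.
have : D c <= b + w c * (expR (2 * a * c) / 2).
  rewrite (le_trans (DI c _)) ?c0// lerD2l.
  apply: (@le_trans _ _ (\int[leb]_(s in E)
     (w c * (if (s : R) < c then a * expR (2 * a * s) else 0)))).
    apply: (Rintegral_le mE finE).
    - by apply: bmeas_before; apply: bmeasM => //; exact: bmeas_cst.
    - apply: bmeasM; first exact: bmeas_cst.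
      apply: bmeas_before; apply: bmeasM; first exact: bmeas_cst.
      exact: bmeas_exp.
    - move=> s Es; case: ifPn => sc; last by rewrite mulr0.
      rewrite mulrCA ler_pM2l// Dle//.
      by have /andP[/ltW -> _] := E_itv Es; rewrite (le_trans (ltW sc)).
  rewrite RintegralZl//; last first.
    apply: (bmeas_integrable mE finE); apply: bmeas_before.
    by apply: bmeasM; [exact: bmeas_cst|exact: bmeas_exp].
  by rewrite ler_wpM2l// exp_integral// c0 (le_trans ctau).
have e1 : 1 <= expR (2 * a * c) by rewrite -expR0 ler_expR !mulr_ge0// ltW.
rewrite {1}Dw => h.
have wb : w c <= 2 * b.
  rewrite -(ler_pM2r (lt_le_trans ltr01 e1)).
  have : b <= b * expR (2 * a * c) by rewrite ler_peMr.
  by move: h; set X := expR _; nra.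
move=> t ttau; rewrite (le_trans (Dle _ ttau))// ler_wpM2r// expR_ge0//.
Qed.

(** * Trajectories in a tube around the reference state *)

Section trajectories.
Variables (f : R -> H -> bop U H) (y0 : H) (y : R -> H) (u1 : R -> U) (rho M : R).
Hypotheses (rho_gt0 : 0 < rho) (M_gt0 : 0 < M) (K_gt0 : 0 < K).
Hypothesis f_measurable : forall x w, dmeas E ((fun t => f t x w) : RR -> H).
Hypothesis f_continuous : forall t, E t -> forall (x : nat -> H) (l : H),
  x n @[n --> \oo] --> l -> f t (x n) @[n --> \oo] --> f t l.
Hypothesis f_bounded : forall t z, E t -> `|z - y t| < rho -> `|f t z| <= M.
Hypothesis f_lipschitz : forall t z z', E t -> `|z - y t| < rho ->
  `|z' - y t| < rho -> `|f t z - f t z'| <= M * `|z - z'|.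

(** The weak form of [mild_state] over the fixed domain [E]; [mild_of_state] and [state_of_mild]
    relate the two. *)
Definition mild (u : R -> U) (Y : R -> H) : Prop :=
  [/\ {within `[0, T], continuous Y},
      bmeas E ((fun s => f s (Y s) (u s)) : RR -> H) &
      forall t, 0 <= t <= T ->
        weakint leb E (fun s => sg_ext S (t - s) (f s (Y s) (u s))) (Y t - S t y0)].

Hypothesis y_mild : mild u1 y.
Hypothesis u1_bmeas : bmeas E (u1 : RR -> U).

Let cy : {within `[0, T], continuous y}. Proof. by case: y_mild. Qed.

Lemma dmeas_nemytskii (Y : R -> H) (u : R -> U) :
  dmeas E (Y : RR -> H) -> dmeas E (u : RR -> U) ->
  dmeas E ((fun s => f s (Y s) (u s)) : RR -> H).
Proof.
move=> mY mu; apply: (@dmeas_bop _ RR _ _ _ sepU E (fun s => f s (Y s))) => // w.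
apply: (@caratheodory _ RR _ _ _ sepH E (fun s x => f s x w) Y) => // s Es x l xl.
exact: (@bop_cvg _ _ _ (eval_bop H w) _ _ _ _ _ (f_continuous Es xl)).
Qed.

Section perturbation.
Variables (u : R -> U) (Cu : R).
Hypotheses (mu : dmeas E (u : RR -> U)) (Cu_gt0 : 0 < Cu).
Hypothesis uC : forall s, E s -> `|u s| <= Cu.

(** Lipschitz constant of the integrand of the state equation in Y: K from the semigroup, M from the
    field, Cu from the control. The quantity [b] below is the inhomogeneity caused by the change of
    control. *)
Let a := K * M * Cu.
Let a_gt0 : 0 < a. Proof. by rewrite !mulr_gt0. Qed.

Let bu : bmeas E (u : RR -> U). Proof. by split => //; exists Cu. Qed.

Definition control_dist := \int[leb]_(s in E) `|u s - u1 s|.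

Let b := K * M * control_dist.

Lemma control_dist_ge0 : 0 <= control_dist.
Proof. exact: Rintegral_ge0. Qed.

Let b_ge0 : 0 <= b.
Proof. by rewrite !mulr_ge0 ?control_dist_ge0// ltW. Qed.

Let bdu : bmeas E ((fun s => `|u s - u1 s|) : RR -> R).
Proof. by apply: bmeas_norm; exact: bmeasB. Qed.

(** The factor of [control_dist] in the Gronwall bound 2 b exp(2aT). *)
Definition stability_constant := 2 * (K * M) * expR (2 * a * T).

Let CE : stability_constant * control_dist = 2 * b * expR (2 * a * T).
Proof. by rewrite /stability_constant /b; ring. Qed.

Let exp_le t : t <= T -> expR (2 * a * t) <= expR (2 * a * T).
Proof. by move=> tT; rewrite ler_expR ler_pM2l// mulr_gt0. Qed.

Lemma integrand_diff s z z' w w' : E s -> `|z - y s| < rho -> `|z' - y s| < rho ->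
  `|w| <= Cu -> `|f s z w - f s z' w'| <= M * Cu * `|z - z'| + M * `|w - w'|.
Proof.
move=> Es hz hz' hw.
have -> : f s z w - f s z' w' = (f s z - f s z') w + f s z' (w - w').
  by rewrite bop_subE bopB addrA subrK.
rewrite (le_trans (ler_normD _ _))// lerD//.
  rewrite (le_trans (bopE_norm _ _))// mulrAC ler_pM// f_lipschitz//.
by rewrite (le_trans (bopE_norm _ _))// ler_wpM2r// f_bounded.
Qed.

(** The tube is assumed strictly before tau and the bound reaches tau itself, since the integrals
    see earlier times only; the exit-time argument of [mild_stable] needs this. *)
Lemma mild_stable_before (Y : R -> H) (tau : R) : mild u Y -> 0 <= tau <= T ->
  (forall s, 0 <= s < tau -> `|Y s - y s| < rho) ->
  forall t, 0 <= t <= tau -> `|Y t - y t| <= stability_constant * control_dist.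
Proof.
move=> [cY bY wY] /andP[tau0 tauT] tube t ttau.
have [_ by1 wy] := y_mild.
have cD : {within `[0, T], continuous (fun s => `|Y s - y s|)}.
  by move=> x; apply: cvg_norm; apply: cvgB; [exact: cY|exact: cy].
have bD := bmeas_continuous cD.
have tT : t <= T by have /andP[_ /le_trans] := ttau; exact.
rewrite CE (@le_trans _ _ (2 * b * expR (2 * a * t)))//; last first.
  by rewrite ler_wpM2l ?exp_le// mulr_ge0.
apply: (gronwall (D := fun s => `|Y s - y s|) (tau := tau)) => //.
  by rewrite tau0.
move=> {}t {ttau tT}/andP[t0 ttau]; have tT := le_trans ttau tauT.
have -> : Y t - y t = (Y t - S t y0) - (y t - S t y0).
  by rewrite opprB addrA subrK.
have br : bmeas E ((fun s => M * Cu * `|Y s - y s| + M * `|u s - u1 s|) : RR -> R).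
  have sR : separable R by exact: separable_real.
  by apply: bmeasD => //; apply: bmeasM => //; exact: bmeas_cst.
apply: (le_trans (convolution_diff tT bY by1 br _ (wY t _) (wy t _))).
- move=> s Es st; apply: integrand_diff => //; last exact: uC.
    by apply: tube; have /andP[/ltW -> _] := E_itv Es; rewrite (lt_le_trans st).
  by rewrite subrr normr0.
- by rewrite t0.
- by rewrite t0.
have bI : bmeas E (fun s : RR => if (s : R) < t then a * `|Y s - y s| else 0).
  by apply: bmeas_before; apply: bmeasM => //; exact: bmeas_cst.
have bJ : bmeas E ((fun s => K * M * `|u s - u1 s|) : RR -> R).
  by apply: bmeasM => //; exact: bmeas_cst.
rewrite /b /control_dist -RintegralZl//; last exact: bmeas_integrable.
rewrite addrC -RintegralD//; [|exact: bmeas_integrable..].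
apply: (Rintegral_le mE finE).
- by apply: bmeas_before; apply: bmeasM => //; exact: bmeas_cst.
- by apply: bmeasD => //; exact: separable_real.
- move=> s Es; case: ifP => _; last by rewrite add0r !mulr_ge0// ltW.
  by rewrite le_eqVlt; apply/orP; left; apply/eqP; rewrite /a; ring.
Qed.

(** At the infimum tau of the times outside the tube, the stability bound still puts Y strictly
    inside; by continuity Y stays inside a little longer, contradicting the choice of tau. *)
Lemma mild_stable (Y : R -> H) : mild u Y ->
  stability_constant * control_dist < rho ->
  forall t, 0 <= t <= T -> `|Y t - y t| <= stability_constant * control_dist.
Proof.
move=> mY Crho; have [cY _ _] := mY.
apply: (@mild_stable_before Y T mY) => [|s /andP[s0 sT]]; first by rewrite lexx ltW.
rewrite ltNge; apply/negP => bad.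
pose A := [set t | 0 <= t <= T /\ rho <= `|Y t - y t|].
have As : A s by split => //; rewrite s0 ltW.
have infA : has_inf A.
  by split; [exists s|exists 0 => t [/andP[]]].
pose tau := inf A.
have tau0 : 0 <= tau by apply: lb_le_inf => [|t [/andP[]]//]; exists s.
have taus : tau <= s by apply: ge_inf => //; case: infA.
have tauT : 0 <= tau <= T by rewrite tau0 (le_trans taus)// ltW.
have before t : 0 <= t < tau -> `|Y t - y t| < rho.
  move=> /andP[t0 ttau]; rewrite ltNge; apply/negP => h.
  suff : tau <= t by rewrite leNgt ttau.
  apply: ge_inf; first by case: infA.
  by split => //; rewrite t0 (le_trans (ltW ttau))//; case/andP: tauT.
have htau : `|Y tau - y tau| < rho.
  rewrite (le_lt_trans _ Crho)// (mild_stable_before mY tauT before)//.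
  by rewrite tau0 lexx.
have cD : {within `[0, T], continuous (fun s => `|Y s - y s|)}.
  by move=> x; apply: cvg_norm; apply: cvgB; [exact: cY|exact: cy].
have /withinP/(_ tau (rho - `|Y tau - y tau|)) := cD.
rewrite /= in_itv /= subr_gt0 => /(_ tauT htau)[d d0 dD].
have [t [tT ht] ttau] := inf_adherent d0 infA.
have tt : tau <= t by apply: ge_inf => //; case: infA.
have := dD t; rewrite /= in_itv /= => /(_ tT).
rewrite ger0_norm ?subr_ge0// ltrBlDl => /(_ ttau).
rewrite ltr_norml => /andP[_]; rewrite ltrD2r; apply/negP.
by rewrite -leNgt.
Qed.

Lemma bmeas_tube (Y : R -> H) : dmeas E (Y : RR -> H) ->
  (forall s, E s -> `|Y s - y s| < rho) ->
  bmeas E ((fun s => f s (Y s) (u s)) : RR -> H).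
Proof.
move=> mY tube; split; first exact: dmeas_nemytskii.
exists (M * Cu) => s Es; rewrite (le_trans (bopE_norm _ _))// ler_pM ?uC//.
by rewrite f_bounded// tube.
Qed.

Lemma orbit_continuous : {within `[0, T], continuous (fun t => S t y0)}.
Proof.
apply: seq_within_continuous => t l tT lT; apply: S_continuous.
  by move=> n; have := tT n; rewrite /= in_itv /= => /andP[].
by move: lT; rewrite /= in_itv /= => /andP[].
Qed.

(** The default 0 is never met along the iteration: the integrands there are in [bmeas], so by
    [picardP] the weak integral exists. *)
Let picard (Y : R -> H) (t : R) : H := S t y0 +
  xget 0 [set z | weakint leb E (fun s => sg_ext S (t - s) (f s (Y s) (u s))) z].

Let picardP (Y : R -> H) (t : R) : bmeas E ((fun s => f s (Y s) (u s)) : RR -> H) ->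
  0 <= t <= T ->
  weakint leb E (fun s => sg_ext S (t - s) (f s (Y s) (u s))) (picard Y t - S t y0).
Proof.
move=> bY /andP[_ tT]; rewrite /picard addrAC subrr add0r.
apply: (@xgetPex _ 0 [set z | weakint leb E _ z]).
by apply: weakint_exists => //; exact: bmeas_sg_ext.
Qed.

Let continuous_of_mild (Y Z : R -> H) : bmeas E ((fun s => f s (Y s) (u s)) : RR -> H) ->
  (forall t, 0 <= t <= T ->
    weakint leb E (fun s => sg_ext S (t - s) (f s (Y s) (u s))) (Z t - S t y0)) ->
  {within `[0, T], continuous Z}.
Proof.
move=> bY hY.
have h1 := @convolution_continuous (fun s => f s (Y s) (u s)) (fun t => Z t - S t y0) bY hY.
rewrite (_ : Z = (fun t => (Z t - S t y0) + S t y0)); last first.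
  by apply/funext => t; rewrite subrK.
by move=> x; apply: cvgD; [exact: h1|exact: orbit_continuous].
Qed.

Let Y_ n := iter n picard y.

Section convergence.
Hypothesis Crho : stability_constant * control_dist < rho.

Let in_tube (Y : R -> H) (c : R) : c <= 2 ->
  (forall t, 0 <= t <= T -> `|Y t - y t| <= b * c * expR (2 * a * t)) ->
  forall t, 0 <= t <= T -> `|Y t - y t| < rho.
Proof.
move=> c2 h t /andP[t0 tT]; rewrite (le_lt_trans _ Crho)// CE.
rewrite (le_trans (h t _)) ?t0// (@le_trans _ _ (b * 2 * expR (2 * a * t)))//.
  by rewrite ler_wpM2r ?expR_ge0// ler_wpM2l.
by rewrite (mulrC b) ler_wpM2l ?exp_le// mulr_ge0.
Qed.

Let tubeE (Y : R -> H) : (forall t, 0 <= t <= T -> `|Y t - y t| < rho) ->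
  forall s, E s -> `|Y s - y s| < rho.
Proof. by move=> h s /E_itv /andP[/ltW s0 /ltW sT]; apply: h; rewrite s0. Qed.

(** The increments halve in the weighted norm, and 2 - 2/2^n is the sum of 2^-k over k < n. So the
    distance to y stays below 2 b exp(2aT), which is smaller than [rho], and the iterates never
    leave the tube. *)
Let picard_invariant n : [/\ {within `[0, T], continuous (Y_ n)},
  forall t, 0 <= t <= T ->
    `|Y_ n t - y t| <= b * (2 - 2 / 2 ^+ n) * expR (2 * a * t) &
  forall t, 0 <= t <= T -> `|Y_ n.+1 t - Y_ n t| <= b / 2 ^+ n * expR (2 * a * t)].
Proof.
have expge1 t : 0 <= t -> 1 <= expR (2 * a * t).
  by move=> t0; rewrite -expR0 ler_expR !mulr_ge0// ltW.
elim: n => [|n [cYn h1 h2]].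
  split; first exact: cy.
    by move=> t _; rewrite subrr normr0 expr0 divr1 subrr mulr0 mul0r.
  have [_ by1 wy] := y_mild.
  have bY0 : bmeas E ((fun s => f s (y s) (u s)) : RR -> H).
    apply: bmeas_tube; first by have [] := bmeas_continuous cy.
    by move=> s _; rewrite subrr normr0.
  move=> t t0T; have /andP[t0 tT] := t0T; rewrite expr0 divr1.
  rewrite (@le_trans _ _ b)//; last by rewrite ler_peMr// expge1.
  have -> : Y_ 1 t - Y_ 0 t = (picard y t - S t y0) - (y t - S t y0).
    by rewrite opprB addrA subrK.
  have br : bmeas E ((fun s => M * `|u s - u1 s|) : RR -> R).
    by apply: bmeasM => //; exact: bmeas_cst.
  apply: (le_trans (convolution_diff tT bY0 by1 br _ (picardP bY0 t0T) (wy t t0T))).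
    move=> s Es _; rewrite -bopB (le_trans (bopE_norm _ _))// ler_wpM2r//.
    by rewrite f_bounded// subrr normr0.
  rewrite /b /control_dist -RintegralZl//; last exact: bmeas_integrable.
  apply: (Rintegral_le mE finE).
  - by apply: bmeas_before; apply: bmeasM => //; exact: bmeas_cst.
  - by apply: bmeasM => //; exact: bmeas_cst.
  - by move=> s Es; case: ifP => _; rewrite ?mulrA// !mulr_ge0// ltW.
have p2 : 0 < 2 ^+ n :> R by rewrite exprn_gt0.
have tn : 2 - 2 / 2 ^+ n <= 2 :> R by rewrite gerBl divr_ge0// ltW.
have tubn := tubeE (in_tube tn h1).
have bYn : bmeas E ((fun s => f s (Y_ n s) (u s)) : RR -> H).
  by apply: bmeas_tube => //; have [] := bmeas_continuous cYn.
have cYn1 : {within `[0, T], continuous (Y_ n.+1)}.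
  by apply: (continuous_of_mild bYn) => t; exact: picardP.
have h1' t : 0 <= t <= T ->
    `|Y_ n.+1 t - y t| <= b * (2 - 2 / 2 ^+ n.+1) * expR (2 * a * t).
  move=> tT; rewrite -(subrK (Y_ n t) (Y_ n.+1 t)) -addrA.
  rewrite (le_trans (ler_normD _ _))// (le_trans (lerD (h2 t tT) (h1 t tT)))//.
  rewrite -mulrDl ler_wpM2r ?expR_ge0// le_eqVlt; apply/orP; left; apply/eqP.
  by rewrite exprS; field; rewrite gt_eqF.
have tn1 : 2 - 2 / 2 ^+ n.+1 <= 2 :> R by rewrite gerBl divr_ge0// exprn_ge0.
have tubn1 := tubeE (in_tube tn1 h1').
have bYn1 : bmeas E ((fun s => f s (Y_ n.+1 s) (u s)) : RR -> H).
  by apply: bmeas_tube => //; have [] := bmeas_continuous cYn1.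
split => // t t0T; have /andP[t0 tT] := t0T.
have -> : Y_ n.+2 t - Y_ n.+1 t =
    (picard (Y_ n.+1) t - S t y0) - (picard (Y_ n) t - S t y0).
  by rewrite opprB addrA subrK.
have br : bmeas E ((fun s => M * Cu * (b / 2 ^+ n * expR (2 * a * s))) : RR -> R).
  by do 2 (apply: bmeasM; first exact: bmeas_cst); exact: bmeas_exp.
apply: (le_trans (convolution_diff tT bYn1 bYn br _ (picardP bYn1 t0T) (picardP bYn t0T))).
  move=> s Es st; have := integrand_diff (u s) Es (tubn1 s Es) (tubn s Es) (uC Es).
  rewrite subrr normr0 mulr0 addr0 => /le_trans; apply.
  rewrite ler_wpM2l ?(mulr_ge0 (ltW M_gt0) (ltW Cu_gt0))// h2//.
  by have /andP[/ltW -> /ltW ->] := E_itv Es.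
rewrite (@eq_Rintegral _ _ _ leb E (fun s => b / 2 ^+ n *
  (if (s : R) < t then a * expR (2 * a * s) else 0))); last first.
  by move=> s _; case: ifP => _; rewrite ?mulr0// /a; ring.
rewrite RintegralZl//; last first.
  apply: (bmeas_integrable mE finE); apply: bmeas_before.
  by apply: bmeasM; [exact: bmeas_cst|exact: bmeas_exp].
have -> : b / 2 ^+ n.+1 * expR (2 * a * t) = b / 2 ^+ n * (expR (2 * a * t) / 2).
  by rewrite exprS; field; rewrite gt_eqF.
by rewrite ler_wpM2l ?divr_ge0 ?(ltW p2)// exp_integral.
Qed.

Let picard_cauchy n k t : 0 <= t <= T ->
  `|Y_ (n + k)%N t - Y_ n t| <= b / 2 ^+ n * (2 - 2 / 2 ^+ k) * expR (2 * a * t).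
Proof.
move=> tT; elim: k => [|k IH].
  by rewrite addn0 subrr normr0 expr0 divr1 subrr mulr0 mul0r.
rewrite addnS -(subrK (Y_ (n + k)%N t) (Y_ (n + k).+1 t)) -addrA.
have [_ _ /(_ t tT) h2] := picard_invariant (n + k)%N.
rewrite (le_trans (ler_normD _ _))// (le_trans (lerD h2 IH))//.
rewrite -mulrDl ler_wpM2r ?expR_ge0// le_eqVlt; apply/orP; left; apply/eqP.
by rewrite exprS exprD; field; rewrite !gt_eqF// exprn_gt0.
Qed.

(** The iterates converge pointwise and boundedly, so the integral equation passes to the limit by
    dominated convergence; continuity of the limit is then read off from the equation. *)
Lemma mild_exists : exists Y, mild u Y.
Proof.
(* Outside [0,T] nothing is claimed and the value is arbitrary. *)
have cvgY t : exists l : H, 0 <= t <= T -> Y_ n t @[n --> \oo] --> l.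
  have [tT|ntT] := pselect (0 <= t <= T); last by exists 0.
  suff [l Yl] : exists l : H, Y_ n t @[n --> \oo] --> l by exists l.
  apply: cauchy_seq_cvg => e e0.
  (* The summand 1 makes [B] positive even when the two controls coincide and b = 0. *)
  pose B := 2 * b * expR (2 * a * t) + 1.
  have B0 : 0 < B by rewrite ltr_wpDl// mulr_ge0 ?expR_ge0// mulr_ge0.
  have [N NB] : exists N : nat, B / 2 ^+ N < e / 2.
    have := @cvg_geometric R B (2^-1) _.
    rewrite ger0_norm ?invr_ge0// invf_lt1 ?ltr1n// => /(_ isT).
    move=> /cvgnP/(_ (e / 2)); rewrite divr_gt0// => /(_ isT)[N /(_ N (leqnn N))].
    rewrite subr0 /geometric /= exprVn ger0_norm ?divr_ge0 ?(ltW B0) ?exprn_ge0//.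
    by exists N.
  have dN n : (N <= n)%N -> `|Y_ n t - Y_ N t| <= B / 2 ^+ N.
    move=> Nn; rewrite -(subnKC Nn) (le_trans (picard_cauchy N (n - N) tT))//.
    have i0 : 0 <= (2 ^+ N)^-1 :> R by rewrite invr_ge0 exprn_ge0.
    have j0 : 0 <= (2 ^+ (n - N))^-1 :> R by rewrite invr_ge0 exprn_ge0.
    have -> : B / 2 ^+ N = b / 2 ^+ N * 2 * expR (2 * a * t) + (2 ^+ N)^-1.
      by rewrite /B; ring.
    rewrite (@le_trans _ _ (b / 2 ^+ N * 2 * expR (2 * a * t)))//; last by rewrite lerDl.
    rewrite ler_wpM2r ?expR_ge0// ler_wpM2l ?(mulr_ge0 b_ge0 i0)//.
    by rewrite gerBl mulr_ge0.
  exists N => n m Nn Nm; rewrite -(subrK (Y_ N t) (Y_ n t)) -addrA.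
  rewrite (le_lt_trans (ler_normD _ _))// (distrC (Y_ N t)).
  by have := dN _ Nn; have := dN _ Nm; lra.
have {cvgY}/choice[Y YE] := cvgY.
have YEE s : E s -> Y_ n s @[n --> \oo] --> Y s.
  by move=> /E_itv /andP[/ltW s0 /ltW sT]; apply: YE; rewrite s0.
have mY_ n : dmeas E (Y_ n : RR -> H).
  by have [cYn _ _] := picard_invariant n; have [] := bmeas_continuous cYn.
have mY : dmeas E (Y : RR -> H) by exact: dmeas_lim YEE.
have bound_ n t : 0 <= t <= T -> `|Y_ n t - y t| <= b * 2 * expR (2 * a * t).
  move=> tT; have [_ /(_ t tT) h _] := picard_invariant n.
  rewrite (le_trans h)// ler_wpM2r ?expR_ge0// ler_wpM2l//.
  by rewrite gerBl divr_ge0// exprn_ge0.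
have tube_ n := tubeE (in_tube (lexx 2) (bound_ n)).
have bound t : 0 <= t <= T -> `|Y t - y t| <= b * 2 * expR (2 * a * t).
  move=> tT; have h : `|Y_ n t - y t| @[n --> \oo] --> `|Y t - y t|.
    by apply: cvg_norm; apply: cvgB; [exact: YE|exact: cvg_cst].
  apply: (ler_cvg_to h (cvg_cst (b * 2 * expR (2 * a * t)))).
  by near=> n; exact: bound_.
have tube := tubeE (in_tube (lexx 2) bound).
have bY_ n := bmeas_tube (mY_ n) (tube_ n).
have bY := bmeas_tube mY tube.
have wY t : 0 <= t <= T ->
    weakint leb E (fun s => sg_ext S (t - s) (f s (Y s) (u s))) (Y t - S t y0).
  move=> t0T; have /andP[t0 tT] := t0T.
  have [z wz] := weakint_exists mE finE sepH (bmeas_sg_ext tT bY).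
  suff -> : Y t - S t y0 = z by [].
  have h1 : Y_ n.+1 t - S t y0 @[n --> \oo] --> Y t - S t y0.
    by apply: cvgB; [have := YE t t0T; rewrite -cvg_shiftS|exact: cvg_cst].
  have fM_ n s : E s -> `|sg_ext S (t - s) (f s (Y_ n s) (u s))| <= K * (M * Cu).
    move=> Es; rewrite (le_trans (sg_ext_bound T_gt0 S_bounded _ _))//.
      by have /andP[s0 _] := E_itv Es; lra.
    rewrite ler_wpM2l ?K_ge0// (le_trans (bopE_norm _ _))// ler_pM ?uC//.
    by rewrite f_bounded// tube_.
  have fM s : E s -> `|sg_ext S (t - s) (f s (Y s) (u s))| <= K * (M * Cu).
    move=> Es; rewrite (le_trans (sg_ext_bound T_gt0 S_bounded _ _))//.
      by have /andP[s0 _] := E_itv Es; lra.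
    rewrite ler_wpM2l ?K_ge0// (le_trans (bopE_norm _ _))// ler_pM ?uC//.
    by rewrite f_bounded// tube.
  have h2 : Y_ n.+1 t - S t y0 @[n --> \oo] --> z.
    apply: (@weakint_cvg _ _ _ leb E mE finE H sepH
      (fun n s => sg_ext S (t - s) (f s (Y_ n s) (u s)))
      (fun s => sg_ext S (t - s) (f s (Y s) (u s))) _ _ (K * (M * Cu))) => //.
    - by move=> n; have [] := bmeas_sg_ext tT (bY_ n).
    - by have [] := bmeas_sg_ext tT bY.
    - move=> s Es; apply: bop_cvg.
      exact: (@bop_cvg _ _ _ (eval_bop H (u s)) _ _ _ _ _ (f_continuous Es (YEE s Es))).
    - by move=> n; exact: picardP.
  exact: cvg_unique h1 h2.
by exists Y; split => //; exact: (continuous_of_mild bY).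
Unshelve. all: by end_near. Qed.

End convergence.
End perturbation.
End trajectories.
End stability.

(** * Frechet derivatives and duality *)

(** Compactness of [a,b] as continuity induction: near the supremum of the times satisfying P, the
    step leads from a time just before it to one past it. It serves for the mean value inequality
    and for the tube. *)
Lemma interval_induction (R : realType) (a b : R) (P : R -> Prop) : a <= b -> P a ->
  (forall t, a <= t <= b -> exists2 d : R, 0 < d & forall s s' : R,
     a <= s -> s' <= b -> t - d < s <= t -> t <= s' < t + d -> P s -> P s') ->
  P b.
Proof.
move=> ab Pa step; pose A := [set t | a <= t <= b /\ P t].
have Aa : A a by split; rewrite ?lexx.
have supA : has_sup A by split; [exists a|exists b => t [/andP[]]].
have at0 : a <= sup A by apply: ub_le_sup => //; case: supA.
have tb : sup A <= b by apply: ge_sup => [|t [/andP[]]//]; exists a.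
have [|d d0 dP] := step (sup A); first by rewrite at0.
have [s As ts] := sup_adherent d0 supA.
have [/andP[as' sb] Ps] := As.
(* This time lies past the supremum unless it is cut off at b; hence the cut-off occurs and P b
   holds. *)
pose s' := Num.min b (sup A + d / 2).
have ts' : sup A <= s' by rewrite le_min tb lerDl divr_ge0// ltW.
have Ps' : P s'.
  apply: dP Ps => //; first by rewrite ge_min lexx.
    by rewrite ts /=; apply: ub_le_sup => //; case: supA.
  rewrite ts' /= gt_min; apply/orP; right.
  by rewrite ltrD2l ltr_pdivrMr// ltr_pMr// ltr1n.
have As' : A s' by split => //; rewrite (le_trans at0 ts') ge_min lexx.
have : s' <= sup A by apply: ub_le_sup => //; case: supA.
rewrite ge_min => /orP[bs|]; last by rewrite gerDl leNgt divr_gt0.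
have <- : s' = b; last by [].
by apply/eqP; rewrite eq_le ge_min lexx /= (le_trans bs ts').
Qed.

Section frechet_lemmas.
Context {R : realType} {V W : normedModType R}.

Lemma frechetE (F : V -> W) x : differentiable F x ->
  (frechet F x : V -> W) = 'd F x :> (V -> W).
Proof.
move=> dF; apply: (@xgetPex _ 0 [set B : bop V W | (B : V -> W) = 'd F x]).
have h : bop_pred ('d F x) by apply/asboolP; split; [exact: linearP|exact: diff_continuous].
by exists (Bop ('d F x) h).
Qed.

Lemma frechet_expansion (F : V -> W) x (e : R) : differentiable F x -> 0 < e ->
  exists2 d : R, 0 < d & forall h, `|h| < d ->
    `|F (x + h) - F x - frechet F x h| <= e * `|h|.
Proof.
move=> dF e0; have /eqaddoP/(_ _ e0)/nbhs_norm0P[d /= d0 dE] := diff_locally dF.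
exists d => // h hd; have := dE h hd.
by rewrite frechetE// !fctE /shift (addrC h) opprD addrA.
Qed.

(** The form in which differentiability is used: increments of order l leave a remainder o(l). The
    tolerance e/(C+1) also covers C = 0. *)
Lemma frechet_quotient_cvg (F : V -> W) x (h : nat -> V) (l : nat -> R) (C : R) :
  differentiable F x -> (forall n, 0 < l n) -> l n @[n --> \oo] --> (0 : R) ->
  (forall n, `|h n| <= C * l n) ->
  (l n)^-1 * `|F (x + h n) - F x - frechet F x (h n)| @[n --> \oo] --> (0 : R).
Proof.
move=> dF l0 lc hC; apply/cvgnP => e e0.
have C0 : 0 <= C.
  by rewrite -(pmulr_lge0 _ (l0 0%N)) (le_trans _ (hC 0%N)).
have C1 : 0 < C + 1 by rewrite ltr_wpDl.
have [d d0 dF'] := frechet_expansion dF (divr_gt0 e0 C1).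
have /cvgnP/(_ _ (divr_gt0 d0 C1))[N lN] := lc.
exists N => n /lN; rewrite subr0 gtr0_norm// ltr_pdivlMr// => ln.
rewrite subr0 ger0_norm ?mulr_ge0 ?invr_ge0 ?(ltW (l0 n))//.
rewrite mulrC ltr_pdivrMr//.
have hd : `|h n| < d by rewrite (le_lt_trans (hC n))// (le_lt_trans _ ln)// mulrC ler_wpM2l ?lerDl// ltW.
rewrite (le_lt_trans (dF' _ hd))//.
rewrite (@le_lt_trans _ _ (e / (C + 1) * (C * l n)))//.
  by apply: ler_wpM2l (hC n); rewrite divr_ge0// ltW.
rewrite mulrA ltr_pM2r// mulrAC ltr_pdivrMr// ltr_pM2l//.
by rewrite ltrDl.
Qed.

(* Continuity induction along the segment, which avoids the Hahn-Banach
   theorem for a normed target. *)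
Lemma mean_value_le (F : V -> W) (z w : V) (M : R) :
  (forall t, 0 <= t <= 1 -> differentiable F (z + t *: w) /\
     `|frechet F (z + t *: w)| <= M) ->
  `|F (z + w) - F z| <= M * `|w|.
Proof.
move=> dF; apply/ler_addgt0Pr => e e0.
(* The slack e pays for the first-order remainder at each point; having the bound for every e > 0
   gives the claim. *)
pose P (t : R) : Prop := `|F (z + t *: w) - F z| <= (M * `|w| + e) * t.
suff : P 1 by rewrite /P scale1r mulr1.
apply: (@interval_induction _ 0 1 P) => //; first by rewrite /P scale0r addr0 subrr normr0 mulr0.
move=> t t01; have [dFt Ft] := dF t t01.
have w1 : 0 < `|w| + 1 by rewrite ltr_wpDl.
have [d d0 dE] := frechet_expansion dFt (divr_gt0 e0 w1).
have key (k : R) : `|k| < d / (`|w| + 1) ->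
    `|F (z + (t + k) *: w) - F (z + t *: w)| <= (M * `|w| + e) * `|k|.
  move=> kd; have -> : z + (t + k) *: w = z + t *: w + k *: w by rewrite scalerDl addrA.
  have kw : `|k *: w| < d.
    rewrite normrZ; move: kd; rewrite ltr_pdivlMr//; apply: le_lt_trans.
    by rewrite ler_wpM2l// lerDl.
  rewrite -(subrK (frechet F (z + t *: w) (k *: w)) (F _ - _)).
  rewrite (le_trans (ler_normD _ _))// addrC mulrDl lerD//.
    by rewrite (le_trans (bopE_norm _ _))// normrZ -mulrA (mulrC `|w|) ler_wpM2r// mulr_ge0.
  rewrite (le_trans (dE _ kw))// normrZ mulrCA mulrC ler_wpM2r//.
  by rewrite mulrAC ler_pdivrMr// ler_pM2l// lerDl.
exists (d / (`|w| + 1)); first by rewrite divr_gt0.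
move=> s s' s0 s'1 /andP[ts st] /andP[ts' s't] Ps.
rewrite /P -(subrK (F (z + s *: w)) (F (z + s' *: w))) -addrA.
have -> : (M * `|w| + e) * s' = (M * `|w| + e) * (s' - s) + (M * `|w| + e) * s by ring.
rewrite (le_trans (ler_normD _ _))// lerD//.
rewrite -(subrK (F (z + t *: w)) (F (z + s' *: w))) -addrA.
rewrite (le_trans (ler_normD _ _))//.
have h1 := key (s' - t); rewrite subrKC in h1.
have h2 := key (s - t); rewrite subrKC in h2.
rewrite (distrC (F (z + t *: w))).
have -> : s' - s = `|s' - t| + `|s - t|.
  by rewrite ger0_norm ?subr_ge0// ler0_norm ?subr_le0// opprB addrA subrK.
by rewrite mulrDr lerD// ?h1 ?h2// ltr_norml; apply/andP; split; lra.
Qed.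

Lemma locally_lipschitz (F : V -> W) (c : V) (rho M : R) :
  (forall z, `|z - c| < rho -> differentiable F z /\ `|frechet F z| <= M) ->
  forall z z', `|z - c| < rho -> `|z' - c| < rho -> `|F z - F z'| <= M * `|z - z'|.
Proof.
move=> dF z z' hz hz'; rewrite -{1}(subrKC z' z); apply: mean_value_le => t /andP[t0 t1].
apply: dF; have -> : z' + t *: (z - z') - c = t *: (z - c) + (1 - t) *: (z' - c).
  have -> : z - z' = (z - c) - (z' - c) by rewrite opprB addrA subrK.
  by rewrite scalerBr scalerBl scale1r addrAC addrCA.
rewrite (le_lt_trans (ler_normD _ _))// !normrZ (ger0_norm t0) ger0_norm ?subr_ge0//.
have [->|tn0] := eqVneq t 0; first by rewrite mul0r add0r subr0 mul1r.
have -> : rho = t * rho + (1 - t) * rho by ring.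
rewrite ltr_leD//; first by rewrite ltr_pM2l// lt_neqAle eq_sym tn0.
by rewrite ler_wpM2l ?subr_ge0// ltW.
Qed.

End frechet_lemmas.

(** The adjoint equation differentiates x -> f s x (u s); the chain rule with the evaluation at w
    reduces this to the derivative of the operator-valued map. *)
Lemma frechet_eval (R : realType) (V U W : normedModType R) (F : V -> bop U W) x w h :
  differentiable F x ->
  differentiable (fun z => F z w) x /\
  frechet (fun z => F z w) x h = frechet F x h w.
Proof.
move=> dF; pose ev : {linear bop U W -> W} :=
  HB.pack (fun B : bop U W => B w) (GRing.isLinear.Build _ _ _ _ _ (@eval_linear R U W w)).
have cev : continuous ev by exact: (@bop_continuous _ _ _ (eval_bop W w)).
have dev : differentiable ev (F x) by exact: linear_differentiable.
have dc := differentiable_comp dF dev.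
split; first exact: dc.
have e1 := diff_comp dF dev; have e2 := diff_lin (F x) cev.
by rewrite frechetE// -[LHS]/('d (ev \o F) x h) e1 /= e2 /= frechetE.
Qed.

Section tube.
Context {R : realType} {H : hilbertType R}.

(** Local bounds, uniform in t, become one bound on a neighbourhood of the compact curve y. The time
    t of the field and the time s on the curve are independent. *)
Lemma uniform_tube (T : R) (y : R -> H) (C : R -> H -> R) : 0 < T ->
  {within `[0, T], continuous y} ->
  (forall x, exists r M : R, 0 < r /\ forall t z, 0 < t < T -> `|z - x| < r -> C t z <= M) ->
  exists rho M : R, [/\ 0 < rho, 0 < M & forall t s z, 0 < t < T -> 0 <= s <= T ->
    `|z - y s| < rho -> C t z <= M].
Proof.
move=> T0 /withinP cy Cloc.
pose P (tau : R) := exists rho M : R, [/\ 0 < rho, 0 < M &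
  forall t s z, 0 < t < T -> 0 <= s <= tau -> `|z - y s| < rho -> C t z <= M].
suff : P T by [].
apply: (@interval_induction _ 0 T) => //; first exact: ltW.
  have [r [M [r0 rM]]] := Cloc (y 0); exists r, (`|M| + 1); split => //.
  move=> t s z tT; rewrite -eq_le => /eqP <- zr; rewrite (le_trans (rM t z tT zr))//.
  by rewrite (le_trans (ler_norm M))// lerDl.
move=> t tT; have [r [M [r0 rM]]] := Cloc (y t).
have [||d d0 dy] := cy t (r / 2); [by rewrite /= in_itv|by rewrite divr_gt0|].
exists d => // s s' s0 s'T /andP[ts st] /andP[ts' s't] [rho [M' [rho0 M'0 rhoM]]].
(* Half the radius: for times within d of t the curve moves by less than r/2, so the ball of radius
   r/2 around it stays in the ball of radius r around y t. *)
exists (Num.min rho (r / 2)), (Num.max M' M); split.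
- by rewrite lt_min rho0 divr_gt0.
- by rewrite lt_max M'0.
move=> t' x z t'T /andP[x0 xs']; rewrite lt_min => /andP[z1 z2].
rewrite le_max; apply/orP; have [xs|sx] := leP x s.
  by left; apply: rhoM z1 => //; rewrite x0.
right; apply: rM => //.
rewrite -(subrK (y x) z) -addrA (le_lt_trans (ler_normD _ _))//.
rewrite -[r](@divfK _ 2)// mulr_natr mulr2n ltrD// dy//.
  by rewrite /= in_itv /= x0 (le_trans xs').
by rewrite ltr_norml; apply/andP; split; lra.
Qed.

End tube.

(** * Fubini's theorem and the duality of state and adjoint *)

Section fubini.
Context {R : realType}.
Local Notation leb := (@lebesgue_measure R).
Local Notation RR := (measurableTypeR R).
Variable E : set RR.
Hypotheses (mE : measurable E) (finE : (leb E < +oo)%E).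

(** F is extended by 0 from E x E to the whole plane, where Fubini's theorem is applied; real and
    extended integrals agree because all sections are bounded. *)
Lemma fubini_bounded (F : RR * RR -> R) (M : R) : measurable_fun (E `*` E) F ->
  (forall s t, E s -> E t -> `|F (s, t)| <= M) ->
  \int[leb]_(s in E) \int[leb]_(t in E) F (s, t) =
  \int[leb]_(t in E) \int[leb]_(s in E) F (s, t).
Proof.
move=> mF FM; have mEE : measurable (E `*` E) by exact: measurableX.
have finEE : ((leb \x leb)%E (E `*` E) < +oo)%E.
  by rewrite product_measure1E// lte_mul_pinfty// ge0_fin_numE.
have iF : (leb \x leb)%E.-integrable (E `*` E) (EFin \o F).
  by apply: (bounded_integrable mEE finEE mF) => -[s t] [Es Et]; exact: FM.
have iF' := (integrable_mkcond _ mEE).1 iF.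
have int1 s : E s -> leb.-integrable E (EFin \o (fun t => F (s, t))).
  move=> Es; apply: (@bounded_integrable _ _ _ leb E mE finE _ M) => [|t Et].
    by apply: (measurable_comp mEE _ mF) => [_ [t Et <-]//|];
      exact: (measurable_funTS (pair1_measurable s)).
  exact: FM.
have int2 t : E t -> leb.-integrable E (EFin \o (fun s => F (s, t))).
  move=> Et; apply: (@bounded_integrable _ _ _ leb E mE finE _ M) => [|s Es].
    by apply: (measurable_comp mEE _ mF) => [_ [s Es <-]//|];
      exact: (measurable_funTS (pair2_measurable t)).
  exact: FM.
have := Fubini iF' => fub; rewrite /Rintegral; congr fine.
transitivity (\int[leb]_x \int[leb]_y ((EFin \o F) \_ (E `*` E)) (x, y))%E.
  rewrite integral_mkcond; apply: eq_integral => s _; rewrite patchE.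
  case: ifPn => [|/negP nEs]; last first.
    rewrite integral0_eq// => t _; rewrite patchE memNset// => -[/= Es _].
    by apply: nEs; rewrite inE.
  rewrite inE => Es; rewrite fineK; last exact: integrable_fin_num (int1 s Es).
  rewrite integral_mkcond; apply: eq_integral => t _; rewrite !patchE.
  have [Et|nEt] := pselect (E t); first by rewrite !mem_set.
  by rewrite !memNset// => -[].
rewrite fub [in RHS]integral_mkcond; apply: eq_integral => t _; rewrite patchE.
case: ifPn => [|/negP nEt]; last first.
  rewrite integral0_eq// => s _; rewrite patchE memNset// => -[/= _ Et].
  by apply: nEt; rewrite inE.
rewrite inE => Et; rewrite fineK; last exact: integrable_fin_num (int2 t Et).
rewrite [in RHS]integral_mkcond; apply: eq_integral => s _; rewrite !patchE.
have [Es|nEs] := pselect (E s); first by rewrite !mem_set.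
by rewrite !memNset// => -[].
Qed.

End fubini.

Section duality.
Context {R : realType} {H : hilbertType R}.
Local Notation leb := (@lebesgue_measure R).
Local Notation RR := (measurableTypeR R).
Hypothesis (sepH : separable H).
Variables (T : R) (E : set RR).
Hypotheses (T_gt0 : 0 < T) (mE : measurable E) (ET : E `<=` `]0, T[%classic).
Variables (S : R -> bop H H) (K : R).
Hypothesis S_bounded : forall t, 0 <= t <= T -> `|S t| <= K.
Hypothesis S_continuous : forall (x : H) (t : nat -> R) (l : R),
  (forall n, 0 <= t n) -> 0 <= l ->
  t n @[n --> \oo] --> l -> S (t n) x @[n --> \oo] --> S l x.

(* Fubini applied to the double integral of q(s) S(s-t) g(t) over t < s. *)
Lemma adjoint_duality (p q : R -> bop H R) (pT : bop H R) (g delta : R -> H) (Mq : R) :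
  (forall x, bmeas E ((fun s => q s x) : RR -> R)) ->
  (forall s, E s -> `|q s| <= Mq) ->
  (forall t x, E t -> p t x = pT (S (T - t) x) +
     \int[leb]_(s in E) q s (sg_ext S (s - t) x)) ->
  bmeas E (g : RR -> H) ->
  (forall t, 0 <= t <= T -> weakint leb E (fun s => sg_ext S (t - s) (g s)) (delta t)) ->
  \int[leb]_(s in E) p s (g s) = pT (delta T) + \int[leb]_(s in E) q s (delta s).
Proof.
move=> bq qM pE bg wd.
have finE' : (leb E < +oo)%E := finE T_gt0 mE ET.
have TT : 0 <= T <= T by rewrite lexx ltW.
have Eitv s : E s -> 0 < s < T by move=> /ET; rewrite /= in_itv.
have [mg [Mg gM]] := bg.
have mEE : measurable (E `*` E) by exact: measurableX.
have bound s t : E s -> E t -> `|q s (sg_ext S (s - t) (g t))| <= Mq * (K * Mg).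
  move=> Es Et; rewrite (le_trans (bopE_norm _ _))// ler_pM ?qM//.
  have /andP[s0 sT] := Eitv s Es; have /andP[t0 tT] := Eitv t Et.
  rewrite (le_trans (sg_ext_bound T_gt0 S_bounded _ _))//; first by lra.
  rewrite ler_wpM2l ?gM//.
  by rewrite (le_trans _ (S_bounded (t := 0) _))// lexx ltW.
(* The first coordinate is the time of the source g, the second the time of q; [sg_ext] restricts to
   the triangle z.1 < z.2. *)
pose F (z : RR * RR) := q z.2 (sg_ext S (z.2 - z.1) (g z.1)).
have mF : measurable_fun (E `*` E) F.
  have fstE : @fst RR RR @` (E `*` E) `<=` E by move=> _ [[s t] [/= ? ?] <-].
  have sndE : @snd RR RR @` (E `*` E) `<=` E by move=> _ [[s t] [/= ? ?] <-].
  apply: (@measurable_bop _ _ _ _ (E `*` E) (fun z => q z.2)) => // [v|].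
    apply: (measurable_comp mE sndE (bmeas_measurable (bq v))).
    exact: measurable_funTS.
  apply: (dmeas_sg_ext_comp sepH S_continuous) => //.
    by apply: measurable_funB; apply: measurable_funTS.
  move=> v; apply: (measurable_comp mE fstE (mg v)).
  exact: measurable_funTS.
have fub := fubini_bounded mE finE' mF (fun s t Es Et => bound t s Et Es).
have bsg (t : R) : t <= T -> bmeas E (fun s : RR => sg_ext S (t - s) (g s)).
  by move=> tT; exact: (@bmeas_sg_ext R H sepH T E T_gt0 mE ET S K S_bounded S_continuous).
have bF2 s : E s -> bmeas E (fun t : RR => q s (sg_ext S (s - t) (g t))).
  move=> Es; have [z zE] := riesz (q s).
  have sT : s <= T by have /andP[_ /ltW] := Eitv s Es.
  apply: (eq_bmeas _ (bmeas_dot mE z sepH (bsg s sT))).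
  by move=> t _; rewrite zE.
have inner s : E s -> \int[leb]_(t in E) F (t, s) = q s (delta s).
  move=> Es; have [z zE] := riesz (q s); rewrite -zE.
  have /andP[s0 sT] := Eitv s Es.
  rewrite wd; last by rewrite !ltW.
  by apply: eq_Rintegral => t _; rewrite /F /= zE.
have bp1 : bmeas E (fun s : RR => pT (sg_ext S (T - s) (g s))).
  have [z zE] := riesz pT.
  apply: (eq_bmeas _ (bmeas_dot mE z sepH (bsg T (lexx T)))).
  by move=> t _; rewrite zE.
have pTE : pT (delta T) = \int[leb]_(s in E) pT (sg_ext S (T - s) (g s)).
  have [z zE] := riesz pT; rewrite -zE wd//.
  by apply: eq_Rintegral => t _; rewrite zE.
(* Integrability of the inner integral as a function of the outer variable, needed to split the
   integral of the sum below. *)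
have int2 : leb.-integrable E (EFin \o (fun t => \int[leb]_(s in E) F (t, s))).
  have iF : (leb \x leb)%E.-integrable setT ((EFin \o F) \_ (E `*` E)).
    apply/(integrable_mkcond _ mEE).
    have finEE : ((leb \x leb)%E (E `*` E) < +oo)%E.
      by rewrite product_measure1E// lte_mul_pinfty// ge0_fin_numE.
    apply: (@bounded_integrable _ _ _ _ _ mEE finEE _ (Mq * (K * Mg)) mF).
    by move=> [t s] [/= Et Es]; exact: bound.
  have := integrable_fubini_F iF => iG.
  have iG' := integrableS measurableT mE (@subsetT _ E) iG.
  apply: (eq_integrable mE _ _ _ iG') => t; rewrite inE => Et.
  rewrite /comp /Rintegral fineK; last first.
    apply: integrable_fin_num => //.
    apply: (@bounded_integrable _ _ _ leb E mE finE' _ (Mq * (K * Mg))) => [|s Es].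
      apply: (measurable_comp mEE _ mF) => [_ [s Es <-]//|].
      exact: (measurable_funTS (pair1_measurable t)).
    exact: bound.
  rewrite [in RHS]integral_mkcond; apply: eq_integral => s _; rewrite !patchE.
  have [Es|nEs] := pselect (E s); first by rewrite !mem_set.
  by rewrite !memNset// => -[].
rewrite pTE (@eq_Rintegral _ _ _ leb E (fun s => pT (sg_ext S (T - s) (g s)) +
   \int[leb]_(t in E) F (s, t))); last first.
  move=> s; rewrite inE => Es; rewrite pE//; congr (pT _ + _).
  by rewrite /sg_ext subr_gt0; have /andP[_ ->] := Eitv s Es.
rewrite (RintegralD mE (bmeas_integrable mE finE' bp1) int2).
congr (_ + _); rewrite fub; apply: eq_Rintegral => s; rewrite inE => Es.
exact: inner.
Qed.

End duality.

(** * Needle variations *)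

Lemma bop_apply_continuous (R : realType) (V W : normedModType R) (D : set R)
    (B : R -> bop V W) (w : R -> V) :
  {within D, continuous B} -> {within D, continuous w} ->
  {within D, continuous (fun s => B s (w s))}.
Proof.
move=> cB cw; apply: seq_within_continuous => t l tD lD tl.
have Bl := within_cvg cB tD lD tl; have wl := within_cvg cw tD lD tl.
rewrite (_ : (fun n => _) = fun n => (B (t n) - B l) (w (t n)) + B l (w (t n))); last first.
  by apply/funext => n; rewrite bop_subE subrK.
rewrite -[X in _ --> X]add0r; apply: cvgD; last exact: bop_cvg.
apply: (@squeeze0 _ _ _ _ (fun n => `|B (t n) - B l| * `|w (t n)|)) => [n|].
  by rewrite subr0 bopE_norm.
rewrite -[X in _ --> X](mul0r `|w l|); apply: cvgM; last exact: cvg_norm.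
rewrite -[X in _ --> X](@normr0 _ (bop V W)) -(subrr (B l)).
by apply: cvg_norm; apply: cvgB => //; exact: cvg_cst.
Qed.

Lemma bmeas_bop d (T : measurableType d) (R : realType) (V W : normedModType R)
    (E : set T) (B : T -> bop V W) (g : T -> V) (M : R) : measurable E -> separable V ->
  (forall v, dmeas E (fun x => B x v)) -> (forall x, E x -> `|B x| <= M) ->
  bmeas E g -> bmeas E (fun x => B x (g x)).
Proof.
move=> mE sV mB BM [mg [M' gM']]; split; first exact: dmeas_bop.
exists (M * M') => x Ex; rewrite (le_trans (bopE_norm _ _))// ler_pM//.
  exact: BM.
exact: gM'.
Qed.

Section common_domain.
Context {R : realType} {H U : hilbertType R}.
Local Notation leb := (@lebesgue_measure R).
Local Notation RR := (measurableTypeR R).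

(* The exceptional null sets of the functions f(.,x)w are first merged over
   countable dense sets of x and w. *)
Lemma common_measurable_domain (T : R) (f : R -> H -> bop U H) :
  separable H -> separable U -> measurable_in_time T f ->
  (forall t, 0 < t < T -> forall x, differentiable (f t) x) ->
  exists E : set RR, [/\ measurable E, E `<=` `]0, T[%classic,
    leb (`]0, T[%classic `\` E) = 0%E &
    forall x w, dmeas E ((fun t => f t x w) : RR -> H)].
Proof.
move=> sH sU fm fd; have [e [_ ed]] := separable_enum sH; have [k [_ kd]] := separable_enum sU.
have /choice[N NP] : forall ij : nat * nat, exists N : set RR,
    [/\ measurable N, leb N = 0%E &
        dmeas (`]0, T[%classic `\` N) ((fun t => f t (e ij.1) (k ij.2)) : RR -> H)].
  move=> [i j]; have [s [N [mN N0 sN]]] := fm (e i) (k j).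
  exists N; split => //; apply: (ae_limit_dmeas _ (And3 mN N0 sN)).
  exact: measurable_itv.
pose N0 := \bigcup_i \bigcup_j N (i, j).
have mN0 : measurable N0.
  apply: bigcupT_measurable => i; apply: bigcupT_measurable => j.
  by have [] := NP (i, j).
have N00 : leb N0 = 0%E.
  have : leb.-negligible N0.
    apply: negligible_bigcup => i; apply: negligible_bigcup => j.
    by have [mN NN0 _] := NP (i, j); exists (N (i, j)); split.
  by move/(measure_negligible mN0).
have mI : measurable (`]0, T[%classic : set RR) by exact: measurable_itv.
have mE : measurable ((`]0, T[%classic : set RR) `\` N0) by exact: measurableD.
exists (`]0, T[%classic `\` N0); split => //.
- apply/eqP; rewrite -measure_le0 -N00 le_measure ?inE//; first exact: measurableD.
  by move=> t [tT /not_andP[//|/contrapT]].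
move=> x w.
have /choice[i iP] : forall n : nat, exists i, `|x - e i| < n.+1%:R^-1.
  by move=> n; apply: ed; rewrite invr_gt0.
have /choice[j jP] : forall n : nat, exists j, `|w - k j| < n.+1%:R^-1.
  by move=> n; apply: kd; rewrite invr_gt0.
apply: (@dmeas_lim _ RR _ _ _ (fun n t => f t (e (i n)) (k (j n)))).
  move=> n; have [mN _ h] := NP (i n, j n).
  apply: (dmeasS _ _ h); first exact: measurableD.
  move=> t [tT nN]; split => // Nt; apply: nN.
  by exists (i n) => //; exists (j n).
move=> t [tT _].
have ei : e (i n) @[n --> \oo] --> x.
  by apply: (squeeze0 _ (@cvg_harmonic R)) => n; rewrite distrC ltW.
have kj : k (j n) @[n --> \oo] --> w.
  by apply: (squeeze0 _ (@cvg_harmonic R)) => n; rewrite distrC ltW.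
have fe : f t (e (i n)) @[n --> \oo] --> f t x.
  apply: continuous_cvg ei; apply: differentiable_continuous; apply: fd.
  by move: tT; rewrite /= in_itv.
apply: (@squeeze0 _ _ _ _ (fun n => `|f t (e (i n)) - f t x| * `|k (j n)| +
   `|f t x| * `|k (j n) - w|)) => [n|].
  have -> : f t (e (i n)) (k (j n)) - f t x w =
     (f t (e (i n)) - f t x) (k (j n)) + f t x (k (j n) - w).
    by rewrite bop_subE bopB addrA subrK.
  by rewrite (le_trans (ler_normD _ _))// lerD// bopE_norm.
have norm0 (V : normedModType R) (g : nat -> V) l :
    g n @[n --> \oo] --> l -> `|g n - l| @[n --> \oo] --> (0 : R).
  move=> gl; rewrite -[X in _ --> X](@normr0 _ V) -(subrr l).
  by apply: cvg_norm; apply: cvgB => //; exact: cvg_cst.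
rewrite -[X in _ --> X](addr0 0) -[X in _ --> X + _](mul0r `|w|).
rewrite -[X in _ --> _ + X](mulr0 `|f t x|).
apply: cvgD; first by apply: cvgM; [exact: norm0|exact: cvg_norm].
by apply: cvgMr; exact: norm0.
Qed.

End common_domain.

(** * The state equation on the common domain *)

Section control_problem.
Context {R : realType} {H U : hilbertType R}.
Local Notation leb := (@lebesgue_measure R).
Local Notation RR := (measurableTypeR R).
Hypotheses (sepH : separable H) (sepU : separable U).
Variables (T : R) (E : set RR).
Hypotheses (T_gt0 : 0 < T) (mE : measurable E) (ET : E `<=` `]0, T[%classic).
Hypothesis E_full : leb (`]0, T[%classic `\` E) = 0%E.
Variables (S : R -> bop H H) (K : R).
Hypothesis K_ge1 : 1 <= K.
Hypothesis S_bounded : forall t, 0 <= t <= T -> `|S t| <= K.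
Hypothesis S_continuous : forall (x : H) (t : nat -> R) (l : R),
  (forall n, 0 <= t n) -> 0 <= l ->
  t n @[n --> \oo] --> l -> S (t n) x @[n --> \oo] --> S l x.
Variables (f : R -> H -> bop U H) (y0 : H).
Hypothesis f_dmeas : forall x w, dmeas E ((fun t => f t x w) : RR -> H).
Hypothesis f_diff : forall t, 0 < t < T -> forall x, differentiable (f t) x.
Hypothesis f_loc : locally_bounded_C1 T f.

Let finE' : (leb E < +oo)%E := finE T_gt0 mE ET.
Let Eitv s : E s -> 0 < s < T. Proof. by move=> /ET; rewrite /= in_itv. Qed.
Let Eitv' s : E s -> 0 <= s <= T. Proof. by move=> /Eitv /andP[/ltW -> /ltW ->]. Qed.
Let K_gt0 : 0 < K. Proof. exact: lt_le_trans ltr01 K_ge1. Qed.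

Lemma field_continuous t : E t -> forall (x : nat -> H) (l : H),
  x n @[n --> \oo] --> l -> f t (x n) @[n --> \oo] --> f t l.
Proof.
move=> /Eitv tT x l xl; apply: continuous_cvg xl.
by apply: differentiable_continuous; exact: f_diff.
Qed.

(** The bound comes from a tube around Y itself, so it holds along every continuous trajectory and
    not only near the reference state. *)
Lemma bmeas_field (u : R -> U) (Y : R -> H) : {within `[0, T], continuous Y} ->
  bmeas E (u : RR -> U) -> bmeas E ((fun s => f s (Y s) (u s)) : RR -> H).
Proof.
move=> cY [mu [Mu uM]]; split.
  apply: (dmeas_nemytskii sepH sepU mE f_dmeas field_continuous) => //.
  by have [] := bmeas_continuous T_gt0 ET cY.
have [x|rho [M [rho0 M0 fM]]] := @uniform_tube _ _ T Y (fun t z => `|f t z|) T_gt0 cY.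
  have [r [M [r0 rM]]] := f_loc x; exists r, M; split => // t z tT zx.
  by have [] := rM t z tT zx.
exists (M * Mu) => s Es; rewrite (le_trans (bopE_norm _ _))// ler_pM ?uM//.
by apply: (fM s s) => //; [exact: Eitv|exact: Eitv'|rewrite subrr normr0].
Qed.

Lemma mild_of_state (u : R -> U) (Y : R -> H) : bmeas E (u : RR -> U) ->
  mild_state T S f y0 u Y -> mild T E S f y0 u Y.
Proof.
move=> bu [cY wY]; have bY := bmeas_field cY bu; split => // t tT.
have [z bz ->] := wY t tT; rewrite addrAC subrr add0r.
exact: (mild_weakint sepH T_gt0 mE ET E_full S_bounded S_continuous tT bY bz).
Qed.

Lemma state_of_mild (u : R -> U) (Y : R -> H) :
  mild T E S f y0 u Y -> mild_state T S f y0 u Y.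
Proof.
move=> [cY bY wY]; split => // t tT; exists (Y t - S t y0); last by rewrite subrKC.
exact: (mild_bochner sepH T_gt0 mE ET E_full S_bounded S_continuous tT bY (wY t tT)).
Qed.

Lemma state_mild (u : R -> U) : bmeas E (u : RR -> U) ->
  (exists Y, mild T E S f y0 u Y) -> mild T E S f y0 u (state T S f y0 u).
Proof.
move=> bu [Y mY]; apply: mild_of_state => //.
exact: (@xgetPex _ (cst 0) [set Y | mild_state T S f y0 u Y]
  (ex_intro _ Y (state_of_mild mY))).
Qed.

(** * The adjoint equation and the linearized cost *)

Section adjoint_equation.
Variables (l1 m : H -> R) (u1 : R -> U) (y : R -> H) (p : R -> bop H R).
Variable Sd : R -> bop (bop H R) (bop H R).
Hypothesis SdE : forall q x (t : R), 0 <= t -> Sd t q x = q (S t x).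
Hypotheses (l1_C1 : continuously_frechet l1) (m_C1 : continuously_frechet m).
Hypothesis u1_continuous : {within `[0, T], continuous u1}.
Hypothesis y_state : mild_state T S f y0 u1 y.
Hypothesis p_adjoint : mild_adjoint T f l1 Sd u1 y p.
Hypothesis p_final : p T = frechet m (y T).
Variables (rho M : R).
Hypotheses (rho_gt0 : 0 < rho) (M_gt0 : 0 < M).
Hypothesis f_tube : forall t s z, 0 < t < T -> 0 <= s <= T -> `|z - y s| < rho ->
  `|f t z| <= M.
Hypothesis df_tube : forall t s z, 0 < t < T -> 0 <= s <= T -> `|z - y s| < rho ->
  `|frechet (f t) z| <= M.
Hypothesis dl1_tube : forall s z, 0 <= s <= T -> `|z - y s| < rho ->
  `|frechet l1 z| <= M.

Let cy : {within `[0, T], continuous y}. Proof. by case: y_state. Qed.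
Let cp : {within `[0, T], continuous p}. Proof. by case: p_adjoint. Qed.
Let bu1 : bmeas E (u1 : RR -> U).
Proof. exact: bmeas_continuous T_gt0 ET _ _ u1_continuous. Qed.
Let by_ : bmeas E (y : RR -> H).
Proof. exact: bmeas_continuous T_gt0 ET _ _ cy. Qed.
Let bp : bmeas E (p : RR -> bop H R).
Proof. exact: bmeas_continuous T_gt0 ET _ _ cp. Qed.

Lemma y_mild : mild T E S f y0 u1 y. Proof. exact: mild_of_state. Qed.

Lemma field_lipschitz t z z' : E t -> `|z - y t| < rho -> `|z' - y t| < rho ->
  `|f t z - f t z'| <= M * `|z - z'|.
Proof.
move=> Et; apply: locally_lipschitz => {}z zt; split; first exact/f_diff/Eitv.
by apply: (df_tube _ _ zt); [exact: Eitv|exact: Eitv'].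
Qed.

Lemma running_cost_lipschitz t z : E t -> `|z - y t| < rho ->
  `|l1 z - l1 (y t)| <= M * `|z - y t|.
Proof.
move=> Et zt; apply: (@locally_lipschitz _ _ _ l1 (y t) rho) => //.
  move=> {zt}z zt; split; first by case: l1_C1.
  by apply: (dl1_tube _ zt); exact: Eitv'.
by rewrite subrr normr0.
Qed.

(** The source term of the adjoint equation, with its dependence on p frozen: [adjoint_duality]
    treats it as a given function. *)
Let q s := dual_adj (frechet (fun x => f s x (u1 s)) (y s)) (p s) + frechet l1 (y s).

Let qE s x : E s ->
  q s x = p s (frechet (f s) (y s) x (u1 s)) + frechet l1 (y s) x.
Proof.
move=> Es; rewrite /q bop_addE /= (frechet_eval _ _ _).2//.
by apply: f_diff; exact: Eitv.
Qed.

(** The derivative is a pointwise limit of difference quotients with steps 1/(n+1), and these are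
    measurable in time. *)
Lemma dmeas_linearization x :
  dmeas E ((fun s => frechet (f s) (y s) x (u1 s)) : RR -> H).
Proof.
pose h (n : nat) : R := n.+1%:R^-1.
have h0 n : 0 < h n by rewrite invr_gt0.
apply: (@dmeas_lim _ RR _ _ _ (fun n s => (h n)^-1 *:
   (f s (y s + h n *: x) (u1 s) - f s (y s) (u1 s)))).
  move=> n; apply: dmeasZ => //; apply: dmeasB => //.
    apply: (@dmeas_nemytskii _ _ _ sepH sepU E mE f f_dmeas field_continuous
      (fun s => y s + h n *: x)); last by case: bu1.
    by apply: dmeasD => //; case: by_.
  by have [] := bmeas_field cy bu1.
move=> s Es; have sT := Eitv Es.
have hc : h n @[n --> \oo] --> (0 : R) by exact: cvg_harmonic.
have /= q0 := @frechet_quotient_cvg _ _ _ (f s) (y s) (fun n => h n *: x) h `|x|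
  (f_diff sT _) h0 hc _.
apply: (@squeeze0 _ _ _ _ (fun n => (h n)^-1 * `|f s (y s + h n *: x) - f s (y s) -
   frechet (f s) (y s) (h n *: x)| * `|u1 s|)) => [n|]; last first.
  rewrite -[X in _ --> X](mul0r `|u1 s|); apply: cvgMl; apply: q0 => n.
  by rewrite normrZ gtr0_norm// mulrC.
have -> : (h n)^-1 *: (f s (y s + h n *: x) (u1 s) - f s (y s) (u1 s)) -
    frechet (f s) (y s) x (u1 s) =
    (h n)^-1 *: ((f s (y s + h n *: x) - f s (y s) -
      frechet (f s) (y s) (h n *: x)) (u1 s)).
  rewrite !bop_subE bopZ bop_scaleE [in RHS]scalerBr scalerA mulVf ?scale1r//.
  by rewrite gt_eqF.
rewrite normrZ normfV gtr0_norm// -mulrA ler_wpM2l ?bopE_norm// invr_ge0 ltW//.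
Qed.

Lemma linearization_bound s x : E s -> `|frechet (f s) (y s) x| <= M * `|x|.
Proof.
move=> Es; rewrite (le_trans (bopE_norm _ _))// ler_wpM2r//.
by apply: (df_tube (Eitv Es) (Eitv' Es)); rewrite subrr normr0.
Qed.

Lemma bmeas_linearization (d : RR -> H) : bmeas E d ->
  bmeas E ((fun s => frechet (f s) (y s) (d s) (u1 s)) : RR -> H).
Proof.
move=> [md [Md dM]]; have [mu [Mu uM]] := bu1; split; last first.
  exists (M * Md * Mu) => s Es; rewrite (le_trans (bopE_norm _ _))// ler_pM ?uM//.
  by rewrite (le_trans (linearization_bound _ Es))// ler_wpM2l ?dM// ltW.
apply: (@caratheodory _ RR _ _ _ sepH E (fun s x => frechet (f s) (y s) x (u1 s))) => //.
  exact: dmeas_linearization.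
move=> s Es x l xl.
exact: (@bop_cvg _ _ _ (eval_bop H (u1 s)) _ _ _ _ _ (bop_cvg xl)).
Qed.

Let dmeas_p x : dmeas E ((fun s => p s x) : RR -> R).
Proof.
have cpx : {within `[0, T], continuous (fun s => p s x)}.
  apply: seq_within_continuous => t l tT lT tl.
  exact: (@bop_cvg _ _ _ (eval_bop R x) _ _ _ _ _ (within_cvg cp tT lT tl)).
by have [] := bmeas_continuous T_gt0 ET cpx.
Qed.

Lemma bmeas_costate (g : RR -> H) : bmeas E g -> bmeas E ((fun s => p s (g s)) : RR -> R).
Proof.
move=> bg; have [_ [Mp pM]] := bp.
by apply: (@bmeas_bop _ RR _ _ _ E (p : RR -> bop H R) g Mp).
Qed.

Let cdl1 : {within `[0, T], continuous (fun s => frechet l1 (y s))}.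
Proof.
move=> s; apply: continuous_comp; first exact: cy.
by case: l1_C1 => _; exact.
Qed.

Lemma bmeas_dl1 (g : RR -> H) : bmeas E g ->
  bmeas E ((fun s => frechet l1 (y s) (g s)) : RR -> R).
Proof.
move=> bg; have [_ [Ml lM]] := bmeas_continuous T_gt0 ET cdl1.
apply: (@bmeas_bop _ RR _ _ _ E (fun s => frechet l1 (y s)) g Ml) => // x.
have cl : {within `[0, T], continuous (fun s => frechet l1 (y s) x)}.
  apply: seq_within_continuous => t l tT lT tl.
  exact: (@bop_cvg _ _ _ (eval_bop R x) _ _ _ _ _ (within_cvg cdl1 tT lT tl)).
by have [] := bmeas_continuous T_gt0 ET cl.
Qed.

Let bq_at (g : RR -> H) : bmeas E g -> bmeas E ((fun s => q s (g s)) : RR -> R).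
Proof.
move=> bg; apply: (@eq_bmeas _ RR _ E _ (fun s =>
   p s (frechet (f s) (y s) (g s) (u1 s)) + frechet l1 (y s) (g s))).
  by move=> s Es; rewrite qE.
apply: bmeasD => //; first exact: separable_real.
  by apply: bmeas_costate; exact: bmeas_linearization.
exact: bmeas_dl1.
Qed.

Let q_bounded : exists Mq, forall s, E s -> `|q s| <= Mq.
Proof.
have [_ [Mp pM]] := bp; have [_ [Mu uM]] := bu1.
exists (`|Mp| * (M * `|Mu|) + M) => s Es; apply: bop_norm_le => [x|]; last first.
  by rewrite addr_ge0 ?mulr_ge0// ltW.
rewrite qE// (le_trans (ler_normD _ _))// mulrDl lerD//.
  rewrite (le_trans (bopE_norm _ _))// -mulrA ler_pM//.
    by rewrite (le_trans (pM _ Es))// ler_norm.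
  rewrite (le_trans (bopE_norm _ _))// mulrAC ler_pM ?linearization_bound//.
  by rewrite (le_trans (uM _ Es))// ler_norm.
rewrite (le_trans (bopE_norm _ _))// ler_wpM2r//.
by apply: (dl1_tube (Eitv' Es)); rewrite subrr normr0.
Qed.

(** The adjoint equation tested at x: evaluation at x is a bounded operator on the dual, so
    [bochner_bop] applies, and Sd is moved onto x as S. *)
Let adjoint_weak t x : E t -> p t x = frechet m (y T) (S (T - t) x) +
  \int[leb]_(s in E) q s (sg_ext S (s - t) x).
Proof.
move=> Et; have /andP[t0 tT] := Eitv Et.
have [_ /(_ t (Eitv' Et))[z bz ->]] := p_adjoint.
rewrite bop_addE SdE ?subr_ge0 ?(ltW tT)// p_final; congr (_ + _).
have [Mq qM] := q_bounded.
have mEt : measurable (E `&` `]t, T[%classic) by apply: measurableI => //; exact: measurable_itv.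
have SdS s : (E `&` `]t, T[%classic) s -> Sd (s - t) (q s) x = q s (sg_ext S (s - t) x).
  move=> [Es /=]; rewrite in_itv /= => /andP[ts _].
  by rewrite SdE ?subr_ge0 ?(ltW ts)// /sg_ext subr_gt0 ts.
have mq : measurable_fun E ((fun s => q s (sg_ext S (s - t) x)) : RR -> R).
  apply: bmeas_measurable; apply: bq_at; split.
    apply: (dmeas_sg_ext_comp sepH S_continuous mE _ (dmeas_cst x)).
    by apply: measurable_funB; [exact: measurable_time|exact: measurable_cst].
  exists (K * `|x|) => s Es; apply: (sg_ext_bound T_gt0 S_bounded).
  by have /andP[_ sT] := Eitv Es; lra.
have sub : `]t, T[%classic `<=` `]0, T[%classic.
  by move=> s /=; rewrite !in_itv /= => /andP[/(lt_trans t0) -> ->].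
have -> : z x = \int[leb]_(s in E `&` `]t, T[%classic) Sd (s - t) (q s) x.
  apply: (@bochner_bop _ RR _ leb `]t, T[%classic (E `&` `]t, T[%classic) _ mEt _ _ _
    (bop H R) (fun s => Sd (s - t) (q s)) z (eval_bop R x) (Mq * K) bz).
  - exact: measurable_itv.
  - by move=> s [].
  - rewrite (@le_lt_trans _ _ (leb `]0, T[%classic))//.
      by rewrite le_measure ?inE//; exact: measurable_itv.
    by rewrite lebesgue_itvT// ltry.
  - apply/eqP; rewrite -measure_le0 -E_full; apply: le_measure; rewrite ?inE.
    + by apply: measurableD => //; exact: measurable_itv.
    + by apply: measurableD => //; exact: measurable_itv.
    + by move=> s [st nEs]; split; [exact: sub|move=> Es; apply: nEs].
  - move=> s [Es]; rewrite /= in_itv /= => /andP[ts sT].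
    apply: bop_norm_le => [z'|]; last first.
      by rewrite mulr_ge0 ?(ltW K_gt0)// (le_trans _ (qM s Es)).
    rewrite SdE ?subr_ge0 ?(ltW ts)// (le_trans (bopE_norm _ _))// -mulrA ler_pM ?qM//.
    rewrite (le_trans (bopE_norm _ _))// ler_wpM2r// S_bounded// subr_ge0 ltW//=.
    by lra.
  - apply: (@eq_measurable_fun _ _ RR _ _ (fun s => q s (sg_ext S (s - t) x))).
      by move=> s; rewrite inE => Es; rewrite /= SdS.
    by apply: measurable_funS mq => // s [].
rewrite Rintegral_mkcondr; apply: eq_Rintegral => s; rewrite inE => Es.
have /andP[s0 sT] := Eitv Es.
rewrite patchE; case: ifPn => [|].
  by rewrite inE => st; rewrite SdS.
rewrite notin_setE /= in_itv /= sT andbT => /negP ts.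
rewrite /sg_ext subr_gt0 (negbTE ts); exact/esym/(bop0 (q s)).
Qed.

(* The adjoint state turns the linearized cost into an integral of the defect
   of the linearized state equation. *)
Lemma variation_identity (u : R -> U) (Y : R -> H) : mild T E S f y0 u Y ->
  frechet m (y T) (Y T - y T) + \int[leb]_(s in E) frechet l1 (y s) (Y s - y s) =
  \int[leb]_(s in E) p s (f s (Y s) (u s) - f s (y s) (u1 s) -
     frechet (f s) (y s) (Y s - y s) (u1 s)).
Proof.
move=> [cY bY wY]; have [_ byu wy] := y_mild; have [Mq qM] := q_bounded.
have bYy : bmeas E ((fun s => Y s - y s) : RR -> H).
  by apply: bmeasB => //; exact: (bmeas_continuous T_gt0 ET cY).
have bg : bmeas E ((fun s => f s (Y s) (u s) - f s (y s) (u1 s)) : RR -> H) by exact: bmeasB.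
have wd t : 0 <= t <= T -> weakint leb E (fun s =>
    sg_ext S (t - s) (f s (Y s) (u s) - f s (y s) (u1 s))) (Y t - y t).
  move=> t0T h; have /andP[_ tT] := t0T.
  have bsg (g : R -> H) : bmeas E (g : RR -> H) -> bmeas E (fun s : RR => sg_ext S (t - s) (g s)).
    by move=> bgg; exact: (bmeas_sg_ext sepH T_gt0 mE ET S_bounded S_continuous tT bgg).
  have := weakintB mE finE' sepH (bsg _ bY) (bsg _ byu) (wY t t0T) (wy t t0T) h.
  have -> : Y t - S t y0 - (y t - S t y0) = Y t - y t by rewrite opprB addrA subrK.
  by move=> ->; apply: eq_Rintegral => s _; rewrite bopB.
have bqx x : bmeas E ((fun s => q s x) : RR -> R) by apply: bq_at; exact: bmeas_cst.
have := adjoint_duality sepH T_gt0 mE ET S_bounded S_continuous bqx qM adjoint_weak bg wd.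
have bl := bmeas_dl1 bYy.
have bB := bmeas_costate (bmeas_linearization bYy).
rewrite (@eq_Rintegral _ _ _ leb E (fun s => p s (frechet (f s) (y s) (Y s - y s) (u1 s)) +
  frechet l1 (y s) (Y s - y s)) (fun s => q s (Y s - y s))); last first.
  by move=> s; rewrite inE => Es; rewrite qE.
rewrite RintegralD//; [|exact: bmeas_integrable..].
move=> dual.
transitivity (\int[leb]_(s in E) p s (f s (Y s) (u s) - f s (y s) (u1 s)) -
   \int[leb]_(s in E) p s (frechet (f s) (y s) (Y s - y s) (u1 s))).
  by rewrite dual; ring.
rewrite -(RintegralB mE (bmeas_integrable mE finE' (bmeas_costate bg))
  (bmeas_integrable mE finE' bB)).
by apply: eq_Rintegral => s _; rewrite -bopB.
Qed.

Let f_bound t z : E t -> `|z - y t| < rho -> `|f t z| <= M.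
Proof. by move=> Et; exact: f_tube (Eitv Et) (Eitv' Et). Qed.

(** [state] is some chosen mild solution; existence makes the choice meaningful, and the stability
    estimate holds for every mild solution, hence for the chosen one. *)
Lemma state_stable (u : R -> U) (Cu : R) : dmeas E (u : RR -> U) -> 0 < Cu ->
  (forall s, E s -> `|u s| <= Cu) ->
  stability_constant T K M Cu * control_dist E u1 u < rho ->
  mild T E S f y0 u (state T S f y0 u) /\
  forall t, 0 <= t <= T ->
    `|state T S f y0 u t - y t| <= stability_constant T K M Cu * control_dist E u1 u.
Proof.
move=> mu Cu0 uC small.
have mY : mild T E S f y0 u (state T S f y0 u).
  apply: state_mild; first by split => //; exists Cu.
  exact: (mild_exists sepH sepU T_gt0 mE ET S_bounded S_continuous rho_gt0 M_gt0 K_gt0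
    f_dmeas field_continuous f_bound field_lipschitz y_mild bu1 mu Cu0 uC small).
split => // t tT.
exact: (mild_stable sepH sepU T_gt0 mE ET S_bounded S_continuous rho_gt0 M_gt0 K_gt0
    f_bound field_lipschitz y_mild bu1 mu Cu0 uC mY small tT).
Qed.

(** Uniqueness is the case of control distance 0 in the stability estimate. *)
Lemma state_reference t : 0 <= t <= T -> state T S f y0 u1 t = y t.
Proof.
move=> tT; have [mu [Mu uM]] := bu1.
have d0 : control_dist E u1 u1 = 0.
  rewrite /control_dist (@eq_Rintegral _ _ _ leb E (cst 0)); last first.
    by move=> s _; rewrite subrr normr0.
  by rewrite Rintegral_cst// mul0r.
have C0 : 0 < `|Mu| + 1 by rewrite ltr_wpDl.
have [||_ /(_ t tT)] := @state_stable u1 (`|Mu| + 1) mu C0.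
- by move=> s Es; rewrite (le_trans (uM s Es))// (le_trans (ler_norm _))// lerDl.
- by rewrite d0 mulr0.
by rewrite d0 mulr0 normr_le0 subr_eq0 => /eqP.
Qed.

Let l1_continuous : continuous l1.
Proof. by move=> x; apply: differentiable_continuous; case: l1_C1. Qed.

Let continuous_cost (Y : R -> H) : {within `[0, T], continuous Y} ->
  {within `[0, T], continuous (fun s => l1 (Y s))}.
Proof.
by move=> cY s; apply: continuous_comp; [exact: cY|exact: l1_continuous].
Qed.

Lemma integral_full (h : R -> R) : {within `[0, T], continuous h} ->
  \int[leb]_(s in `[0, T]) h s = \int[leb]_(s in E) h s.
Proof.
move=> ch; pose D : set RR := `[0, T]%classic.
have mD : measurable D by exact: measurable_itv.
have ED : E `<=` D by move=> s /Eitv' sT; rewrite /D /= in_itv.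
have finD : (leb D < +oo)%E by rewrite lebesgue_measure_itv /= lte_fin T_gt0 ltry.
have cn : {within `[0, T], continuous (fun t => `|h t|)}.
  by move=> x; apply: cvg_norm; exact: ch.
have [c _ hc] := EVT_max (ltW T_gt0) cn.
rewrite /Rintegral (@negligible_integral _ _ _ leb D (D `\` E))//.
- congr (fine (integral _ _ _)); rewrite setDD; exact/setIidPr.
- exact: measurableD.
- apply: (@bounded_integrable _ RR _ leb D mD finD _ `|h c|).
    by apply/(@dmeas_realP _ RR); exact: dmeas_continuous.
  by move=> s Ds; apply: hc.
have -> : D `\` E = (`]0, T[%classic `\` E) `|` (([set 0] `|` [set T]) `\` E).
  apply/seteqP; split => s /=.
    rewrite /D /= !in_itv /= => -[/andP[s0 sT] nE].
    have [s00|sn0] := eqVneq s 0; first by right; split => //; left.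
    have [sTT|snT] := eqVneq s T; first by right; split => //; right.
    by left; split => //; rewrite !lt_neqAle s0 sT eq_sym sn0 snT.
  case=> -[]; rewrite /D /= !in_itv /=; first by move=> /andP[/ltW -> /ltW ->].
  by case=> -> nE; rewrite lexx (ltW T_gt0).
have m0T : measurable ([set 0] `|` [set T] : set RR).
  by apply: measurableU; exact: measurable_set1.
have mI : measurable (`]0, T[%classic : set RR) by exact: measurable_itv.
apply: null_set_setU => //; [exact: measurableD|exact: measurableD|].
apply/eqP; rewrite -measure_le0.
apply: (@le_trans _ _ (leb ([set 0] `|` [set T] : set RR))).
  by apply: le_measure; rewrite ?inE//; exact: measurableD.
by rewrite (@null_set_setU _ _ _ leb [set 0] [set T])//; exact: lebesgue_measure_set1.
Qed.

Lemma cost_mild (u : R -> U) : mild T E S f y0 u (state T S f y0 u) ->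
  cost T S f y0 l1 m u =
  \int[leb]_(s in E) l1 (state T S f y0 u s) + m (state T S f y0 u T).
Proof. by move=> [cY _ _]; rewrite /cost integral_full//; exact: continuous_cost. Qed.

(** * First-order expansion of the cost along a needle *)

Section needle_variation.
Variables (tau : R) (v : U) (Cu : R).
Hypotheses (tau_itv : 0 < tau < T) (Cu_gt0 : 0 < Cu) (v_le : `|v| <= Cu).
Hypothesis u1_le : forall s, E s -> `|u1 s| <= Cu.
Variable (P : R -> bop U R).
Hypothesis P_continuous : {within `[0, T], continuous P}.
Hypothesis P_def : forall t w, 0 <= t <= T -> P t w = p t (f t (y t) w).

Let hit (lambda s : R) := tau - lambda / 2 <= s <= tau + lambda / 2.

Let measurable_hit lambda : measurable_fun E (hit lambda : RR -> bool).
Proof.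
rewrite (_ : hit lambda = fun s => ~~ (s < tau - lambda / 2) && ~~ (tau + lambda / 2 < s)); last first.
  by apply/funext => s; rewrite /hit !leNgt.
apply: measurable_and; apply: measurableT_comp => //.
  exact: measurable_before.
by apply: measurable_fun_ltr; [exact: measurable_cst|exact: measurable_time].
Qed.

Let bmeas_hit (V : normedModType R) lambda (g : RR -> V) : bmeas E g ->
  bmeas E (fun s : RR => if hit lambda s then g s else 0).
Proof. by move=> bg; apply: bmeas_if => //; exact: bmeas_cst. Qed.

Let hit_integral lambda c : 0 < lambda -> lambda / 2 < tau -> lambda / 2 < T - tau ->
  \int[leb]_(s in E) (if hit lambda s then c else 0) = c * lambda.
Proof.
move=> l0 l1' l2'; pose N : set RR := `[tau - lambda / 2, tau + lambda / 2]%classic.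
have mN : measurable N by exact: measurable_itv.
have mEN : measurable (E `&` N) by exact: measurableI.
rewrite (@eq_Rintegral _ _ _ leb E ((cst c) \_ N)); last first.
  move=> s _; rewrite patchE /N; case: ifPn => h; first by rewrite mem_set//= in_itv.
  by rewrite memNset//= in_itv; exact/negP.
rewrite -Rintegral_mkcondr Rintegral_cst//; congr (_ * _).
have mI : measurable (`]0, T[%classic : set RR) by exact: measurable_itv.
rewrite -(measure_full_subset mE mI mN ET E_full).
rewrite (_ : _ `&` _ = N); last first.
  apply/setIidPr => s; rewrite /N /= !in_itv /= => /andP[h1 h2].
  by apply/andP; split; lra.
have leN : leb `[tau - lambda / 2, tau + lambda / 2]%classic = lambda%:E.
  by rewrite lebesgue_measure_itv /= lte_fin ifT; [congr EFin; field|lra].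
by rewrite -[lambda]/(fine lambda%:E) -leN.
Qed.

Let dmeas_needle lambda : dmeas E (needle u1 tau v lambda : RR -> U).
Proof.
by apply: (dmeas_if mE (measurable_hit lambda)) => //; case: bu1.
Qed.

Let needle_le lambda s : E s -> `|needle u1 tau v lambda s| <= Cu.
Proof. by move=> Es; rewrite /needle; case: ifP => // _; exact: u1_le. Qed.

(** On the needle, a set of measure lambda, the two controls differ by at most 2 Cu. *)
Let C := stability_constant T K M Cu * (2 * Cu).

Let st_ge0 : 0 <= stability_constant T K M Cu.
Proof. by rewrite /stability_constant !mulr_ge0 ?expR_ge0 ?ltW. Qed.

Let C_ge0 : 0 <= C. Proof. by rewrite !mulr_ge0// ltW. Qed.

(** The needle lies inside ]0,T[, so its full width counts, and the perturbed trajectory stays in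
    the tube. *)
Let small lambda :=
  [/\ 0 < lambda, lambda / 2 < tau, lambda / 2 < T - tau & C * lambda < rho].

Let hit_bound lambda (h : RR -> R) B : small lambda -> 0 <= B -> bmeas E h ->
  (forall s, E s -> hit lambda s -> `|h s| <= B) ->
  `|\int[leb]_(s in E) (if hit lambda s then h s else 0)| <= B * lambda.
Proof.
move=> [l0 lt lT _] B0 bh hB; rewrite -hit_integral//.
apply: (Rintegral_norm_le mE finE').
- exact: bmeas_hit.
- by apply: bmeas_hit; exact: bmeas_cst.
- by move=> s Es; case: ifP => [/(hB s Es)//|_]; rewrite normr0.
Qed.

Let dist_needle lambda : small lambda ->
  stability_constant T K M Cu * control_dist E u1 (needle u1 tau v lambda) <= C * lambda.
Proof.
move=> [l0 lt lT _]; rewrite /C -mulrA ler_wpM2l// -hit_integral//.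
apply: (Rintegral_le mE finE').
- apply: bmeas_norm; apply: bmeasB => //; split => //.
  by exists Cu => s; exact: needle_le.
- by apply: bmeas_hit; exact: bmeas_cst.
- move=> s Es; rewrite /needle -/(hit lambda s); case: ifP => _; last by rewrite subrr normr0.
  by rewrite (le_trans (ler_normB _ _))// mulr_natl mulr2n lerD// u1_le.
Qed.

Let Y lambda := state T S f y0 (needle u1 tau v lambda).

Let needle_state lambda : small lambda ->
  mild T E S f y0 (needle u1 tau v lambda) (Y lambda) /\
  forall t, 0 <= t <= T -> `|Y lambda t - y t| <= C * lambda.
Proof.
move=> sl; have [l0 _ _ lrho] := sl; have dl := dist_needle sl.
have [mY Yy] := state_stable (dmeas_needle lambda) Cu_gt0 (@needle_le lambda) (le_lt_trans dl lrho).
by split => // t tT; rewrite (le_trans (Yy t tT)).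
Qed.

Let tube lambda s : small lambda -> 0 <= s <= T -> `|Y lambda s - y s| < rho.
Proof.
by move=> sl sT; have [_ /(_ s sT) h] := needle_state sl; case: sl => _ _ _; exact: le_lt_trans.
Qed.

Let g s := P s (v - u1 s).

Let cg : {within `[0, T], continuous g}.
Proof.
apply: bop_apply_continuous => // s.
by apply: cvgB; [exact: cvg_cst|exact: u1_continuous].
Qed.

(** The remainders: [running] and [defect] are Taylor remainders of l_1 and f, hence o(lambda) at
    each time; [mixed] couples the changes of f and of the control, is O(lambda), and is integrated
    over the needle only, so it contributes O(lambda^2). *)
Let running lambda s := l1 (Y lambda s) - l1 (y s) - frechet l1 (y s) (Y lambda s - y s).
Let defect lambda s :=
  p s ((f s (Y lambda s) - f s (y s) - frechet (f s) (y s) (Y lambda s - y s)) (u1 s)).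
Let mixed lambda s := p s ((f s (Y lambda s) - f s (y s)) (v - u1 s)).

Let bmeas_diff lambda : small lambda -> bmeas E ((fun s => Y lambda s - y s) : RR -> H).
Proof.
move=> /needle_state[[cY _ _] _]; apply: bmeasB => //.
exact: (bmeas_continuous T_gt0 ET cY).
Qed.

Let bmeas_running lambda : small lambda -> bmeas E (running lambda : RR -> R).
Proof.
move=> sl; have [[cY _ _] _] := needle_state sl.
have sR : separable R by exact: separable_real.
apply: bmeasB => //; last by apply: bmeas_dl1; exact: bmeas_diff.
by apply: bmeasB => //; [exact: (bmeas_continuous T_gt0 ET (continuous_cost cY))|
  exact: (bmeas_continuous T_gt0 ET (continuous_cost cy))].
Qed.

Let bmeas_defect lambda : small lambda -> bmeas E (defect lambda : RR -> R).
Proof.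
move=> sl; have [[cY _ _] _] := needle_state sl; apply: bmeas_costate.
apply: (@eq_bmeas _ RR _ E _ (fun s => f s (Y lambda s) (u1 s) - f s (y s) (u1 s) -
   frechet (f s) (y s) (Y lambda s - y s) (u1 s))) => //.
apply: bmeasB => //; last by apply: bmeas_linearization; exact: bmeas_diff.
by apply: bmeasB => //; [exact: (bmeas_field cY bu1)|exact: (bmeas_field cy bu1)].
Qed.

Let bmeas_vu : bmeas E ((fun s => v - u1 s) : RR -> U).
Proof. by apply: bmeasB => //; exact: bmeas_cst. Qed.

Let bmeas_mixed lambda : small lambda -> bmeas E (mixed lambda : RR -> R).
Proof.
move=> sl; have [[cY _ _] _] := needle_state sl; apply: bmeas_costate.
apply: (@eq_bmeas _ RR _ E _ (fun s => f s (Y lambda s) (v - u1 s) - f s (y s) (v - u1 s))) => //.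
by apply: bmeasB => //; [exact: (bmeas_field cY bmeas_vu)|
  exact: (bmeas_field cy bmeas_vu)].
Qed.

Let bmeas_g : bmeas E (g : RR -> R). Proof. exact: (bmeas_continuous T_gt0 ET cg). Qed.

(** An exact identity: the costs are expanded at y, [variation_identity] replaces their linear parts
    by an integral against p, and [split3] decomposes its integrand. *)
Let quotientE lambda : small lambda -> needle_quotient T S f y0 l1 m u1 tau v lambda =
  \int[leb]_(s in E) (lambda^-1 * running lambda s) +
  lambda^-1 * (m (Y lambda T) - m (y T) - frechet m (y T) (Y lambda T - y T)) +
  \int[leb]_(s in E) (lambda^-1 * defect lambda s) +
  lambda^-1 * (\int[leb]_(s in E) (if hit lambda s then mixed lambda s else 0)) +
  lambda^-1 * (\int[leb]_(s in E) (if hit lambda s then g s else 0)).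
Proof.
move=> sl; have [mY _] := needle_state sl; have [cY _ _] := mY.
have TT : 0 <= T <= T by rewrite lexx ltW.
have m1 : mild T E S f y0 u1 (state T S f y0 u1).
  by apply: state_mild => //; exists y; exact: y_mild.
have bI (h : RR -> R) : bmeas E h -> leb.-integrable E (EFin \o h).
  by move=> bh; exact: (bmeas_integrable mE finE' bh).
rewrite /needle_quotient !cost_mild// -/(Y lambda) (state_reference TT).
rewrite [X in _ - (X + _)](@eq_Rintegral _ _ _ leb E (fun s => l1 (y s))); last first.
  by move=> s; rewrite inE => Es; rewrite state_reference//; exact: Eitv'.
rewrite !RintegralZl//; [|exact/bI/bmeas_defect|exact/bI/bmeas_running].
have bl Z : {within `[0, T], continuous Z} -> bmeas E ((fun s => l1 (Z s)) : RR -> R).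
  by move=> cZ; exact: (bmeas_continuous T_gt0 ET (continuous_cost cZ)).
have sR : separable R by exact: separable_real.
have -> : \int[leb]_(s in E) running lambda s =
   \int[leb]_(s in E) l1 (Y lambda s) - \int[leb]_(s in E) l1 (y s) -
   \int[leb]_(s in E) frechet l1 (y s) (Y lambda s - y s).
  rewrite -(RintegralB mE (bI _ (bl _ cY)) (bI _ (bl _ cy))).
  rewrite -RintegralB//; apply: bI; first by apply: bmeasB => //; exact: bl.
  by apply: bmeas_dl1; exact: bmeas_diff.
have key := variation_identity mY.
(* Off the needle the integrand is the Taylor remainder [defect]. On the needle f(Y)(v - u_1) is
   added, which is [mixed] plus f(y)(v - u_1), and p turns the latter into [g]. *)
have split3 : \int[leb]_(s in E) p s (f s (Y lambda s) (needle u1 tau v lambda s) -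
    f s (y s) (u1 s) - frechet (f s) (y s) (Y lambda s - y s) (u1 s)) =
  \int[leb]_(s in E) defect lambda s +
  \int[leb]_(s in E) (if hit lambda s then mixed lambda s else 0) +
  \int[leb]_(s in E) (if hit lambda s then g s else 0).
  have bd := bmeas_defect sl; have bm := bmeas_hit lambda (bmeas_mixed sl).
  have bg := bmeas_hit lambda bmeas_g.
  rewrite -(RintegralD mE (bI _ bd) (bI _ bm)).
  rewrite -(RintegralD mE (bI _ (bmeasD mE sR bd bm)) (bI _ bg)).
  apply: eq_Rintegral => s; rewrite inE => Es; rewrite /needle -/(hit lambda s).
  rewrite /defect /mixed /g; case: ifP => _; last by rewrite !addr0 !bop_subE.
  rewrite P_def; last exact: Eitv'.
  rewrite -!bopD; congr (p s _).
  set F := f s (Y lambda s); set G := f s (y s); set D := frechet (f s) _ _.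
  have -> : (F - G - D) (u1 s) = F (u1 s) - G (u1 s) - D (u1 s) by [].
  rewrite -[RHS]addrA [X in _ = _ + X](_ : _ = F v - F (u1 s)); last first.
    by rewrite bop_subE subrK bopB.
  by rewrite [RHS]addrC !addrA subrK.
move: split3; rewrite -key => {key}split3.
move: split3; set I0 := \int[_]_(s in E) frechet _ _ _.
set I1 := \int[_]_(s in E) defect _ _; set I2 := \int[_]_(s in E) _; set I3 := \int[_]_(s in E) _.
by move=> split3; rewrite -!mulrDr mulrC; congr (_ * _); move: split3; lra.
Qed.

Let P_bound : exists2 Mp, 0 <= Mp & forall s, E s -> `|p s| <= Mp.
Proof.
have [_ [Mp pM]] := bp; exists `|Mp| => // s Es.
by rewrite (le_trans (pM s Es))// ler_norm.
Qed.

Section along_sequence.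
Variable (lambda : nat -> R).
Hypotheses (lambda_small : forall n, small (lambda n)).
Hypothesis lambda_cvg : lambda n @[n --> \oo] --> (0 : R).

Let lambda_gt0 n : 0 < lambda n. Proof. by have [] := lambda_small n. Qed.

Let diff_le n s : 0 <= s <= T -> `|Y (lambda n) s - y s| <= C * lambda n.
Proof. by move=> sT; have [_ /(_ s sT)] := needle_state (lambda_small n). Qed.

Let scaled_le n (a B : R) : `|a| <= B * lambda n -> `|(lambda n)^-1 * a| <= B.
Proof.
move=> h; rewrite normrM normfV (gtr0_norm (lambda_gt0 n)) mulrC ler_pdivrMr//.
Qed.

Let running_cvg :
  \int[leb]_(s in E) ((lambda n)^-1 * running (lambda n) s) @[n --> \oo] --> (0 : R).
Proof.
apply: (Rintegral_cvg0 mE finE' (M := M * C + M * C)) => [n|n s Es|s Es].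
- apply: measurable_funM; first exact: measurable_cst.
  exact/bmeas_measurable/bmeas_running.
- have sT := Eitv' Es; apply: scaled_le; rewrite mulrDl (le_trans (ler_normB _ _))// lerD//.
    rewrite (le_trans (running_cost_lipschitz Es (tube (lambda_small n) sT)))//.
    by rewrite -mulrA ler_wpM2l ?diff_le// ltW.
  rewrite (le_trans (bopE_norm _ _))// -mulrA ler_pM ?diff_le//.
  by apply: (dl1_tube sT); rewrite subrr normr0.
have sT := Eitv' Es.
have /= q0 := @frechet_quotient_cvg _ _ _ l1 (y s) (fun n => Y (lambda n) s - y s) lambda C
  (l1_C1.1 _) lambda_gt0 lambda_cvg (fun n => diff_le n sT).
apply: (squeeze0 _ q0) => n; rewrite subr0 normrM normfV (gtr0_norm (lambda_gt0 n)).
by rewrite subrKC.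
Qed.

Let terminal_cvg : (lambda n)^-1 *
    (m (Y (lambda n) T) - m (y T) - frechet m (y T) (Y (lambda n) T - y T))
  @[n --> \oo] --> (0 : R).
Proof.
have TT : 0 <= T <= T by rewrite lexx ltW.
have /= q0 := @frechet_quotient_cvg _ _ _ m (y T) (fun n => Y (lambda n) T - y T) lambda C
  (m_C1.1 _) lambda_gt0 lambda_cvg (fun n => diff_le n TT).
apply: (squeeze0 _ q0) => n; rewrite subr0 normrM normfV (gtr0_norm (lambda_gt0 n)).
by rewrite subrKC.
Qed.

Let defect_cvg :
  \int[leb]_(s in E) ((lambda n)^-1 * defect (lambda n) s) @[n --> \oo] --> (0 : R).
Proof.
have [Mp Mp0 pM] := P_bound.
apply: (Rintegral_cvg0 mE finE' (M := Mp * ((M * C + M * C) * Cu))) => [n|n s Es|s Es].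
- apply: measurable_funM; first exact: measurable_cst.
  exact/bmeas_measurable/bmeas_defect.
- have sT := Eitv' Es; apply: scaled_le; rewrite -!mulrA (le_trans (bopE_norm _ _))//.
  rewrite ler_pM ?pM// (mulrC Cu) mulrA (le_trans (bopE_norm _ _))// ler_pM ?u1_le//.
  rewrite (le_trans (ler_normB _ _))// mulrDl lerD//.
    have h0 : `|y s - y s| < rho by rewrite subrr normr0.
    rewrite (le_trans (field_lipschitz Es (tube (lambda_small n) sT) h0))//.
    by rewrite -mulrA ler_wpM2l ?diff_le// ltW.
  rewrite (le_trans (linearization_bound _ Es))//.
  by rewrite -mulrA ler_wpM2l ?diff_le// ltW.
have sT := Eitv' Es.
have /= q0 := @frechet_quotient_cvg _ _ _ (f s) (y s) (fun n => Y (lambda n) s - y s) lambda C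
  (f_diff (Eitv Es) _) lambda_gt0 lambda_cvg (fun n => diff_le n sT).
have q1 : Mp * Cu * ((lambda n)^-1 * `|f s (y s + (Y (lambda n) s - y s)) - f s (y s) -
    frechet (f s) (y s) (Y (lambda n) s - y s)|) @[n --> \oo] --> (0 : R).
  by rewrite -[X in _ --> X](mulr0 (Mp * Cu)); apply: cvgMr.
apply: (squeeze0 _ q1) => n; rewrite subr0 normrM normfV (gtr0_norm (lambda_gt0 n)).
rewrite mulrCA ler_wpM2l ?invr_ge0 ?(ltW (lambda_gt0 n))// subrKC.
rewrite (le_trans (bopE_norm _ _))// -mulrA ler_pM ?pM// mulrC.
by rewrite (le_trans (bopE_norm _ _))// ler_wpM2l// u1_le.
Qed.

Let mixed_cvg : (lambda n)^-1 *
    (\int[leb]_(s in E) (if hit (lambda n) s then mixed (lambda n) s else 0))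
  @[n --> \oo] --> (0 : R).
Proof.
have [Mp Mp0 pM] := P_bound.
have c0 : Mp * (M * C * (2 * Cu)) * lambda n @[n --> \oo] --> (0 : R).
  by rewrite -[X in _ --> X](mulr0 (Mp * (M * C * (2 * Cu)))); apply: cvgMr.
apply: (squeeze0 _ c0) => n; rewrite subr0; apply: scaled_le.
apply: hit_bound => //; last 2 first.
- exact: bmeas_mixed.
- move=> s Es _; have sT := Eitv' Es; rewrite -mulrA (le_trans (bopE_norm _ _))//.
  rewrite ler_pM ?pM// mulrAC (le_trans (bopE_norm _ _))// ler_pM//.
    have h0 : `|y s - y s| < rho by rewrite subrr normr0.
    rewrite (le_trans (field_lipschitz Es (tube (lambda_small n) sT) h0))//.
    by rewrite -mulrA ler_wpM2l ?diff_le// ltW.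
  by rewrite (le_trans (ler_normB _ _))// mulr_natl mulr2n lerD// u1_le.
by rewrite !mulr_ge0// ltW.
Qed.

Let average_cvg : (lambda n)^-1 *
    (\int[leb]_(s in E) (if hit (lambda n) s then g s else 0))
  @[n --> \oo] --> g tau.
Proof.
have sR : separable R by exact: separable_real.
have tauT : 0 <= tau <= T by case/andP: tau_itv => /ltW -> /ltW ->.
apply/cvgnP => e e0; have e20 : 0 < e / 2 by rewrite divr_gt0.
have [|d d0 dg] := (withinP _ _).1 cg tau _ _ e20; first by rewrite /= in_itv.
have /cvgnP/(_ _ d0)[N lN] := lambda_cvg; exists N => n /lN.
rewrite subr0 gtr0_norm// => ld; have [l0 lt lT _] := lambda_small n.
rewrite (@le_lt_trans _ _ (e / 2))//; last by lra.
have bgd : bmeas E ((fun s => g s - g tau) : RR -> R).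
  by apply: bmeasB => //; exact: bmeas_cst.
have bh := bmeas_hit (lambda n) bgd.
have bc := bmeas_hit (lambda n) (bmeas_cst E (g tau)).
have -> : \int[leb]_(s in E) (if hit (lambda n) s then g s else 0) =
    \int[leb]_(s in E) (if hit (lambda n) s then g s - g tau else 0) + g tau * lambda n.
  rewrite -hit_integral// -(RintegralD mE (bmeas_integrable mE finE' bh)
    (bmeas_integrable mE finE' bc)).
  by apply: eq_Rintegral => s _; case: ifP; rewrite ?subrK ?addr0.
rewrite mulrDr [_ * (g tau * _)]mulrC mulfK ?gt_eqF// addrK.
apply: scaled_le; apply: hit_bound => // [|s Es /andP[h1 h2]]; first exact: ltW.
(* Points of the needle are within lambda/2 of tau, and lambda < d. *)
apply: ltW; apply: dg; first by rewrite /= in_itv /= Eitv'.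
by rewrite ltr_norml; apply/andP; split; lra.
Qed.

Lemma quotient_seq_cvg :
  needle_quotient T S f y0 l1 m u1 tau v (lambda n) @[n --> \oo] --> P tau (v - u1 tau).
Proof.
have <- : 0 + 0 + 0 + 0 + g tau = P tau (v - u1 tau) by rewrite !add0r.
apply: cvg_trans (cvgD (cvgD (cvgD (cvgD running_cvg terminal_cvg) defect_cvg)
  mixed_cvg) average_cvg).
by apply: near_eq_cvg; near=> n; rewrite (quotientE (lambda_small n)).
Unshelve. all: by end_near. Qed.

End along_sequence.

Lemma needle_quotient_cvg :
  needle_quotient T S f y0 l1 m u1 tau v lambda @[lambda --> 0^'+] --> P tau (v - u1 tau).
Proof.
apply/cvg_at_rightP => lambda [l0 lc]; have /andP[tau0 tauT] := tau_itv.
(* Below [e] all conditions of [small] hold; the denominator C + 1 allows for C = 0. *)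
pose e := Num.min (Num.min tau (T - tau)) (rho / (C + 1)).
have C1 : 0 < C + 1 by rewrite ltr_wpDl.
have e0 : 0 < e by rewrite !lt_min tau0 subr_gt0 tauT divr_gt0.
have /cvgnP/(_ _ e0)[N lN] := lc.
rewrite -(@cvg_shiftn N); apply: quotient_seq_cvg => [n|]; last first.
  by move: lc; rewrite -(@cvg_shiftn N).
have := lN (n + N)%N (leq_addl _ _); have ln := l0 (n + N)%N.
rewrite subr0 gtr0_norm// !lt_min ltr_pdivlMr// => /andP[/andP[h1 h2] h3].
split => //; [lra|lra|rewrite mulrC (le_lt_trans _ h3)//].
by rewrite ler_pM2l// lerDl.
Qed.

End needle_variation.
End adjoint_equation.
End control_problem.

(** * The quadratic problem *)

Section adjoint_operator.
Context {R : realType} {X Y : hilbertType R}.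

Lemma hadjP (B : bop X Y) y x : dot (hadj B y) x = dot y (B x).
Proof.
suff [C CP] : exists C : bop Y X, forall y x, dot (C y) x = dot y (B x).
  exact: (@xgetPex _ 0 [set C : bop Y X | forall y x, dot (C y) x = dot y (B x)]
    (ex_intro _ C CP)).
have /choice[C CE] : forall y, exists z, forall x, dot z x = dot y (B x).
  by move=> z; exact: riesz (bop_comp (dotb z) B).
have Clin : linear C.
  by move=> a y1 y2; apply: dot_inj => h; rewrite dotDr dotZr !(dotC h) !CE dotDl dotZl.
have Cbound z : `|C z| <= `|B| * `|z|.
  apply: dot_norm_le_bop => [|h]; first by rewrite mulr_ge0.
  rewrite dotC CE (le_trans (cauchy_schwarz _ _))// mulrC mulrAC.
  by rewrite ler_wpM2r// bopE_norm.
by exists (lipschitz_bop Clin Cbound) => z h; exact: CE.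
Qed.

End adjoint_operator.

Lemma hadj_self_adjoint (R : realType) (X : hilbertType R) (Q : bop X X) :
  (forall x y, dot (Q x) y = dot x (Q y)) -> hadj Q = Q.
Proof.
by move=> Qs; apply: bopE => x; apply: dot_inj => h; rewrite dotC hadjP dotC -Qs dotC.
Qed.

(** Lax-Milgram gives surjectivity; coercivity with Cauchy-Schwarz gives c|x| <= |Bx|, hence
    injectivity and the bound 1/c for the inverse. *)
Lemma coercive_inverse (R : realType) (X : hilbertType R) (B : bop X X) (c : R) :
  0 < c -> (forall x y, dot (B x) y = dot x (B y)) ->
  (forall x, c * `|x| ^+ 2 <= dot (B x) x) -> exists C, is_bop_inverse B C.
Proof.
move=> c0 Bs Bc; have /choice[C CE] : forall h, exists z, forall x, dot (B z) x = dot h x.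
  by move=> h; exact: (lax_milgram (dotb h) c0 Bs Bc).
have BC h : B (C h) = h by apply: dot_inj => x; rewrite dotC CE dotC.
have Bi x : c * `|x| <= `|B x|.
  have [->|x0] := eqVneq x 0; first by rewrite normr0 mulr0.
  have nx : 0 < `|x| by rewrite normr_gt0.
  rewrite -(ler_pM2r nx) -mulrA -expr2 (le_trans (Bc x))//.
  by rewrite (le_trans (ler_norm _))// cauchy_schwarz.
have CB x : C (B x) = x.
  apply/eqP; rewrite -subr_eq0 -normr_le0 -(ler_pM2l c0) mulr0 (le_trans (Bi _))//.
  by rewrite bopB BC subrr normr0.
have Clin : linear C.
  move=> a h k; rewrite -[LHS](CB) BC -[in LHS](BC h) -[in LHS](BC k).
  by rewrite -bopZ -bopD CB.
have Cbound h : `|C h| <= c^-1 * `|h|.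
  by rewrite mulrC ler_pdivlMr// mulrC -{2}(BC h).
by exists (lipschitz_bop Clin Cbound); split => x; [exact: CB|exact: BC].
Qed.

Section quadratic_cost.
Context {R : realType} {U : hilbertType R}.
Variables (B : bop U R) (Q : bop U U) (c alpha : R) (w : U).
Hypothesis c_gt0 : 0 < c.
Hypothesis Q_self_adjoint : forall u v, dot (Q u) v = dot u (Q v).
Hypothesis Q_coercive : forall u, c * `|u| ^+ 2 <= dot (Q u) u.

Let L : bop U U := bop_comp (hadj B) B + hadj Q.

Lemma riccati_dot u v : dot (L u) v = B u * B v + dot (Q u) v.
Proof. by rewrite dotDl /= hadjP hadj_self_adjoint. Qed.

Lemma riccati_inverse : exists C, is_bop_inverse L C.
Proof.
apply: (coercive_inverse c_gt0) => [x y|x].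
  by rewrite [RHS]dotC !riccati_dot Q_self_adjoint (dotC x) mulrC.
by rewrite riccati_dot (le_trans (Q_coercive x))// lerDr -expr2 sqr_ge0.
Qed.

Let J v := 2^-1 * (B (v - w) - alpha) ^+ 2 + 2^-1 * dot v (Q v).

(** Exact because J is quadratic. Its linear coefficient is the stationarity condition, and its
    nonnegative second-order term makes that condition sufficient. *)
Let J_expansion u h t : J (u + t *: h) = J u +
  t * dot (L u - (hadj B (B w) + hadj B alpha)) h + t ^+ 2 / 2 * (B h ^+ 2 + dot (Q h) h).
Proof.
rewrite dotBl riccati_dot dotDl !hadjP /J -addrAC bopD !bopB bopD bopZ.
rewrite bopZ !(dotDl, dotDr, dotZl, dotZr) -(Q_self_adjoint h u) (dotC (Q h) u).
rewrite -(Q_self_adjoint u h) (dotC h (Q h)).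
by rewrite -[dot (B w : R) _]/(B w * B h) -[dot (alpha : R) _]/(alpha * B h)
  -[t *: B h]/(t * B h); field.
Qed.

Lemma quadratic_minimizer (C : bop U U) u : is_bop_inverse L C ->
  (forall v, J u <= J v) <-> u = C (hadj B (B w) + hadj B alpha).
Proof.
move=> [CL LC]; split=> [Jmin|->].
  rewrite -[LHS]CL; congr (C _); apply/eqP; rewrite -subr_eq0; apply/eqP.
  apply: dot_inj => h; rewrite dot0r dotC.
  apply: (quadratic_ge0_linear0 (b := B h ^+ 2 + dot (Q h) h)) => t.
  by have := Jmin (u + t *: h); rewrite J_expansion; lra.
move=> v; set u' := C _; rewrite -(subrKC u' v) -[v - u']scale1r J_expansion.
rewrite LC subrr dot0l mulr0 addr0 lerDl mulr_ge0// addr_ge0 ?sqr_ge0//.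
by rewrite (le_trans _ (Q_coercive _))// mulr_ge0 ?sqr_ge0// ltW.
Qed.

End quadratic_cost.

(** * The mode insertion gradient up to the endpoints *)

Section insertion_gradient.
Context {R : realType} {H U : hilbertType R}.

(** Interior times accumulate at every tau in [0,T], the endpoints included; this makes limits along
    the filter unique, so that [lim] can be evaluated. *)
Lemma itv_endpoint_proper (T tau : R) : 0 < T -> 0 <= tau <= T ->
  ProperFilter (within `]0, T[ (nbhs tau)).
Proof.
move=> T0 /andP[tau0 tauT]; apply: within_nbhs_proper => A [e /= e0 eA].
pose k := Num.min 1 (e / T) / 2.
have k0 : 0 < k by rewrite divr_gt0// lt_min ltr01 divr_gt0.
have k1 : k < 1.
  have : Num.min 1 (e / T) <= 1 by rewrite ge_min lexx.
  by rewrite /k; lra.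
have ke : k * T < e.
  rewrite -ltr_pdivlMr//; have : Num.min 1 (e / T) <= e / T by rewrite ge_min lexx orbT.
  have : 0 < e / T by rewrite divr_gt0.
  by rewrite /k; lra.
(* Moving tau towards the midpoint T/2 enters the open interval since 0 < k < 1, with displacement
   at most kT/2 < e. *)
exists (tau + k * (T / 2 - tau)); split; first by rewrite /= in_itv /=; apply/andP; split; nra.
apply: eA => /=; rewrite opprD addrA subrr sub0r normrN normrM gtr0_norm//.
rewrite (le_lt_trans _ ke)// ler_pM2l// ler_norml; apply/andP; split; lra.
Qed.

Variables (T : R) (S : R -> bop H H) (f : R -> H -> bop U H) (y0 : H) (l1 m : H -> R).
Variables (u1 : R -> U) (P : R -> bop U R).
Hypothesis T_gt0 : 0 < T.
Hypothesis u1_continuous : {within `[0, T], continuous u1}.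
Hypothesis P_continuous : {within `[0, T], continuous P}.
Hypothesis needle_cvg : forall tau v, 0 < tau < T ->
  needle_quotient T S f y0 l1 m u1 tau v lambda @[lambda --> 0^'+] --> P tau (v - u1 tau).

Let insertion_limitE tau v : 0 < tau < T ->
  insertion_limit T S f y0 l1 m u1 v tau = P tau (v - u1 tau).
Proof. by move=> /needle_cvg h; exact: (cvg_lim _ (h v)). Qed.

Let insertion_limit_cvg tau v : 0 <= tau <= T ->
  insertion_limit T S f y0 l1 m u1 v sigma @[sigma --> within `]0, T[ (nbhs tau)]
    --> P tau (v - u1 tau).
Proof.
move=> tauT; have cg : {within `[0, T], continuous (fun s => P s (v - u1 s))}.
  apply: bop_apply_continuous => // s.
  by apply: cvgB; [exact: cvg_cst|exact: u1_continuous].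
apply/cvgrPdist_lt => e e0.
have [|d d0 dg] := (withinP _ _).1 cg tau _ _ e0; first by rewrite /= in_itv.
exists d => //= s /= ts; rewrite in_itv /= => sT.
rewrite insertion_limitE// distrC; apply: dg; last by rewrite distrC.
by rewrite /= in_itv /=; case/andP: sT => /ltW -> /ltW ->.
Qed.

Lemma insertion_gradient_exists tau v : 0 <= tau <= T ->
  has_insertion_gradient T S f y0 l1 m u1 tau v.
Proof.
move=> tauT; rewrite /has_insertion_gradient; case: ifPn => [tT|_].
  by apply/cvg_ex; exists (P tau (v - u1 tau)); exact: needle_cvg.
by apply/cvg_ex; exists (P tau (v - u1 tau)); exact: insertion_limit_cvg.
Qed.

Lemma insertion_gradientE tau v : 0 <= tau <= T ->
  insertion_gradient T S f y0 l1 m u1 tau v = P tau (v - u1 tau).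
Proof.
move=> tauT; rewrite /insertion_gradient; case: ifPn => [tT|_].
  exact: insertion_limitE.
have FF := itv_endpoint_proper T_gt0 tauT.
apply: (@cvg_lim _ _ _ _ FF); [exact: Rhausdorff|exact: insertion_limit_cvg].
Qed.

End insertion_gradient.

Theorem theorem2p1 (R : realType) (H U : hilbertType R)
  (sepH : separable H) (sepU : separable U)
  (T : R) (T_gt0 : 0 < T) (y0 : H) (alpha_d : R) (alpha_d_lt0 : alpha_d < 0)
  (* A with domain D(A), its semigroup S(t), and the semigroup Sd(t) of A^* *)
  (DA : set H) (A : H -> H) (S : R -> bop H H)
  (A_generates : generates DA A S)
  (Sd : R -> bop (bop H R) (bop H R))
  (Ad_generates : generates (adjoint_dom DA A) (adjoint_op DA A) Sd)
  (l1 m : H -> R)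
  (l1_C1 : continuously_frechet l1) (m_C1 : continuously_frechet m)
  (l1_bounded : exists M, forall x, `|l1 x| <= M)
  (m_bounded : exists M, forall x, `|m x| <= M)
  (f : R -> H -> bop U H)
  (f_C1 : forall t, 0 < t < T -> continuously_frechet (f t))
  (f_measurable : measurable_in_time T f)
  (f_locally_bounded : locally_bounded_C1 T f)
  (* Q is the operator called R in the cost l_2 *)
  (Q : bop U U) (Q_self_adjoint : forall u v, dot (Q u) v = dot u (Q v))
  (gamma : R) (gamma_gt0 : 0 < gamma)
  (Q_coercive : forall u, gamma * `|u| ^+ 2 <= dot (Q u) u)
  (q : R) (q_ge1 : 1 <= q)
  (u1 : R -> U) (u1_continuous : {within `[0, T], continuous u1})
  (f_growth : linearly_bounded T f \/ small_horizon T S f y0 q u1)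
  (y : R -> H) (y_state : mild_state T S f y0 u1 y)
  (p : R -> bop H R) (p_adjoint : mild_adjoint T f l1 Sd u1 y p)
  (p_final : p T = frechet m (y T))
  (P : R -> bop U R) (P_continuous : {within `[0, T], continuous P})
  (P_def : forall t w, 0 <= t <= T -> P t w = p t (f t (y t) w)) :
  exists Pi : R -> bop U U,
    (forall t, 0 <= t <= T ->
      is_bop_inverse (bop_comp (hadj (P t)) (P t) + hadj Q) (Pi t)) /\
    forall tau, 0 <= tau <= T ->
      (forall v, has_insertion_gradient T S f y0 l1 m u1 tau v) /\
      forall u_opt : U,
        (forall v, l2 T S f y0 l1 m u1 alpha_d Q tau u_opt
                   <= l2 T S f y0 l1 m u1 alpha_d Q tau v) <->
        u_opt = Pi tau (hadj (P tau) (P tau (u1 tau)) + hadj (P tau) alpha_d).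
Proof.
have f_diff t : 0 < t < T -> forall x, differentiable (f t) x.
  by move=> /f_C1[].
have [E [mE ET E_full f_dmeas]] := common_measurable_domain sepH sepU f_measurable f_diff.
have [K K1 SK] := hilbert_sg_bounded A_generates T.
have Sc (x : H) (t : nat -> R) (l : R) : (forall n, 0 <= t n) -> 0 <= l ->
    t n @[n --> \oo] --> l -> S (t n) x @[n --> \oo] --> S l x.
  exact: (hilbert_sg_continuous A_generates).
have cy : {within `[0, T], continuous y} by case: y_state.
(* Bounding the sum of three nonnegative quantities yields one tube and one constant for all of
   them. *)
have [x|rho [M [rho0 M0 tubeM]]] := @uniform_tube _ _ T y
  (fun t z => `|f t z| + `|frechet (f t) z| + `|frechet l1 z|) T_gt0 cy.
  have [r [M [r0 rM]]] := f_locally_bounded x.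
  have [_ /(_ x)/cvgrPdist_lt/(_ _ ltr01)/nbhs_ballP[d /= d0 dl1]] := l1_C1.
  exists (Num.min r d), (M + M + (`|frechet l1 x| + 1)); split; first by rewrite lt_min r0.
  move=> t z tT; rewrite lt_min => /andP[zr zd]; have [h1 h2] := rM t z tT zr.
  rewrite !lerD// -[frechet l1 z](subrK (frechet l1 x)) addrC (le_trans (ler_normD _ _))//.
  rewrite lerD// distrC ltW// dl1//.
  by rewrite -ball_normE /= distrC.
(* A dummy time: the derivative of l_1 does not depend on t, but the tube bound asks for some
   interior t. *)
have h0 : 0 < T / 2 < T by apply/andP; split; lra.
have f_tube t s z : 0 < t < T -> 0 <= s <= T -> `|z - y s| < rho -> `|f t z| <= M.
  by move=> tT sT zs; rewrite (le_trans _ (tubeM t s z tT sT zs))// -addrA lerDl addr_ge0.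
have df_tube t s z : 0 < t < T -> 0 <= s <= T -> `|z - y s| < rho -> `|frechet (f t) z| <= M.
  by move=> tT sT zs; rewrite (le_trans _ (tubeM t s z tT sT zs))// addrAC lerDr addr_ge0.
have dl1_tube s z : 0 <= s <= T -> `|z - y s| < rho -> `|frechet l1 z| <= M.
  by move=> sT zs; rewrite (le_trans _ (tubeM _ s z h0 sT zs))// lerDr addr_ge0.
have [_ [Mu uM]] := bmeas_continuous T_gt0 ET u1_continuous.
have needle_cvg tau v : 0 < tau < T ->
    needle_quotient T S f y0 l1 m u1 tau v lambda @[lambda --> 0^'+] --> P tau (v - u1 tau).
  move=> tauT.
  (* [Cu] must bound both u_1 and v and be positive. *)
  apply: (needle_quotient_cvg sepH sepU T_gt0 mE ET E_full K1 SK Sc f_dmeas f_diff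
    f_locally_bounded (adjoint_sgE A_generates Ad_generates) l1_C1 m_C1 u1_continuous
    y_state p_adjoint p_final rho0 M0 f_tube df_tube dl1_tube
    (Cu := `|Mu| + `|v| + 1) tauT) => //.
  - by rewrite -addrA addrCA lerDl addr_ge0.
  - move=> s Es; rewrite (le_trans (uM s Es))// (le_trans (ler_norm Mu))// -addrA.
    by rewrite lerDl addr_ge0.
have /choice[Pi PiE] : forall t, exists C,
    is_bop_inverse (bop_comp (hadj (P t)) (P t) + hadj Q) C.
  by move=> t; exact: (riccati_inverse (P t) gamma_gt0 Q_self_adjoint Q_coercive).
exists Pi; split => [t _|tau tauT]; first exact: PiE.
split=> [v|u_opt].
  exact: (insertion_gradient_exists u1_continuous P_continuous needle_cvg).
rewrite -(quadratic_minimizer alpha_d (u1 tau) gamma_gt0 Q_self_adjoint Q_coercive u_opt (PiE tau)).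
have l2E v : l2 T S f y0 l1 m u1 alpha_d Q tau v =
    2^-1 * (P tau (v - u1 tau) - alpha_d) ^+ 2 + 2^-1 * dot v (Q v).
  by rewrite /l2 (insertion_gradientE T_gt0 u1_continuous P_continuous needle_cvg).
by split=> h v; have := h v; rewrite !l2E.
Qed.
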